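(* Let $\sigma$ be a smooth section of a smooth submersion $\pi\colon(P,k)\to(M,g)$ of Riemannian manifolds, with $M$ compact and $m=\dim M$. (i) For $r\in\{1,\dots,m\}$, if $\sigma$ is $r$-horizontal then $\sigma$ is an $r$-harmonic section. (ii) If $\pi$ is a Riemannian submersion with totally geodesic fibres and $\sigma$ is horizontal then $\sigma$ is an $r$-harmonic map $(M,g)\to(P,k)$ for all $r=1,\dots,m$.
   Context: Write $TP=\mathcal V\oplus\mathcal H$ with $\mathcal V=\ker d\pi$, $\mathcal H=\mathcal V^\perp$. The vertical derivative $d^v\sigma(X)$ is the $\mathcal V$-component of $d\sigma(X)$. The section $\sigma$ is horizontal if $d^v\sigma=0$, and $r$-horizontal if the rank of $d^v\sigma$ is everywhere less than $r$. Let $\varepsilon^v_r(\sigma)$ be the $r$-th elementary symmetric polynomial of the eigenvalues of the $(1,1)$-tensor $\alpha^v$ on $M$ with $g(\alpha^v(X),Y)=k(d^v\sigma(X),d^v\sigma(Y))$, and let $\mathcal E^v_r(\sigma)=\frac12\int_M\varepsilon^v_r(\sigma)\,\mathrm{vol}(g)$; $\sigma$ is an $r$-harmonic section if it is a critical point of $\mathcal E^v_r$ with respect to variations through sections. Let $\varepsilon_r(\sigma)$ be the $r$-th elementary symmetric polynomial of the eigenvalues of the $(1,1)$-tensor $\alpha$ with $g(\alpha(X),Y)=k(d\sigma(X),d\sigma(Y))$, and $\mathcal E_r(\sigma)=\frac12\int_M\varepsilon_r(\sigma)\,\mathrm{vol}(g)$; $\sigma$ is an $r$-harmonic map if it is a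 critical point of $\mathcal E_r$ with respect to all smooth variations through maps $M\to P$. *)

(* Defs.v *)
From HB Require Import structures.
From mathcomp Require Import all_boot all_order all_algebra.
From mathcomp Require Import all_classical all_reals all_analysis.

Set Implicit Arguments.
Unset Strict Implicit.
Unset Printing Implicit Defensive.

Import Order.TTheory GRing.Theory Num.Theory.
Import numFieldNormedType.Exports.

Local Open Scope classical_set_scope.
Local Open Scope ring_scope.

(* Vectors are rows and linear maps act on the right: the matrix L stands for
   v |-> v *m L, which is the convention of [jacobian].  *)

Section Calculus.
Context {R : realType}.

(* U is meant to be open and V, W finite-dimensional, so that directional
   derivatives of all orders determine all the higher differentials.  *)
Fixpoint Ck (V W : normedModType R) (k : nat) (U : set V) (f : V -> W) : Prop :=
  match k with
  | 0 => forall x, U x -> {for x, continuous f}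
  | j.+1 => (forall x, U x -> differentiable f x) /\
            (forall v, Ck j U (fun x => 'D_v f x))
  end.

Definition smooth_on (V W : normedModType R) (U : set V) (f : V -> W) : Prop :=
  forall k, Ck k U f.

(* Lebesgue integral over R^n of a nonnegative Borel function, as an iterated
   integral (Tonelli).  *)
Fixpoint lebesgue_int (n : nat) : ('rV[R]_n -> \bar R) -> \bar R :=
  match n with
  | 0 => fun f => f 0
  | j.+1 => fun f =>
      (\int[lebesgue_measure]_(x in [set: R])
         lebesgue_int (fun v : 'rV[R]_j =>
           f (row_mx (\row_(_ < 1) x) v : 'rV[R]_(1 + j))))%E
  end.

End Calculus.

Section Manifold.
Context {R : realType}.

Record chart (T : topologicalType) (n : nat) := Chart {
  dom : set T;
  img : set 'rV[R]_n;
  coord :> T -> 'rV[R]_n;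
  param : 'rV[R]_n -> T;
  open_dom : open dom;
  open_img : open img;
  coord_img : forall x, dom x -> img (coord x);
  param_dom : forall u, img u -> dom (param u);
  coordK : forall x, dom x -> param (coord x) = x;
  paramK : forall u, img u -> coord (param u) = u;
  coord_continuous : {within dom, continuous coord};
  param_continuous : {within img, continuous param}
}.

Record manifold (n : nat) := Manifold {
  space :> ptopologicalType;
  space_hausdorff : hausdorff_space space;
  space_countable : @second_countable space;
  atlas : set (chart space n);
  atlas_compat : forall c d, atlas c -> atlas d ->
    smooth_on (c @` (dom c `&` dom d)) (d \o param c);
  chart_at : space -> chart space n;
  chart_at_atlas : forall x, atlas (chart_at x);
  chart_at_dom : forall x, dom (chart_at x) x
}.

(* The tangent space at x is 'rV[R]_n: a tangent vector is given by its
   components in the preferred chart [chart_at x].  *)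

Definition smooth_map (m n : nat) (M : manifold m) (N : manifold n)
    (f : M -> N) : Prop :=
  continuous f /\
  forall c d, atlas c -> atlas d ->
    smooth_on (c @` (dom c `&` f @^-1` dom d)) (d \o f \o param c).

Definition tangent_map (m n : nat) (M : manifold m) (N : manifold n)
    (f : M -> N) (x : M) : 'M[R]_(m, n) :=
  jacobian (chart_at (f x) \o f \o param (chart_at x)) (chart_at x x).

(* Row i of [frame c x] is the coordinate vector field d/dc_i at x.  *)
Definition frame (n : nat) (M : manifold n) (c : chart M n) (x : M) : 'M[R]_n :=
  jacobian (chart_at x \o param c) (c x).

Definition local_form (n : nat) (M : manifold n) (c : chart M n)
    (g : M -> 'M[R]_n) (u : 'rV[R]_n) : 'M[R]_n :=
  frame c (param c u) *m g (param c u) *m (frame c (param c u))^T.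

Definition local_field (n : nat) (M : manifold n) (c : chart M n)
    (X : M -> 'rV[R]_n) (u : 'rV[R]_n) : 'rV[R]_n :=
  X (param c u) *m invmx (frame c (param c u)).

Definition smooth_field (n : nat) (M : manifold n) (X : M -> 'rV[R]_n) : Prop :=
  forall c, atlas c -> smooth_on (img c) (local_field c X).

Record metric (n : nat) (M : manifold n) := Metric {
  gram :> M -> 'M[R]_n;
  gram_sym : forall x, (gram x)^T = gram x;
  gram_gt0 : forall x (v : 'rV[R]_n), v != 0 -> 0 < (v *m gram x *m v^T) 0 0;
  gram_smooth : forall c, atlas c -> smooth_on (img c) (local_form c gram)
}.

Definition inner (n : nat) (M : manifold n) (g : metric M) (x : M)
    (u v : 'rV[R]_n) : R := (u *m g x *m v^T) 0 0.

Lemma gram_unit (n : nat) (M : manifold n) (g : metric M) (x : M) :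
  g x \in unitmx.
Proof.
rewrite -row_free_unit -kermx_eq0; apply/rowV0P => v /sub_kermxP vg0.
apply/eqP; apply: contraT => /(gram_gt0 g x).
by rewrite vg0 mul0mx mxE ltxx.
Qed.

(* Levi-Civita connection, in the chart [c] at [c x = u]:
   2 <Gamma(a,b),w> = (D_a G)(b,w) + (D_b G)(a,w) - (D_w G)(a,b).  *)
Definition christoffel (n : nat) (M : manifold n) (g : metric M)
    (c : chart M n) (u a b : 'rV[R]_n) : 'rV[R]_n :=
  let dG w := 'D_w (local_form c g) u in
  2^-1 *: (b *m dG a + a *m dG b
           - \row_j (a *m dG (delta_mx 0 j) *m b^T) 0 0)
    *m invmx (local_form c g u).

Definition nabla (n : nat) (M : manifold n) (g : metric M)
    (X Y : M -> 'rV[R]_n) (x : M) : 'rV[R]_n :=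
  'D_(X x) (local_field (chart_at x) Y) (chart_at x x)
  + christoffel g (chart_at x) (chart_at x x) (X x) (Y x).

End Manifold.

Arguments chart : clear implicits.
Arguments manifold : clear implicits.

Notation borel M := (g_sigma_algebraType (@open M)).

Section Volume.
Context {R : realType}.

(* vol(g): the Borel measure with density sqrt(det g_ij) in every chart.
   Since M is second countable, this determines it.  *)
Definition is_volume (n : nat) (M : manifold R n) (g : metric M)
    (vol : {measure set (borel M) -> \bar R}) : Prop :=
  forall c, atlas c ->
  forall A : set (borel M), measurable A -> A `<=` dom c ->
    vol A = lebesgue_int (fun u : 'rV[R]_n =>
      (\1_(c @` A) u * Num.sqrt (\det (local_form c g u)))%:E).

End Volume.

Section SymmetricFunctions.
Context {R : realType}.

(* Eigenvalues with multiplicity, for a matrix whose characteristic polynomial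
   splits over R; the tensors to which it is applied are self-adjoint.  *)
Definition eigenvalues (n : nat) (A : 'M[R]_n) : 'rV[R]_n :=
  xget 0 [set l : 'rV[R]_n | char_poly A = \prod_i ('X - (l 0 i)%:P)].

Definition elem_sym (n r : nat) (l : 'rV[R]_n) : R :=
  \sum_(I : {set 'I_n} | #|I| == r) \prod_(i in I) l 0 i.

End SymmetricFunctions.

Section Energy.
Context {R : realType} {m n : nat} {M : manifold R m} {P : manifold R n}.
Variables (g : metric M) (k : metric P).

(* For L : T_x M -> T_y P, the endomorphism A of T_x M such that
   g(A X, Y) = k(L X, L Y); see [pull_tensorP].  *)
Definition pull_tensor (x : M) (y : P) (L : 'M[R]_(m, n)) : 'M[R]_m :=
  L *m k y *m L^T *m invmx (g x).

Lemma pull_tensorP (x : M) (y : P) (L : 'M[R]_(m, n)) (A : 'M[R]_m) :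
  A = pull_tensor x y L <->
  forall X Y, inner g x (X *m A) Y = inner k y (X *m L) (Y *m L).
Proof.
have gU := gram_unit g x; rewrite /pull_tensor /inner; split=> [->|AE].
  by move=> X Y; rewrite !mulmxA mulmxKV// trmx_mul !mulmxA.
apply: (can_inj (mulmxK gU)); rewrite mulmxKV//.
apply/matrixP => i j; have := AE (delta_mx 0 i) (delta_mx 0 j).
rewrite trmx_mul !trmx_delta !mulmxA -!(mulmxA (delta_mx 0 i)) -!rowE -!colE.
by rewrite !mxE.
Qed.

Definition eps (r : nat) (s : M -> P) (x : M) : R :=
  elem_sym r (eigenvalues (pull_tensor x (s x) (tangent_map s x))).

Variable pr : P -> M.

Definition vertical (p : P) : 'M[R]_n := kermx (tangent_map pr p).

Definition horizontal (p : P) : 'M[R]_n := kermx (k p *m (vertical p)^T).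

Definition vproj (p : P) : 'M[R]_n := proj_mx (vertical p) (horizontal p).

Definition vtangent_map (s : M -> P) (x : M) : 'M[R]_(m, n) :=
  tangent_map s x *m vproj (s x).

Definition veps (r : nat) (s : M -> P) (x : M) : R :=
  elem_sym r (eigenvalues (pull_tensor x (s x) (vtangent_map s x))).

Variable vol : {measure set (borel M) -> \bar R}.

Definition energy (r : nat) (s : M -> P) : R :=
  2^-1 * \int[vol]_(x in [set: M]) eps r s x.

Definition venergy (r : nat) (s : M -> P) : R :=
  2^-1 * \int[vol]_(x in [set: M]) veps r s x.

(* Smooth maps ]-e, e[ * M -> P extending s at time 0.  *)
Definition variation (e : R) (s : M -> P) (F : R -> M -> P) : Prop :=
  [/\ 0 < e,
      forall x, F 0 x = s x,
      forall z : R^o * M, `|z.1| < e ->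
        {for z, continuous (fun z : R^o * M => F z.1 z.2)} &
      forall c d, atlas c -> atlas d ->
        smooth_on [set w : R^o * 'rV[R]_m |
                    [/\ `|w.1| < e, img c w.2 & dom d (F w.1 (param c w.2))]]
                  (fun w : R^o * 'rV[R]_m => d (F w.1 (param c w.2)))].

Definition is_section (s : M -> P) : Prop := forall x, pr (s x) = x.

Definition is_horizontal (s : M -> P) : Prop :=
  forall x, vtangent_map s x = 0.

Definition is_r_horizontal (r : nat) (s : M -> P) : Prop :=
  forall x, (\rank (vtangent_map s x) < r)%N.

Definition r_harmonic_section (r : nat) (s : M -> P) : Prop :=
  forall e F, variation e s F ->
    (forall t, `|t| < e -> is_section (F t)) ->
    is_derive (0 : R^o) 1 (fun t : R^o => venergy r (F t) : R^o) 0.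

Definition r_harmonic_map (r : nat) (s : M -> P) : Prop :=
  forall e F, variation e s F ->
    is_derive (0 : R^o) 1 (fun t : R^o => energy r (F t) : R^o) 0.

Definition submersion : Prop :=
  smooth_map pr /\ forall p, row_full (tangent_map pr p).

Definition riemannian_submersion : Prop :=
  submersion /\
  forall p u v, (u <= horizontal p)%MS -> (v <= horizontal p)%MS ->
    inner g (pr p) (u *m tangent_map pr p) (v *m tangent_map pr p)
    = inner k p u v.

Definition vertical_field (X : P -> 'rV[R]_n) : Prop :=
  smooth_field X /\ forall p, (X p <= vertical p)%MS.

(* The second fundamental form of every fibre, the horizontal component of
   nabla_X Y for X, Y vertical, vanishes.  *)
Definition totally_geodesic_fibres : Prop :=
  forall X Y, vertical_field X -> vertical_field Y ->
  forall p, nabla k X Y p *m proj_mx (horizontal p) (vertical p) = 0.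

End Energy.

(* Main.v *)
(* The r-th elementary symmetric function e_r of the eigenvalues of a tensor is,
   up to sign, a coefficient of its characteristic polynomial, so it is C^1 along
   a variation even where eigenvalues collide, and by compactness of M its
   expansion in t is uniform on M.

   (i) The vertical density is nonnegative along every variation and vanishes at
   t = 0 when the vertical derivative has rank < r; hence it is o(t).

   (ii) For a horizontal section of a Riemannian submersion the tensor alpha is
   the identity.  Near the identity,
     e_r = C(m,r) + C(m-1,r-1) (tr alpha - m) + O(sum_i (l_i - 1)^2),
   and the last term, nonnegative and zero at t = 0, is o(t).  Let F_t be the
   variation and h_t = pi o F_t, a variation of the identity of M.  The energy
   density tr alpha of F_t dominates that of h_t, with equality at t = 0, so the
   two agree up to o(t).  Finally the density of h_t is m + 2 t div Y + o(t), with
   Y the velocity of h_t, and the integral of div Y over M vanishes.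

   After localisation by a partition of unity this last integral becomes that of
   a derivative D_i phi in a chart.  Its Riemann sums over grids of cubes vanish:
   the mean value theorem provides sample points for which the sum telescopes. *)
Require Import Defs.
From HB Require Import structures.
From mathcomp Require Import all_boot all_order all_algebra.
From mathcomp Require Import all_classical all_reals all_analysis.
From mathcomp Require Import perm complex ring lra zify measurable_realfun.

Set Implicit Arguments.
Unset Strict Implicit.
Unset Printing Implicit Defensive.

Import Order.TTheory GRing.Theory Num.Theory.
Import numFieldNormedType.Exports.

Local Open Scope classical_set_scope.
Local Open Scope ring_scope.

(** * Pencils of quadratic forms *)

Section LinearAlgebra.
Context {R : realType}.

(** Matrices of tangent maps and tensors refer to the preferred chart at each point, an arbitrary
    choice, so their entries need not vary continuously. In a fixed chart a tensor becomes a
    conjugate of the form [S *m invmx G], with [S] positive semidefinite and [G] positive definite;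
    hence positivity is proved for such pencils, and only conjugation-invariant polynomials in the
    entries are differentiated.

    A C^1 function of t that is nonnegative near 0 and zero at 0 has a minimum there, so its
    derivative vanishes: this is how each inequality between densities becomes an o(t).

    Measurability of the densities at times other than 0 is never established. The integral is
    monotone for arbitrary functions, so a density uniformly close to a bounded measurable function
    has an integral close to that of this function, which also yields the existence of the
    derivative of the energy.

    The volume is given only by iterated integrals in charts. It is evaluated on coordinate cubes
    alone, where bounds on the density suffice; no change of variables or Fubini argument occurs. *)

Definition qform (n : nat) (S : 'M[R]_n) (u v : 'rV[R]_n) : R :=
  (u *m S *m v^T) 0 0.

Definition posdef (n : nat) (S : 'M[R]_n) : Prop :=
  S^T = S /\ forall v, v != 0 -> 0 < qform S v v.

Definition possemidef (n : nat) (S : 'M[R]_n) : Prop :=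
  S^T = S /\ forall v, 0 <= qform S v v.

Lemma qformC n (S : 'M[R]_n) u v : S^T = S -> qform S u v = qform S v u.
Proof.
move=> ST; rewrite /qform.
have -> : v *m S *m u^T = (u *m S *m v^T)^T by rewrite !trmx_mul trmxK ST mulmxA.
by rewrite [RHS]mxE.
Qed.

Lemma qformDl n (S : 'M[R]_n) u u' v :
  qform S (u + u') v = qform S u v + qform S u' v.
Proof. by rewrite /qform !mulmxDl mxE. Qed.

Lemma qformDr n (S : 'M[R]_n) u v v' :
  qform S u (v + v') = qform S u v + qform S u v'.
Proof. by rewrite /qform linearD mulmxDr mxE. Qed.

Lemma qformM n p (L : 'M[R]_(n, p)) (S : 'M[R]_p) u v :
  qform (L *m S *m L^T) u v = qform S (u *m L) (v *m L).
Proof. by rewrite /qform trmx_mul !mulmxA. Qed.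

Lemma posdef_unit n (S : 'M[R]_n) : posdef S -> S \in unitmx.
Proof.
case=> _ S0; rewrite -row_free_unit -kermx_eq0; apply/rowV0P => v /sub_kermxP vS.
apply/eqP; apply: contraT => /S0.
by rewrite /qform vS mul0mx mxE ltxx.
Qed.

Lemma posdef_congr n (L S : 'M[R]_n) :
  L \in unitmx -> posdef S -> posdef (L *m S *m L^T).
Proof.
move=> Lu [ST S0]; split; first by rewrite !trmx_mul trmxK ST mulmxA.
move=> v v0; rewrite qformM S0//; apply: contraNN v0 => /eqP vL0.
by rewrite -(mulmxK Lu v) vL0 mul0mx.
Qed.

Lemma posdef_free n p (L : 'M[R]_(n, p)) (S : 'M[R]_p) :
  row_free L -> posdef S -> posdef (L *m S *m L^T).
Proof.
move=> Lf [ST S0]; split; first by rewrite !trmx_mul trmxK ST mulmxA.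
move=> v v0; rewrite qformM S0//; apply: contraNN v0 => /eqP vL0.
by apply/eqP/(row_free_inj Lf); rewrite vL0 mul0mx.
Qed.

Lemma possemidef_congr n p (L : 'M[R]_(n, p)) (S : 'M[R]_p) :
  possemidef S -> possemidef (L *m S *m L^T).
Proof.
move=> [ST S0]; split; first by rewrite !trmx_mul trmxK ST mulmxA.
by move=> v; rewrite qformM S0.
Qed.

Lemma posdefW n (S : 'M[R]_n) : posdef S -> possemidef S.
Proof.
case=> ST S0; split=> // v; have [->|/S0/ltW//] := eqVneq v 0.
by rewrite /qform !mul0mx mxE.
Qed.

Lemma posdef_inv n (S : 'M[R]_n) : posdef S -> posdef (invmx S).
Proof.
move=> Spd; have Su := posdef_unit Spd.
have -> : invmx S = invmx S *m S *m (invmx S)^T.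
  by rewrite trmx_inv (proj1 Spd) mulmxK.
by apply: posdef_congr => //; rewrite unitmx_inv.
Qed.

(* If (a + ib) S = (p + iq) (a + ib) G, comparing a S b^T with b S a^T gives
   q (G(a,a) + G(b,b)) = 0. *)
Lemma pencil_eigenvalue n (S G : 'M[R]_n) (a b : 'rV[R]_n) (p q : R) :
  possemidef S -> posdef G -> (a != 0) || (b != 0) ->
  a *m S = p *: (a *m G) - q *: (b *m G) ->
  b *m S = q *: (a *m G) + p *: (b *m G) ->
  q = 0 /\ 0 <= p.
Proof.
move=> [ST S0] Gpd ab aS bS.
have lin (x y : R) (A B : 'M[R]_1) : (x *: A + y *: B) 0 0 = x * A 0 0 + y * B 0 0.
  by rewrite !mxE.
have E u : qform S a u = p * qform G a u - q * qform G b u.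
  by rewrite /qform aS -scaleNr mulmxDl -!scalemxAl lin mulNr.
have E' u : qform S b u = q * qform G a u + p * qform G b u.
  by rewrite /qform bS mulmxDl -!scalemxAl lin.
have Ga := (posdefW Gpd).2 a; have Gb := (posdefW Gpd).2 b.
have N0 : 0 < qform G a a + qform G b b.
  by case/orP: ab => /(Gpd.2) h; [apply: ltr_pwDl|apply: ltr_wpDl].
have q0 : q = 0.
  have := qformC a b ST; rewrite E E' (qformC b a Gpd.1) => h.
  have : q * (qform G a a + qform G b b) = 0 by rewrite mulrDr; lra.
  by move/eqP; rewrite mulf_eq0 (gt_eqF N0) orbF => /eqP.
split=> //; have := addr_ge0 (S0 a) (S0 b).
by rewrite E E' q0 !mul0r subr0 add0r -mulrDr pmulr_lge0.
Qed.

(** Over the complex numbers the characteristic polynomial splits. For a root z, a left eigenvector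
    v of [A] satisfies v S = z v G, and the real and imaginary parts of v are the a and b of
    [pencil_eigenvalue], so z is real and nonnegative. The factorisation then descends because the
    embedding of the reals is injective on polynomials. *)
Lemma pencil_split n (S G : 'M[R]_n) : possemidef S -> posdef G ->
  exists l : 'rV[R]_n, (forall i, 0 <= l 0 i) /\
    char_poly (S *m invmx G) = \prod_i ('X - (l 0 i)%:P).
Proof.
move=> Spsd Gpd; have Gu := posdef_unit Gpd.
set A := S *m invmx G; set p := char_poly A.
pose toC := real_complex R.
have [rs prs] := closed_field_poly_normal (map_poly toC p).
have rs_real z : z \in rs -> complex.Im z = 0 /\ 0 <= complex.Re z.
  move=> zrs; have : root (map_poly toC p) z.
    rewrite prs rootZ ?root_prod_XsubC//.
    by rewrite lead_coef_eq0 map_poly_eq0 monic_neq0// char_poly_monic.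
  rewrite map_char_poly -eigenvalue_root_char => /eigenvalueP[v vA v0].
  pose a := map_mx (@complex.Re R) v; pose b := map_mx (@complex.Im R) v.
  have vE : v = map_mx toC a + 'i%C *: map_mx toC b.
    by apply/rowP => j; rewrite !mxE -complexE.
  have vS : v *m map_mx toC S = z *: (v *m map_mx toC G).
    rewrite scalemxAl -vA -mulmxA -map_mxM; congr (_ *m map_mx _ _).
    by rewrite /A mulmxKV.
  have redim (B : 'M[R]_n) : v *m map_mx toC B =
      map_mx toC (a *m B) + 'i%C *: map_mx toC (b *m B).
    by rewrite [in LHS]vE mulmxDl -scalemxAl -!map_mxM.
  apply: (pencil_eigenvalue (a := a) (b := b) Spsd Gpd).
  - rewrite -negb_and; apply: contraNN v0 => /andP[/eqP a0 /eqP b0].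
    by rewrite vE a0 b0 !map_mx0 scaler0 addr0.
  - apply/rowP => j; move/rowP: vS => /(_ j); rewrite !redim.
    case: z {zrs vA} => x y /=; rewrite !mxE.
    by move=> /(congr1 (@complex.Re R)) /=; simpc => /=; lra.
  - apply/rowP => j; move/rowP: vS => /(_ j); rewrite !redim.
    case: z {zrs vA} => x y /=; rewrite !mxE.
    by move=> /(congr1 (@complex.Im R)) /=; simpc => /=; lra.
have pm : p \is monic := char_poly_monic A.
have prs' : map_poly toC p = map_poly toC (\prod_(z <- rs) ('X - (complex.Re z)%:P)).
  rewrite prs rmorph_prod /= (lead_coef_map toC) (monicP pm) scale1r.
  rewrite !big_seq; apply: eq_bigr => z /rs_real[Imz _].
  rewrite rmorphB /= map_polyX map_polyC /=; congr ('X - _%:P).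
  by rewrite [LHS]complexE Imz /= mulr0 addr0.
have /(map_poly_inj toC) pE := prs'.
have srs : size rs = n.
  have := size_char_poly A; rewrite -/p pE size_prod_XsubC => -[].
  by rewrite -[RHS]/n.
exists (\row_i complex.Re (nth 0 rs i)); split.
  by move=> i; rewrite mxE; apply: (rs_real _ _).2; rewrite mem_nth// srs.
rewrite -/p pE (big_nth 0) srs big_mkord; apply: eq_bigr => i _.
by rewrite mxE.
Qed.

(** This form of $e_r$ is polynomial in the entries of [A]. The subtraction [n - r] is truncated, so
    it agrees with [elem_sym] on eigenvalues only under [r <= n]. *)
Definition eigsym (n r : nat) (A : 'M[R]_n) : R :=
  (-1) ^+ r * (char_poly A)`_(n - r).

(** Vieta's formula: distributing the product chooses the root factor on a subset [I] and 'X off it,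
    which gives a monomial of degree [n - #|I|]. *)
Lemma coef_prod_XsubC (n r : nat) (l : 'rV[R]_n) : (r <= n)%N ->
  (\prod_i ('X - (l 0 i)%:P))`_(n - r) = (-1) ^+ r * elem_sym r l.
Proof.
move=> rn; under eq_bigr do rewrite addrC.
have E (I : {set 'I_n}) : \prod_i (if i \in I then - (l 0 i)%:P else 'X) =
    ((-1) ^+ #|I| * \prod_(i in I) l 0 i)%:P * 'X^(n - #|I|) :> {poly R}.
  rewrite (bigID (mem I)) /=; congr (_ * _).
    under eq_bigr => i iI do rewrite iI -polyCN -mulN1r.
    by rewrite -rmorph_prod big_split /= prodr_const.
  under eq_bigr => i iI do rewrite (negbTE iI).
  have <- : #|~: I| = (n - #|I|)%N by rewrite cardsCs finset.setCK card_ord.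
  by rewrite prodr_const; congr ('X^_); apply: eq_card => i; rewrite inE.
rewrite bigA_distr coef_sum /elem_sym mulr_sumr.
rewrite [LHS](bigID (fun I : {set 'I_n} => #|I| == r)) /= [X in _ + X]big1 ?addr0.
  by apply: eq_bigr => I /eqP Ir; rewrite E coefCM coefXn Ir eqxx mulr1.
(* From [n - r = n - #|I|] one gets [r = #|I|], both being at most [n], so truncation causes no
   collision of degrees. *)
move=> I Ir; rewrite E coefCM coefXn; case: eqP => [h|]; rewrite ?mulr0//.
have := max_card (mem I); rewrite card_ord => In.
by case/eqP: Ir; rewrite -(subKn rn) h subKn.
Qed.

(** [eigenvalues] is a choice with default 0; the existence of one factorisation makes the chosen
    vector a factorisation as well. *)
Lemma eigenvaluesP (n : nat) (A : 'M[R]_n) (l : 'rV[R]_n) :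
  char_poly A = \prod_i ('X - (l 0 i)%:P) ->
  char_poly A = \prod_i ('X - (eigenvalues A 0 i)%:P).
Proof. by move=> Al; rewrite /eigenvalues; case: xgetP => [? _ //|/(_ l)]. Qed.

Lemma elem_symE (n r : nat) (A : 'M[R]_n) (l : 'rV[R]_n) : (r <= n)%N ->
  char_poly A = \prod_i ('X - (l 0 i)%:P) -> elem_sym r l = eigsym r A.
Proof.
by move=> rn Al; rewrite /eigsym Al coef_prod_XsubC// mulrA -expr2 sqrr_sign mul1r.
Qed.

Lemma elem_sym_eigenvalues (n r : nat) (S G : 'M[R]_n) : (r <= n)%N ->
  possemidef S -> posdef G ->
  elem_sym r (eigenvalues (S *m invmx G)) = eigsym r (S *m invmx G).
Proof.
move=> rn Spsd Gpd; have [l [_ /eigenvaluesP Al]] := pencil_split Spsd Gpd.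
exact: elem_symE.
Qed.

Lemma eigsym_ge0 (n r : nat) (S G : 'M[R]_n) : (r <= n)%N ->
  possemidef S -> posdef G -> 0 <= eigsym r (S *m invmx G).
Proof.
move=> rn Spsd Gpd; have [l [l0 Al]] := pencil_split Spsd Gpd.
by rewrite -(elem_symE rn Al); apply: sumr_ge0 => I _; apply: prodr_ge0.
Qed.

Lemma char_poly_conj (n : nat) (U A : 'M[R]_n) : U \in unitmx ->
  char_poly (U *m A *m invmx U) = char_poly A.
Proof.
move=> Uu; pose C : 'M[R]_n -> 'M[{poly R}]_n := map_mx polyC.
have CU : C U *m C (invmx U) = 1%:M by rewrite -map_mxM mulmxV// map_mx1.
rewrite /char_poly /char_poly_mx !map_mxM.
have -> : 'X%:M - C U *m C A *m C (invmx U) =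
    C U *m ('X%:M - C A) *m C (invmx U).
  rewrite mulmxBr mulmxBl; congr (_ - _).
  by rewrite (scalar_mxC 'X (C U)) -mulmxA CU mulmx1.
by rewrite !det_mulmx mulrAC -det_mulmx CU det1 mul1r.
Qed.

Lemma eigsym_conj (n r : nat) (U A : 'M[R]_n) : U \in unitmx ->
  eigsym r (U *m A *m invmx U) = eigsym r A.
Proof. by move=> Uu; rewrite /eigsym char_poly_conj. Qed.

(** Conjugation by [col_ebase A] turns [A] into [pid_mx (\rank A) *m N], whose rows of index at
    least [\rank A] vanish. In every Leibniz term of the characteristic polynomial each such row
    contributes 'X or 0, so the polynomial is divisible by 'X to the power [n - \rank A], which
    exceeds [n - r]. *)
Lemma eigsym_rank (n r : nat) (A : 'M[R]_n) : (\rank A < r)%N -> (r <= n)%N ->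
  eigsym r A = 0.
Proof.
move=> Ar rn; rewrite /eigsym.
rewrite -(char_poly_conj A (U := invmx (col_ebase A))) ?unitmx_inv ?col_ebase_unit//.
rewrite invmxK -[in X in _ *m X *m _](mulmx_ebase A) !mulmxA mulVmx ?col_ebase_unit//.
rewrite mul1mx -mulmxA; set N := row_ebase A *m _; rewrite /char_poly /determinant coef_sum.
rewrite big1 ?mulr0// => s _.
have row0 (i j : 'I_n) : (\rank A <= i)%N ->
    char_poly_mx (pid_mx (\rank A) *m N) i j = 'X *+ (i == j).
  move=> iA; rewrite !mxE big1 ?subr0// => k _.
  by rewrite !mxE ltnNge iA andbF mul0r.
rewrite (bigID (fun i : 'I_n => (\rank A <= i)%N)) /=.
rewrite (eq_bigr (fun i => 'X * (i == s i)%:R)); last first.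
  by move=> i iA; rewrite row0//; case: (i == s i); rewrite /= ?mulr1 ?mulr0 ?mulr1n ?mulr0n.
rewrite big_split /= prodr_const.
have -> : #|[pred i : 'I_n | (\rank A <= i)%N]| = (n - \rank A)%N.
  rewrite -sum1_card -(big_geq_mkord _ _ predT (fun=> 1%N)) sum_nat_const_nat.
  by rewrite muln1.
rewrite -['X^_ * _ * _]mulrA mulrCA ['X^_ * _]mulrC coefMXn ltn_sub2l//.
exact: leq_trans rn.
Qed.

(** Adding [i] is a bijection from the r-subsets avoiding [i]. The number is the coefficient of each
    $l_i - 1$ in the first-order expansion of $e_{r+1}$ at $(1,\dots,1)$. *)
Lemma card_sets_containing (n r : nat) (i : 'I_n) :
  #|[set I : {set 'I_n} | (i \in I) && (#|I| == r.+1)]%SET| = 'C(n.-1, r).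
Proof.
have <- : #|~: [set i]| = n.-1 by rewrite cardsC1 card_ord.
rewrite -cards_draws.
rewrite -(card_in_imset (f := fun J => i |: J)); last first.
  move=> J J'; rewrite !inE => /andP[Ji _] /andP[J'i _] JJ'.
  have iJ (K : {set 'I_n}) : K \subset ~: [set i] -> (i |: K) :\ i = K.
    move=> Ki; rewrite finset.setU1K//; apply/negP => /(fintype.subsetP Ki).
    by rewrite !inE eqxx.
  by rewrite -(iJ J)// JJ' iJ.
apply: eq_card => I. rewrite inE; apply/andP/imsetP => [[iI /eqP Ir]|[J]].
  exists (I :\ i); last by rewrite finset.setD1K.
  by rewrite inE finset.subsetDr /= -eqSS -Ir (cardsD1 i I) iI.
rewrite inE => /andP[Ji /eqP Jr] ->; split; first by rewrite !inE eqxx.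
rewrite cardsU1 Jr; suff -> : i \notin J by [].
by apply/negP => /(fintype.subsetP Ji); rewrite !inE eqxx.
Qed.

(** [S] bounds all products of two deviations, squares included, so each deviation is at most 1.
    Prepending a factor at most doubles the error and adds [size s] times [S]; the constant $2^k k$
    absorbs this since $2 \cdot 2^k k + k \le 2^{k+1}(k+1)$. *)
Lemma prod_near1 (T : eqType) (s : seq T) (mu : T -> R) (S : R) : S <= 1 ->
  (forall i j, i \in s -> j \in s -> `|mu i| * `|mu j| <= S) ->
  `|\prod_(i <- s) (1 + mu i) - 1 - \sum_(i <- s) mu i|
    <= ((2 ^ size s) * size s)%:R * S.
Proof.
move=> S1; elim: s => [_|j s IH muS].
  by rewrite !big_nil subrr subr0 normr0 muln0 mul0r.
have {IH} /IH IHs : forall i k, i \in s -> k \in s -> `|mu i| * `|mu k| <= S.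
  by move=> i k si sk; apply: muS; rewrite in_cons ?si ?sk orbT.
have jj : `|mu j| * `|mu j| <= S by apply: muS; rewrite mem_head.
have S0 : 0 <= S by apply: le_trans jj; rewrite mulr_ge0.
have muj1 : `|mu j| <= 1.
  by rewrite -(expr_le1 (n := 2))// expr2 (le_trans jj).
have muSs : `|mu j * \sum_(i <- s) mu i| <= (size s)%:R * S.
  rewrite normrM (le_trans (ler_wpM2l _ (ler_norm_sum _ _ _)))// mulr_sumr.
  rewrite big_seq; apply: (@le_trans _ _ (\sum_(i <- s | i \in s) S)).
    by apply: ler_sum => i si; apply: muS; rewrite ?mem_head// in_cons si orbT.
  by rewrite -big_seq big_const_seq count_predT iter_addr_0 mulr_natl.
rewrite !big_cons; set p := \prod_(i <- s) _ in IHs *; set q := \sum_(i <- s) _ in IHs muSs *.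
have -> : (1 + mu j) * p - 1 - (mu j + q) = (p - 1 - q) * (1 + mu j) + mu j * q.
  by ring.
rewrite (le_trans (ler_normD _ _))//= normrM.
have h : `|p - 1 - q| * `|1 + mu j| <= ((2 ^ size s) * size s)%:R * S * 2.
  by rewrite ler_pM// (le_trans (ler_normD _ _))// normr1 -[leRHS]/(1 + 1) lerD2l.
apply: (le_trans (lerD h muSs)).
rewrite mulrAC -natrM -mulrDl -natrD ler_wpM2r// ler_nat.
have := ltn_expl (size s) (isT : 1 < 2)%N; rewrite expnS.
by move: (2 ^ size s)%N => e; nia.
Qed.

(** Each product is expanded in the deviations $\mu_i = l_i - 1$, and exchanging the sums counts the
    subsets containing a given index. The error is measured by the sum of squares because that is
    symmetric in the eigenvalues, hence polynomial in the entries of the tensor, and dominates every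
    $|\mu_i||\mu_j|$. *)
Lemma elem_sym_near1 (n r : nat) : exists2 K : R, 0 <= K &
  forall l : 'rV[R]_n, let S := \sum_i (l 0 i - 1) ^+ 2 in S <= 1 ->
  `|elem_sym r.+1 l - 'C(n, r.+1)%:R - 'C(n.-1, r)%:R * (\sum_i l 0 i - n%:R)|
    <= K * S.
Proof.
pose K : R := \sum_(I : {set 'I_n} | #|I| == r.+1) ((2 ^ r.+1) * r.+1)%:R.
exists K => [|l S S1]; first exact: sumr_ge0.
pose mu i := l 0 i - 1.
have muS i j : `|mu i| * `|mu j| <= S.
  have sq k : mu k ^+ 2 <= S.
    by rewrite /S (bigD1 k)//= lerDl sumr_ge0// => ? _; rewrite sqr_ge0.
  have [ij|/ltW ij] := lerP `|mu i| `|mu j|.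
    by rewrite (le_trans _ (sq j))// -real_normK ?num_real// expr2 ler_wpM2r.
  by rewrite (le_trans _ (sq i))// -real_normK ?num_real// expr2 ler_wpM2l.
have -> : elem_sym r.+1 l - 'C(n, r.+1)%:R
    - 'C(n.-1, r)%:R * (\sum_i l 0 i - n%:R) =
    \sum_(I : {set 'I_n} | #|I| == r.+1)
      (\prod_(i in I) (1 + mu i) - 1 - \sum_(i in I) mu i).
  rewrite !sumrB; congr (_ - _ - _).
  - apply: eq_bigr => I _; apply: eq_bigr => i _.
    by rewrite /mu addrC subrK.
  - by have := card_draws 'I_n r.+1; rewrite card_ord => <-; rewrite cardsE sumr_const.
  rewrite (exchange_big_dep predT)//=.
  have -> : \sum_i l 0 i - n%:R = \sum_i mu i.
    by rewrite sumrB sumr_const card_ord.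
  rewrite mulr_sumr; apply: eq_bigr => i _; rewrite sumr_const.
  rewrite -(card_sets_containing r i) mulr_natl cardsE.
  congr (_ *+ _); apply: eq_card => I. by rewrite unfold_in /= andbC.
rewrite (le_trans (ler_norm_sum _ _ _))// mulr_suml ler_sum// => I /eqP Ir.
rewrite -!big_enum /= -[in leRHS]Ir cardE; apply: prod_near1 => //.
Qed.

(** Newton's identity $2 e_2 = p_1^2 - p_2$, through which [sqdev] expresses a sum of squares by
    coefficients. *)
Lemma coef2_prod_XsubC (s : seq R) (k : nat) : size s = k.+2 ->
  (\prod_(x <- s) ('X - x%:P))`_k *+ 2 =
  (\sum_(x <- s) x) ^+ 2 - \sum_(x <- s) x ^+ 2.
Proof.
elim: s k => [|x s IH] k //= [sk].
rewrite !big_cons mulrBl coefB coefCM coefXM.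
have -> : (\prod_(j <- s) ('X - j%:P))`_k = - \sum_(j <- s) j.
  by rewrite -coefPn_prod_XsubC sk.
case: k sk => [|k] sk /=.
  by case: s sk {IH} => [|y [|]]//= _; rewrite !big_cons !big_nil; ring.
by rewrite mulrnBl IH //; ring.
Qed.

(* The sum of the squares (l_i - 1)^2 over the eigenvalues l_i of A. *)
Definition sqdev (n : nat) (A : 'M[R]_n) : R :=
  (\tr A) ^+ 2 - (char_poly A)`_(n - 2) *+ 2 *+ (1 < n)%N - \tr A *+ 2 + n%:R.

Lemma sqdevE (n : nat) (A : 'M[R]_n) (l : 'rV[R]_n) : (0 < n)%N ->
  char_poly A = \prod_i ('X - (l 0 i)%:P) ->
  \tr A = \sum_i l 0 i /\ sqdev A = \sum_i (l 0 i - 1) ^+ 2.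
Proof.
move=> n0 Al; pose s := [seq l 0 i | i <- enum 'I_n].
have ss : size s = n by rewrite size_map size_enum_ord.
have sE (f : R -> R) : \sum_(x <- s) f x = \sum_i f (l 0 i).
  by rewrite big_map big_enum.
have As : char_poly A = \prod_(x <- s) ('X - x%:P).
  by rewrite Al big_map big_enum.
have trA : \tr A = \sum_i l 0 i.
  rewrite -[LHS]opprK -char_poly_trace// As -{1}ss coefPn_prod_XsubC; last first.
    by rewrite ss -?lt0n.
  by rewrite opprK big_map big_enum.
split=> //; have sq : (\tr A) ^+ 2 - (char_poly A)`_(n - 2) *+ 2 *+ (1 < n)%N =
    \sum_i (l 0 i) ^+ 2.
  (* For [n = 1] the truncated index [n - 2] is 0 and would select the constant coefficient in place
     of $e_2 = 0$; the factor [(1 < n)] in [sqdev] discards it. *)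
  have [n1|n1] := ltnP 1 n.
    rewrite As mulr1n (@coef2_prod_XsubC s (n - 2)%N); last by rewrite ss; lia.
    by rewrite (sE id) (sE (fun x => x ^+ 2)) trA; ring.
  have n1' : n = 1%N by lia.
  rewrite trA mulr0n subr0; move: l {Al s ss sE As trA}; rewrite n1' => l.
  by rewrite !big_ord1.
rewrite /sqdev sq trA -[X in _ - X + _]mulr_natr mulr_suml -sumrB.
rewrite (_ : n%:R = \sum_(i < n) 1) -?big_split; last by rewrite sumr_const card_ord.
by apply: eq_bigr => i _ /=; ring.
Qed.

Lemma sqdev_ge0 (n : nat) (S G : 'M[R]_n) : (0 < n)%N ->
  possemidef S -> posdef G -> 0 <= sqdev (S *m invmx G).
Proof.
move=> n0 Spsd Gpd; have [l [_ /sqdevE[]// _ ->]] := pencil_split Spsd Gpd.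
by apply: sumr_ge0 => i _; rewrite sqr_ge0.
Qed.

Lemma tr_ge0 (n : nat) (S G : 'M[R]_n) :
  possemidef S -> posdef G -> 0 <= \tr (S *m invmx G).
Proof.
case: n S G => [|n] S G Spsd Gpd; first by rewrite /mxtrace big_ord0.
have [l [l0 /sqdevE[]// -> _]] := pencil_split Spsd Gpd.
exact: sumr_ge0.
Qed.

Lemma sqdev1 (n : nat) : (0 < n)%N -> sqdev (1%:M : 'M[R]_n) = 0.
Proof.
move=> n0; have := @sqdevE n 1%:M (const_mx 1) n0.
case=> [|_ ->]; last by apply: big1 => i _; rewrite mxE subrr expr0n.
rewrite /char_poly /char_poly_mx map_scalar_mx -raddfB /= det_scalar.
by under eq_bigr do rewrite mxE; rewrite prodr_const card_ord.
Qed.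

Lemma sqdev_conj (n : nat) (U A : 'M[R]_n) : U \in unitmx ->
  sqdev (U *m A *m invmx U) = sqdev A.
Proof. by move=> Uu; rewrite /sqdev char_poly_conj// mxtrace_mulC mulKmx. Qed.

Lemma eigsym_near1 (n r : nat) : (r < n)%N -> exists2 K : R, 0 <= K &
  forall S G : 'M[R]_n, possemidef S -> posdef G ->
  let A := S *m invmx G in sqdev A <= 1 ->
  `|eigsym r.+1 A - 'C(n, r.+1)%:R - 'C(n.-1, r)%:R * (\tr A - n%:R)|
    <= K * sqdev A.
Proof.
move=> rn; have [K K0 HK] := elem_sym_near1 n r; exists K => // S G Spsd Gpd A.
have [l [_ Al]] := pencil_split Spsd Gpd.
have [trA ->] := sqdevE (leq_ltn_trans (leq0n r) rn) Al.
by rewrite /A trA -(elem_symE rn Al); apply: HK.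
Qed.

(** * Orthogonal splitting along the kernel of a surjective linear map *)

Section VerticalProjection.
Context {n m : nat} (K : 'M[R]_n) (T : 'M[R]_(n, m)).
Hypotheses (Kpd : posdef K) (Tfull : row_full T).

Let V := kermx T.
Let H := kermx (K *m V^T).
Let Ku := posdef_unit Kpd.

(* [w *m hlift] is the horizontal lift of [w], that is T^T K^-1 applied to
   the inverse of the induced metric [T^T K^-1 T] on the base. *)
Definition hlift : 'M[R]_(m, n) := invmx (T^T *m invmx K *m T) *m T^T *m invmx K.

Lemma hgram_posdef : posdef (T^T *m invmx K *m T).
Proof.
have := posdef_free (L := T^T) (S := invmx K).
rewrite trmxK; apply; last exact: posdef_inv.
by rewrite /row_free mxrank_tr.
Qed.

Lemma hliftK : hlift *m T = 1%:M.
Proof.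
have Gu := posdef_unit hgram_posdef.
by rewrite /hlift -!mulmxA [T^T *m _]mulmxA mulVmx.
Qed.

Lemma hlift_horizontal p (w : 'M[R]_(p, m)) : (w *m hlift <= H)%MS.
Proof.
apply/sub_kermxP; rewrite /hlift !mulmxA mulmxKV// -!mulmxA -trmx_mul.
by rewrite mulmx_ker trmx0 !mulmx0.
Qed.

Lemma horizontal_ortho (v w : 'rV[R]_n) :
  (v <= V)%MS -> (w <= H)%MS -> qform K w v = 0.
Proof.
move=> /submxP[a ->] /sub_kermxP wH.
by rewrite /qform trmx_mul !mulmxA -(mulmxA w) wH mul0mx mxE.
Qed.

Lemma vertical_horizontal0 : (V :&: H = 0)%MS.
Proof.
apply/eqP/rowV0P => v; rewrite sub_capmx => /andP[vV vH].
apply/eqP; apply: contraT => /(Kpd.2).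
by rewrite horizontal_ortho// ltxx.
Qed.

(** The kernels defining [V] and [H] come from Gaussian elimination, whose choices are not
    continuous. The right-hand side is rational in the entries of [K] and [T], which is what makes
    the vertical projection differentiable along a family. *)
Lemma vproj_formula : proj_mx V H = 1%:M - T *m hlift.
Proof.
have dV : (1%:M - T *m hlift <= V)%MS.
  by apply/sub_kermxP; rewrite mulmxBl mul1mx -mulmxA hliftK mulmx1 subrr.
rewrite -[LHS]mul1mx -[X in X *m _](subrK (T *m hlift)) mulmxDl.
rewrite proj_mx_id ?vertical_horizontal0// proj_mx_0 ?addr0//.
  exact: vertical_horizontal0.
exact: hlift_horizontal.
Qed.

(** Write w = v + h with v vertical and h horizontal. [T] kills v and is isometric on h, and v is
    orthogonal to h, so the difference of the two forms at w is the value of [K] at v. *)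
Lemma submersion_psd (G : 'M[R]_m) : G^T = G ->
  (forall u v : 'rV_n, (u <= H)%MS -> (v <= H)%MS ->
     qform G (u *m T) (v *m T) = qform K u v) ->
  possemidef (K - T *m G *m T^T).
Proof.
move=> GT iso; split.
  by rewrite linearB /= !trmx_mul trmxK GT (proj1 Kpd) mulmxA.
move=> w; pose h := w *m T *m hlift; pose v := w - h.
have hH : (h <= H)%MS := hlift_horizontal _.
have vT : v *m T = 0 by rewrite mulmxBl -mulmxA hliftK mulmx1 subrr.
have vV : (v <= V)%MS by apply/sub_kermxP.
have hv : qform K h v = 0 := horizontal_ortho vV hH.
have -> : qform (K - T *m G *m T^T) w w = qform K w w - qform G (w *m T) (w *m T).
  by rewrite -qformM /qform mulmxBr mulmxBl [LHS]mxE; congr (_ + _); rewrite mxE.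
have -> : w = v + h by rewrite subrK.
clearbody v; clearbody h.
rewrite [(v + h) *m T]mulmxDl vT add0r iso// qformDl !qformDr hv.
rewrite (qformC v h Kpd.1) hv !add0r addr0 addrK.
exact: (posdefW Kpd).2.
Qed.

Lemma horizontal_vproj0 p (L : 'M[R]_(p, n)) : L *m proj_mx V H = 0 -> (L <= H)%MS.
Proof.
rewrite vproj_formula mulmxBr mulmx1 => /eqP; rewrite subr_eq0 => /eqP ->.
by rewrite mulmxA hlift_horizontal.
Qed.

End VerticalProjection.

End LinearAlgebra.

(** * Maps of class C^k *)

Lemma near_open (T : topologicalType) (U : set T) (P : T -> Prop) (x : T) :
  open U -> U x -> (forall y, U y -> P y) -> \near x, P x.
Proof.
by move=> Uo Ux UP; apply: (@filterS _ _ _ U) => //; exact: open_nbhs_nbhs.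
Qed.

Section CkCalculus.
Context {R : realType}.

Lemma differentiable_near (V W : normedModType R) (f g : V -> W) (x : V) :
  (\near x, f x = g x) -> differentiable f x -> differentiable g x.
Proof.
move=> fg df.
have gE : g \o shift x = cst (g x) + 'd f x +o_ 0 id.
  apply/eqaddoP => _/posnumP[e].
  have /eqaddoP/(_ e%:num (gt0 e)) := diff_locally df.
  rewrite (nbhs_singleton fg); apply: filter_app.
  have : \forall h \near (0 : V), f (h + x) = g (h + x).
    by move: fg; rewrite (near_shift 0 x) /= subr0.
  by apply: filterS => h fgh; rewrite !fctE /= fgh.
have dc := diff_continuous df.
by apply/diff_locallyP; rewrite (diff_unique dc gE).
Qed.

(** * Closure of C^k under algebraic operations *)

Section Closure.
Context {V : normedModType R}.
Implicit Types (U : set V) (k : nat).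

Lemma Ck_sub (W : normedModType R) k U U' (f : V -> W) :
  U' `<=` U -> Ck k U f -> Ck k U' f.
Proof.
move=> U'U; elim: k f => [|k IH] f /=; first by move=> fc x /U'U/fc.
by move=> [df Df]; split=> [x /U'U/df//|v]; exact: IH.
Qed.

Lemma Ck_local (W : normedModType R) k U (f : V -> W) :
  (forall x, U x -> exists2 U', U' x & Ck k U' f) -> Ck k U f.
Proof.
elim: k f => [|k IH] f /= H; first by move=> x /H[U' U'x]; apply.
split=> [x /H[U' U'x [df _]]|v]; first exact: df.
by apply: IH => x /H[U' U'x [_ Df]]; exists U'.
Qed.

Lemma Ck_ext (W : normedModType R) k U (f g : V -> W) : open U ->
  (forall x, U x -> f x = g x) -> Ck k U f -> Ck k U g.
Proof.
move=> Uo; elim: k f g => [|k IH] f g fg /=.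
  move=> fc x Ux; have nfg : \near x, f x = g x.
    exact: (near_open Uo Ux fg).
  rewrite /prop_for /continuous_at -(fg _ Ux); apply: cvg_trans (fc x Ux).
  exact: near_eq_cvg.
have nfg x : U x -> \near x, f x = g x.
  by move=> Ux; exact: (near_open Uo Ux fg).
move=> [df Df]; split=> [x Ux|v].
  exact: differentiable_near (nfg _ Ux) (df _ Ux).
by apply: IH (Df v) => x Ux; apply: near_eq_derive; exact: nfg.
Qed.

Lemma Ck_continuous (W : normedModType R) k U (f : V -> W) x :
  Ck k U f -> U x -> {for x, continuous f}.
Proof.
case: k => [|k] /= fk Ux; first exact: fk.
exact/differentiable_continuous/fk.1.
Qed.

Lemma CkW (W : normedModType R) k U (f : V -> W) : Ck k.+1 U f -> Ck k U f.
Proof.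
elim: k f => [|k IH] f fk; first by move=> x; exact: Ck_continuous fk.
by split; [exact: fk.1|move=> v; apply: IH; exact: fk.2].
Qed.

Lemma Ck_cst (W : normedModType R) k U (a : W) : Ck k U (fun=> a).
Proof.
elim: k a => [|k IH] a /=; first by move=> x _; exact: cst_continuous.
split=> [x _|v]; first exact: differentiable_cst.
have -> // : (fun x : V => 'D_v (fun=> a : W) x) = (fun=> 0).
by apply/funext => x; rewrite derive_cst.
Qed.

Lemma Ck_linear (W : normedModType R) k U (f : {linear V -> W}) :
  continuous f -> Ck k U f.
Proof.
move=> fc; case: k => [|k] /=; first by move=> x _; exact: fc.
split=> [x _|v]; first exact: linear_differentiable.
have -> : (fun x : V => 'D_v f x) = (fun=> f v); last exact: Ck_cst.
apply/funext => x; rewrite deriveE; last exact: linear_differentiable.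
by rewrite diff_lin.
Qed.

Lemma Ck_add (W : normedModType R) k U (f g : V -> W) : open U ->
  Ck k U f -> Ck k U g -> Ck k U (fun x => f x + g x).
Proof.
move=> Uo; elim: k f g => [|k IH] f g /= fk gk.
  by move=> x Ux; apply: cvgD; [exact: fk|exact: gk].
split=> [x Ux|v]; first by apply: differentiableD; [exact: fk.1|exact: gk.1].
apply: Ck_ext (IH _ _ (fk.2 v) (gk.2 v)) => // x Ux.
by rewrite -deriveD//; apply: diff_derivable; [exact: fk.1|exact: gk.1].
Qed.

Lemma Ck_mul k U (f g : V -> R^o) : open U ->
  Ck k U f -> Ck k U g -> Ck k U (fun x => f x * g x : R^o).
Proof.
move=> Uo; elim: k f g => [|k IH] f g fk gk.
  by move=> x Ux; apply: cvgM; [exact: fk|exact: gk].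
split=> [x Ux|v].
  by apply: differentiableM; [exact: fk.1|exact: gk.1].
have := Ck_add Uo (IH _ _ (CkW fk) (gk.2 v)) (IH _ _ (CkW gk) (fk.2 v)).
apply: Ck_ext => // x Ux.
by rewrite -[LHS]deriveM//; apply: diff_derivable; [exact: fk.1|exact: gk.1].
Qed.

Lemma Ck_scale k U (a : R) (f : V -> R^o) : open U ->
  Ck k U f -> Ck k U (fun x => a * f x : R^o).
Proof. by move=> Uo fk; apply: Ck_mul => //; exact: Ck_cst. Qed.

Lemma Ck_opp k U (f : V -> R^o) : open U ->
  Ck k U f -> Ck k U (fun x => - f x : R^o).
Proof.
by move=> Uo /(Ck_scale (-1) Uo); apply: Ck_ext => // x _; rewrite mulN1r.
Qed.

Lemma Ck_sub_fun k U (f g : V -> R^o) : open U ->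
  Ck k U f -> Ck k U g -> Ck k U (fun x => f x - g x : R^o).
Proof. by move=> Uo fk gk; apply: Ck_add => //; exact: Ck_opp. Qed.

Lemma Ck_sum (I : Type) (s : seq I) (P : pred I) k U (f : I -> V -> R^o) :
  open U -> (forall i, Ck k U (f i)) ->
  Ck k U (fun x => \sum_(i <- s | P i) f i x : R^o).
Proof.
move=> Uo fk; elim: s => [|i s IH].
  by apply: Ck_ext (Ck_cst k U (0 : R^o)) => // x _; rewrite big_nil.
have [Pi|Pi] := boolP (P i).
  by apply: Ck_ext (Ck_add Uo (fk i) IH) => // x _; rewrite big_cons Pi.
by apply: Ck_ext IH => // x _; rewrite big_cons (negbTE Pi).
Qed.

Lemma Ck_prod (I : Type) (s : seq I) (P : pred I) k U (f : I -> V -> R^o) :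
  open U -> (forall i, Ck k U (f i)) ->
  Ck k U (fun x => \prod_(i <- s | P i) f i x : R^o).
Proof.
move=> Uo fk; elim: s => [|i s IH].
  by apply: Ck_ext (Ck_cst k U (1 : R^o)) => // x _; rewrite big_nil.
have [Pi|Pi] := boolP (P i).
  by apply: Ck_ext (Ck_mul Uo (fk i) IH) => // x _; rewrite big_cons Pi.
by apply: Ck_ext IH => // x _; rewrite big_cons (negbTE Pi).
Qed.

Lemma Ck_inv k U (f : V -> R^o) : open U -> (forall x, U x -> f x != 0) ->
  Ck k U f -> Ck k U (fun x => (f x)^-1 : R^o).
Proof.
move=> Uo f0; elim: k => [|k IH] fk.
  by move=> x Ux; apply: cvgV; [exact: f0|exact: fk].
split=> [x Ux|v]; first by apply: differentiableV; [exact: fk.1|exact: f0].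
have fV := IH (CkW fk).
have := Ck_mul Uo (Ck_opp Uo (Ck_mul Uo fV fV)) (fk.2 v).
apply: Ck_ext => // x Ux.
rewrite deriveV ?f0//; last exact/diff_derivable/fk.1.
by rewrite expr2 invfM.
Qed.

(** Order 1 is what the Riemannian density requires; the derivative is recorded for use with
    Jacobi's formula. *)
Lemma Ck_sqrt U (f : V -> R^o) : open U -> (forall x, U x -> 0 < f x) ->
  Ck 1 U f -> Ck 1 U (fun x => Num.sqrt (f x) : R^o) /\
  (forall x v, U x -> 'D_v (fun x => Num.sqrt (f x) : R^o) x =
     (2 * Num.sqrt (f x))^-1 * 'D_v f x).
Proof.
move=> Uo f0 fk.
have dsq (y : R) : 0 < y -> differentiable (Num.sqrt : R -> R) y.
  by move=> y0; apply/derivable1_diffP; have [] := is_derive1_sqrt y0.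
have D x v : U x -> 'D_v (fun x => Num.sqrt (f x) : R^o) x =
     (2 * Num.sqrt (f x))^-1 * 'D_v f x.
  move=> Ux; rewrite deriveE; last first.
    by apply: differentiable_comp; [exact: fk.1|exact/dsq/f0].
  rewrite diff_comp; [|exact: fk.1|exact/dsq/f0].
  rewrite /= diff1E; last exact/dsq/f0.
  rewrite derive1E derive_sqrt ?f0// -deriveE; last exact: fk.1.
  by rewrite -[LHS]/('D_v f x * _ : R) mulrC.
split; last by move=> x v; exact: D.
split=> [x Ux|v].
  by apply: differentiable_comp; [exact: fk.1|exact/dsq/f0].
have sc : Ck 0 U (fun x => Num.sqrt (f x) : R^o).
  move=> x Ux; apply: continuous_comp; first exact: (Ck_continuous fk).
  exact: sqrt_continuous.
have s0 x : U x -> 2 * Num.sqrt (f x) != 0.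
  by move=> Ux; rewrite mulf_neq0// gt_eqF// sqrtr_gt0 f0.
have := Ck_mul Uo (Ck_inv Uo s0 (Ck_scale 2 Uo sc)) (fk.2 v).
by apply: Ck_ext => // x Ux; rewrite D.
Qed.

Lemma Ck_entry (p q : nat) k U (f : V -> 'M[R]_(p, q)) i j : open U ->
  Ck k U f -> Ck k U (fun x => f x i j : R^o).
Proof.
move=> Uo; elim: k f => [|k IH] f fk.
  move=> x Ux; apply: (@continuous_comp _ _ _ f (fun M : 'M[R]_(p, q) => M i j : R^o)).
    exact: fk.
  exact: coord_continuous.
split=> [x Ux|v].
  apply: (@differentiable_comp _ _ _ _ f (fun M : 'M[R]_(p, q) => M i j : R^o)).
    exact: fk.1.
  exact: differentiable_coord.
apply: Ck_ext (IH _ (fk.2 v)) => // x Ux.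
by rewrite derive_mx ?mxE//; exact/diff_derivable/fk.1.
Qed.

End Closure.
End CkCalculus.

Section CkComposition.
Context {R : realType}.

(** * Composition, and C^k families of matrices *)

Section Composition.
Context {V : normedModType R}.
Implicit Types (U : set V).

Lemma continuous_row (n : nat) (f : V -> 'rV[R]_n) (x : V) :
  (forall j, {for x, continuous (fun y => f y 0 j : R^o)}) ->
  {for x, continuous f}.
Proof.
move=> fc; have -> : f = fun y => \sum_j f y 0 j *: delta_mx 0 j.
  by apply/funext => y; rewrite -row_sum_delta.
rewrite /prop_for /continuous_at.
apply: (@cvg_big 'rV[R]_n 'I_n +%R 0 predT _ V (nbhs x) (index_enum 'I_n)
  (fun j y => f y 0 j *: delta_mx 0 j) (fun j => f x 0 j *: delta_mx 0 j)).
  exact: add_continuous.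
move=> j _.
by apply: cvgZr_tmp; exact: fc.
Qed.

Lemma differentiable_row (n : nat) (f : V -> 'rV[R]_n) (x : V) :
  (forall j, differentiable (fun y => f y 0 j : R^o) x) -> differentiable f x.
Proof.
move=> df.
have -> : f = \sum_(j < n) (fun y => f y 0 j *: (delta_mx 0 j : 'rV[R]_n)).
  by apply/funext => y; rewrite fct_sumE -row_sum_delta.
by apply: differentiable_sum => j; exact: differentiableZl.
Qed.

Lemma Ck_row (n : nat) k U (f : V -> 'rV[R]_n) : open U ->
  (forall j, Ck k U (fun x => f x 0 j : R^o)) -> Ck k U f.
Proof.
move=> Uo; elim: k f => [|k IH] f fk.
  by move=> x Ux; apply: continuous_row => j; exact: fk.
have df x : U x -> differentiable f x.
  by move=> Ux; apply: differentiable_row => j; exact: (fk j).1.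
split=> // v; apply: IH => j; apply: Ck_ext ((fk j).2 v) => // x Ux.
by rewrite derive_mx ?mxE//; exact/diff_derivable/df.
Qed.

Lemma derive_comp_row (n : nat) (f : V -> 'rV[R]_n) (g : 'rV[R]_n -> R^o) x v :
  differentiable f x -> differentiable g (f x) ->
  'D_v (g \o f) x =
    \sum_j 'D_v (fun y => f y 0 j : R^o) x * 'D_(delta_mx 0 j) g (f x).
Proof.
move=> df dg; rewrite deriveE; last exact: differentiable_comp.
have -> : 'd (g \o f) x v = 'd g (f x) ('D_v f x) by rewrite diff_comp//= (deriveE v df).
rewrite ['D_v f x]row_sum_delta raddf_sum /=.
apply: eq_bigr => j _; rewrite linearZ /= -[LHS]/(_ * _); congr (_ * _).
  by rewrite derive_mx ?mxE//; exact: diff_derivable.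
by rewrite deriveE.
Qed.

(** Induction on [k]: by the chain rule in coordinates, a directional derivative of the composite is
    a finite sum of products of derivatives of the components of [f] with partial derivatives of [g]
    in fixed directions, composed with [f]. *)
Lemma Ck_comp (n : nat) k U (U' : set 'rV[R]_n) (f : V -> 'rV[R]_n)
    (g : 'rV[R]_n -> R^o) : open U -> (forall x, U x -> U' (f x)) ->
  (forall j, Ck k U (fun x => f x 0 j : R^o)) -> Ck k U' g ->
  Ck k U (fun x => g (f x)).
Proof.
move=> Uo UU'; elim: k g => [|k IH] g fk gk.
  move=> x Ux; apply: continuous_comp; last exact/gk/UU'.
  by apply: continuous_row => j; exact: fk.
have df x : U x -> differentiable f x.
  by move=> Ux; apply: differentiable_row => j; exact: (fk j).1.
split=> [x Ux|v].
  by apply: differentiable_comp; [exact: df|exact/gk.1/UU'].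
have fk' j := (fk j).2 v; have fkW j := CkW (fk j).
have := Ck_sum (index_enum 'I_n) predT Uo
  (fun j => Ck_mul Uo (fk' j) (IH _ fkW (gk.2 (delta_mx 0 j)))).
apply: Ck_ext => // x Ux; rewrite -derive_comp_row//; first exact: df.
exact/gk.1/UU'.
Qed.

Definition Ckmx k U (p q : nat) (A : V -> 'M[R]_(p, q)) : Prop :=
  forall i j, Ck k U (fun x => A x i j : R^o).

Lemma Ckmx_mul k U p q r (A : V -> 'M[R]_(p, q)) (B : V -> 'M[R]_(q, r)) :
  open U -> Ckmx k U A -> Ckmx k U B -> Ckmx k U (fun x => A x *m B x).
Proof.
move=> Uo Ak Bk i j; have := Ck_sum (index_enum 'I_q) predT Uo
  (fun l => Ck_mul Uo (Ak i l) (Bk l j)).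
by apply: Ck_ext => // x _; rewrite mxE.
Qed.

Lemma Ckmx_tr k U p q (A : V -> 'M[R]_(p, q)) : open U ->
  Ckmx k U A -> Ckmx k U (fun x => (A x)^T).
Proof. by move=> Uo Ak i j; apply: Ck_ext (Ak j i) => // x _; rewrite mxE. Qed.

Lemma Ckmx_sub k U p q (A B : V -> 'M[R]_(p, q)) : open U ->
  Ckmx k U A -> Ckmx k U B -> Ckmx k U (fun x => A x - B x).
Proof.
move=> Uo Ak Bk i j.
by apply: Ck_ext (Ck_sub_fun Uo (Ak i j) (Bk i j)) => // x _; rewrite !mxE.
Qed.

Lemma Ckmx_cst k U p q (A : 'M[R]_(p, q)) : Ckmx k U (fun=> A).
Proof. by move=> i j; exact: Ck_cst. Qed.

Lemma Ck_det k U n (A : V -> 'M[R]_n) : open U ->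
  Ckmx k U A -> Ck k U (fun x => \det (A x) : R^o).
Proof.
move=> Uo Ak; apply: Ck_sum => // s; apply: Ck_mul => //; first exact: Ck_cst.
exact: Ck_prod.
Qed.

Lemma Ckmx_inv k U n (A : V -> 'M[R]_n) : open U ->
  (forall x, U x -> A x \in unitmx) ->
  Ckmx k U A -> Ckmx k U (fun x => invmx (A x)).
Proof.
move=> Uo Au Ak i j.
have A0 x : U x -> \det (A x) != 0 by move/Au; rewrite unitmxE unitfE.
have adjk : Ck k U (fun x => (-1) ^+ (j + i) * \det (row' j (col' i (A x))) : R^o).
  apply: Ck_scale => //; apply: Ck_det => // a b.
  by apply: Ck_ext (Ak (lift j a) (lift i b)) => // x _; rewrite !mxE.
have := Ck_mul Uo (Ck_inv Uo A0 (Ck_det Uo Ak)) adjk.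
by apply: Ck_ext => // x Ux; rewrite /invmx Au// !mxE.
Qed.

Lemma Ck_trace k U n (A : V -> 'M[R]_n) : open U ->
  Ckmx k U A -> Ck k U (fun x => \tr (A x) : R^o).
Proof. by move=> Uo Ak; apply: Ck_sum => // i. Qed.

Definition Ckpoly k U (p : V -> {poly R}) : Prop :=
  forall i, Ck k U (fun x => (p x)`_i : R^o).

Lemma Ckpoly_mul k U (p q : V -> {poly R}) : open U ->
  Ckpoly k U p -> Ckpoly k U q -> Ckpoly k U (fun x => p x * q x).
Proof.
move=> Uo pk qk i; have := Ck_sum (index_enum 'I_i.+1) predT Uo
  (fun j : 'I_i.+1 => Ck_mul Uo (pk j) (qk (i - j)%N)).
by apply: Ck_ext => // x _; rewrite coefM.
Qed.

Lemma Ck_char_poly k U n (A : V -> 'M[R]_n) : open U ->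
  Ckmx k U A -> Ckpoly k U (fun x => char_poly (A x)).
Proof.
move=> Uo Ak l.
have ck (p : {poly R}) : Ckpoly k U (fun=> p) by move=> i; exact: Ck_cst.
have ek i j : Ckpoly k U (fun x => char_poly_mx (A x) i j).
  move=> a; have := Ck_sub_fun Uo (Ck_cst k U (('X *+ (i == j))`_a : R^o))
    (Ck_scale (a == 0%N)%:R Uo (Ak i j)).
  apply: Ck_ext => // x _; rewrite !mxE coefB coefC; congr (_ - _).
  by case: (a == 0%N); rewrite ?mul1r ?mul0r.
have pk (s : {perm 'I_n}) (r : seq 'I_n) :
    Ckpoly k U (fun x => \prod_(i <- r) char_poly_mx (A x) i (s i)).
  elim: r => [|i r IH] a.
    by apply: Ck_ext (ck 1 a) => // x _; rewrite big_nil.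
  by apply: Ck_ext (Ckpoly_mul Uo (ek i (s i)) IH a) => // x _; rewrite big_cons.
have := Ck_sum (index_enum {perm 'I_n}) predT Uo
  (fun s => Ckpoly_mul Uo (ck ((-1) ^+ s)) (pk s (index_enum 'I_n)) l).
by apply: Ck_ext => // x _; rewrite /char_poly /determinant coef_sum.
Qed.

Lemma Ck_eigsym k U n r (A : V -> 'M[R]_n) : open U ->
  Ckmx k U A -> Ck k U (fun x => eigsym r (A x) : R^o).
Proof. by move=> Uo Ak; apply: Ck_scale => //; exact: Ck_char_poly. Qed.

Lemma Ck_sqdev k U n (A : V -> 'M[R]_n) : open U ->
  Ckmx k U A -> Ck k U (fun x => sqdev (A x) : R^o).
Proof.
move=> Uo Ak; have trk := Ck_trace Uo Ak.
have := Ck_add Uo (Ck_sub_fun Uo (Ck_sub_fun Uo (Ck_mul Uo trk trk)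
  (Ck_scale (2 *+ (1 < n)%N) Uo (Ck_char_poly Uo Ak (n - 2)%N))) (Ck_scale 2 Uo trk))
  (Ck_cst k U (n%:R : R^o)).
apply: Ck_ext => // x _; rewrite /sqdev expr2 mulr2n mulr_natl.
by case: (1 < n)%N; rewrite ?mulr1n ?mulr0n ?mul0r// mulr_natl.
Qed.

End Composition.
End CkComposition.

(** * Mean values, symmetry of second derivatives, Jacobi's formula *)

Section MeanValue.
Context {R : realType}.

Lemma near_dist (T : topologicalType) (f : T -> R^o) (x : T) (e : R) :
  {for x, continuous f} -> 0 < e -> \forall y \near x, `|f x - f y| < e.
Proof. by move=> fc; apply: cvgr_dist_lt. Qed.

Lemma ler_dist_half (a b c e : R) :
  `|a - b| < e / 2 -> `|c - b| < e / 2 -> `|a - c| <= e.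
Proof.
move=> ab cb; have -> : a - c = (a - b) - (c - b) by rewrite opprB subrKA.
by rewrite (le_trans (ler_normB _ _))// (splitr e) lerD// ltW.
Qed.

Section Lines.
Context {V : normedModType R}.

Lemma is_derive_line (f : V -> R^o) (p v : V) (s : R) :
  differentiable f (s *: v + p) ->
  is_derive (s : R^o) 1 (fun s : R^o => f (s *: v + p)) ('D_v f (s *: v + p)).
Proof.
move=> df; have dv : derivable f (s *: v + p) v := diff_derivable df.
have E : (fun h : R => h^-1 *: (((fun s : R^o => f (s *: v + p)) \o shift (s : R^o))
    (h *: (1 : R^o)) - f (s *: v + p))) =
  (fun h : R => h^-1 *: ((f \o shift (s *: v + p)) (h *: v) - f (s *: v + p))).
  by apply/funext => h /=; rewrite [h%:A]mulr1 scalerDl addrA.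
by apply: DeriveDef; rewrite ?/derivable ?/derive E.
Qed.

Lemma MVT_line (f : V -> R^o) (p v : V) :
  (forall s, 0 <= s <= 1 -> differentiable f (s *: v + p)) ->
  exists2 c : R, 0 <= c <= 1 & f (v + p) - f p = 'D_v f (c *: v + p).
Proof.
move=> df; pose F (s : R) : R := f (s *: v + p).
have [c c01 E] : exists2 c, c \in `[0, 1]%R &
    F 1 - F 0 = 'D_v f (c *: v + p) * (1 - 0).
  apply: (@MVT_segment R F (fun s => 'D_v f (s *: v + p))) => //.
    move=> s; rewrite in_itv /= => /andP[s0 s1].
    by apply: is_derive_line; apply: df; rewrite !ltW.
  apply: derivable_within_continuous => s; rewrite in_itv /= => s01.
  by have [] := is_derive_line (df _ s01).
exists c; first by move: c01; rewrite in_itv.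
by move: E; rewrite /F scale1r scale0r add0r subr0 mulr1.
Qed.

Lemma line_ball (x p v : V) (r s : R) : 0 <= s <= 1 ->
  `|p - x| < r -> `|v + p - x| < r -> `|s *: v + p - x| < r.
Proof.
move=> /andP[s0 s1] pr vr.
have -> : s *: v + p - x = s *: (v + p - x) + (1 - s) *: (p - x).
  rewrite -[v + p - x]addrA scalerDr scalerBl scale1r -[RHS]addrA.
  by rewrite [_ + (_ - _)]addrC subrK addrA.
rewrite (le_lt_trans (ler_normD _ _))// !normrZ (ger0_norm s0) ger0_norm ?subr_ge0//.
have [->|sn0] := eqVneq s 0; first by rewrite mul0r add0r subr0 mul1r.
have {sn0} s0' : 0 < s by rewrite lt0r sn0.
have : s * `|v + p - x| < s * r by rewrite ltr_pM2l.
have : (1 - s) * `|p - x| <= (1 - s) * r by rewrite ler_wpM2l ?subr_ge0// ltW.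
by lra.
Qed.

Lemma derive_translate (f : V -> R^o) (a p v : V) :
  'D_v (fun y => f (a + y)) p = 'D_v f (a + p).
Proof. by rewrite /derive; congr lim; under eq_fun do rewrite /= addrCA. Qed.

Lemma deriveZv (f : V -> R^o) (p v : V) (h : R) : differentiable f p ->
  'D_(h *: v) f p = h * 'D_v f p.
Proof. by move=> df; rewrite !deriveE// linearZ. Qed.

(** The mean value theorem is used twice: along [h *: v] for the increment of [f] in the direction
    [h *: w], then along [h *: w] for the derivative of [f] in direction [v]. *)
Lemma second_difference (f : V -> R^o) (U : set V) (x v w : V) (r h : R) :
  Ck 2 U f -> (forall y, `|y - x| < r -> U y) -> 0 < h ->
  h * (`|v| + `|w|) < r ->
  exists2 y, `|y - x| < r &
    f (x + h *: v + h *: w) - f (x + h *: v) - f (x + h *: w) + f x =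
    h ^+ 2 * 'D_w (fun y => 'D_v f y : R^o) y.
Proof.
move=> fk Ur h0 hr; pose D y : R^o := 'D_v f y.
have df y : `|y - x| < r -> differentiable f y by move=> /Ur; exact: fk.1.
have dD y : `|y - x| < r -> differentiable D y by move=> /Ur; exact: (fk.2 v).1.
have r0 : 0 < r by rewrite (le_lt_trans _ hr)// mulr_ge0 ?addr_ge0// ltW.
have inball a b : 0 <= a <= 1 -> 0 <= b <= 1 -> `|a *: (h *: v) + b *: (h *: w) + x - x| < r.
  move=> /andP[a0 a1] /andP[b0 b1]; rewrite addrK (le_lt_trans _ hr)//.
  rewrite (le_trans (ler_normD _ _))// mulrDr !normrZ (ger0_norm a0) (ger0_norm b0).
  by rewrite gtr0_norm// lerD// ler_piMl// mulr_ge0// ltW.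
pose G (y : V) : R^o := f (h *: w + y) - f y.
have dG s : 0 <= s <= 1 -> differentiable G (s *: (h *: v) + x).
  move=> s01; apply: differentiableB.
    apply: (@differentiable_comp _ _ _ _ (fun y => h *: w + y) f) => //.
    apply: df; have := inball s 1 s01; rewrite scale1r lexx ler01 => /(_ isT).
    by rewrite [_ + h *: w]addrC -!addrA; apply.
  apply: df; have := inball s 0 s01; rewrite scale0r addr0 lexx ler01 => /(_ isT).
  exact.
have [c c01 Gc] := MVT_line dG.
pose p := c *: (h *: v) + x.
have pB : `|p - x| < r.
  have := inball c 0 c01; rewrite scale0r addr0 lexx ler01 => /(_ isT).
  exact.
have wpB : `|h *: w + p - x| < r.
  have := inball c 1 c01; rewrite scale1r lexx ler01 => /(_ isT).
  by rewrite [_ + h *: w]addrC -!addrA; apply.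
have DG : 'D_(h *: v) G p = h * (D (h *: w + p) - D p).
  rewrite deriveZv; last exact: dG.
  have dw : differentiable (fun y => f (h *: w + y)) p.
    by apply: (@differentiable_comp _ _ _ _ (fun y => h *: w + y) f) => //; exact: df.
  rewrite deriveB; [|exact: diff_derivable|exact/diff_derivable/df].
  by rewrite derive_translate.
have [c' c'01 Dc] : exists2 c', 0 <= c' <= 1 &
   D (h *: w + (c *: (h *: v) + x)) - D (c *: (h *: v) + x) =
   'D_(h *: w) D (c' *: (h *: w) + (c *: (h *: v) + x)).
  apply: MVT_line => s s01; apply: dD.
  by have := inball c s c01 s01; rewrite [_ + s *: _]addrC -!addrA; apply.
exists (c' *: (h *: w) + (c *: (h *: v) + x)).
  by have := inball c c' c01 c'01; rewrite [_ + c' *: _]addrC -!addrA; apply.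
have -> : f (x + h *: v + h *: w) - f (x + h *: v) - f (x + h *: w) + f x =
    G (h *: v + x) - G x.
  rewrite /G [x + h *: v]addrC [x + h *: w]addrC [h *: v + x + _]addrC.
  by rewrite opprB [RHS]addrA [LHS]addrAC.
rewrite Gc DG Dc expr2 -mulrA; congr (_ * _); rewrite deriveZv//.
apply: dD; have := inball c c' c01 c'01.
by rewrite [_ + c' *: _]addrC -!addrA; apply.
Qed.

(** The second difference is symmetric in [v] and [w], so the two mixed derivatives take a common
    value at points [y1] and [y2] close to [x]; both are continuous at [x]. *)
Lemma schwarz (f : V -> R^o) (U : set V) (x v w : V) : open U -> U x ->
  Ck 2 U f ->
  'D_w (fun y => 'D_v f y : R^o) x = 'D_v (fun y => 'D_w f y : R^o) x.
Proof.
move=> Uo Ux fk; apply/eqP; rewrite -subr_eq0 -normr_eq0; apply/eqP/le_anti.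
rewrite normr_ge0 andbT; apply/ler_addgt0Pr => e e0; rewrite add0r.
have e2 : 0 < e / 2 by rewrite divr_gt0.
pose Dv y : R^o := 'D_v f y; pose Dw y : R^o := 'D_w f y.
pose P y : R^o := 'D_w Dv y; pose Q y : R^o := 'D_v Dw y.
have fv : Ck 1 U Dv := fk.2 v; have fw : Ck 1 U Dw := fk.2 w.
have Pc : {for x, continuous P} := fv.2 w x Ux.
have Qc : {for x, continuous Q} := fw.2 v x Ux.
rewrite -[X in X - _]/(P x) -[X in _ - X]/(Q x).
have HP : \forall y \near x, `|P x - P y| < e / 2 := near_dist Pc e2.
have HQ : \forall y \near x, `|Q x - Q y| < e / 2 := near_dist Qc e2.
have HU : \near x, U x := open_nbhs_nbhs (conj Uo Ux).
have : \forall y \near x, [/\ U y, `|P x - P y| < e / 2 & `|Q x - Q y| < e / 2].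
  by apply: filterS3 HU HP HQ.
move=> /nbhs_normP[r /= r0 Br].
have B y : `|y - x| < r -> [/\ U y, `|P x - P y| < e / 2 & `|Q x - Q y| < e / 2].
  by move=> yx; apply: Br; rewrite /= distrC.
(* The summand 1 keeps [N] positive when [v] and [w] are both zero. *)
pose N := `|v| + `|w| + 1; have N0 : 0 < N by rewrite ltr_wpDl ?addr_ge0.
pose h := r / 2 / N; have h0 : 0 < h by rewrite !divr_gt0.
have hN : h * (`|v| + `|w|) < r.
  rewrite /h -mulrA [N^-1 * _]mulrC; have : (`|v| + `|w|) / N <= 1.
    by rewrite ler_pdivrMr// mul1r lerDl.
  have := divr_ge0 (addr_ge0 (normr_ge0 v) (normr_ge0 w)) (ltW N0).
  by move: ((`|v| + `|w|) / N) => z; nra.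
have [y1 /B[_ Py1 _] E1] := second_difference (v := v) (w := w) fk
  (fun y yx => let: And3 Uy _ _ := B y yx in Uy) h0 hN.
have [y2 /B[_ _ Qy2] E2] := second_difference (v := w) (w := v) fk
  (fun y yx => let: And3 Uy _ _ := B y yx in Uy) h0
  (eq_ind _ (fun z => h * z < r) hN _ (addrC _ _)).
have PQ : P y1 = Q y2.
  apply: (mulfI (x := h ^+ 2)); first by rewrite expf_neq0// gt_eqF.
  rewrite -[LHS]E1 -[RHS]E2 (addrAC x (h *: v)).
  by rewrite (addrAC (f (x + h *: w + h *: v)) (- f (x + h *: v))).
rewrite -PQ in Qy2.
exact: (ler_dist_half Py1 Qy2).
Qed.

End Lines.

(** * First-order expansion in time, locally uniform in space *)

Section TimeExpansion.
Context {W : normedModType R}.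
Implicit Types (U : set (R^o * W)) (phi : R^o * W -> R^o).

Let dt : R^o * W := (1, 0).

(** The base point [(0, z.2)] moves with [z], which gives uniformity in space near [u]. The mean
    value theorem in the time direction turns the remainder into t times a difference of two time
    derivatives, both close to the one at [(0, u)]. *)
Lemma time_expansion U phi (u : W) : open U -> U (0, u) -> Ck 1 U phi ->
  forall e : R, 0 < e -> \forall z \near ((0, u) : R^o * W),
    `|phi z - phi (0, z.2) - z.1 * 'D_dt phi (0, z.2)| <= e * `|z.1|.
Proof.
move=> Uo U0 phik e e0; pose D z : R^o := 'D_dt phi z.
have Dc : {for ((0, u) : R^o * W), continuous D} by apply: (phik.2 dt).
have e2 : 0 < e / 2 by rewrite divr_gt0.
have : \forall z \near ((0, u) : R^o * W), U z /\ `|D (0, u) - D z| < e / 2.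
  near=> z; split; near: z; first exact: open_nbhs_nbhs.
  exact: (near_dist Dc e2).
move=> /nbhs_normP[r /= r0 Br]; apply/nbhs_normP; exists r => //= -[t v].
have B z : `|z - (0, u)| < r -> U z /\ `|D (0, u) - D z| < e / 2.
  by move=> zu; apply: Br; rewrite /= distrC.
move=> tvB0; have tvB : `|(t, v) - (0, u)| < r by rewrite distrC.
pose p : R^o * W := (0, v).
(* The product carries the maximum norm, so setting the time to 0 stays inside the ball. *)
have pB : `|p - (0, u)| < r.
  apply: le_lt_trans tvB; rewrite !prod_normE /= subrr normr0 ge_max.
  by apply/andP; split; rewrite le_max ?normr_ge0// lexx orbT.
have tE (s : R) : s *: (t *: dt) + p = (s * t, v).
  by congr pair; rewrite /= ?scaler0 ?add0r// addr0 -[LHS]/(s * (t * 1)) mulr1.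
have tdtp : t *: dt + p = (t, v) by have := tE 1; rewrite scale1r mul1r.
have lineB s : 0 <= s <= 1 -> `|s *: (t *: dt) + p - (0, u)| < r.
  by move=> s01; apply: line_ball; rewrite ?tdtp.
have [c c01 E] : exists2 c : R, 0 <= c <= 1 & phi (t *: dt + p) - phi p = 'D_(t *: dt) phi (c *: (t *: dt) + p).
  by apply: MVT_line => s /lineB/B[Us _]; exact: phik.1.
have [Uc Dcc] := B _ (lineB c c01); have [_ Dp] := B _ pB.
rewrite /= -tdtp E deriveZv ?tdtp; last exact: phik.1.
rewrite -mulrBr normrM mulrC ler_wpM2r//.
by apply: (ler_dist_half (b := D (0, u))); rewrite distrC.
Unshelve. all: by end_near. Qed.

End TimeExpansion.

(** The outer function s |-> (s + |s|)^2 is $4\max(s,0)^2$; its derivative 4 (s + |s|) is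
    continuous, also at 0. *)
Lemma Ck_bump (V : normedModType R) (U : set V) (f : V -> R^o) : open U ->
  Ck 1 U f -> Ck 1 U (fun x => (f x + `|f x|) ^+ 2 : R^o).
Proof.
move=> Uo fk; pose b (s : R^o) : R^o := (s + `|s|) ^+ 2.
have db (s : R^o) : is_derive s (1 : R^o) b (4 * (s + `|s|) : R^o).
  have [s0|s0|s0] := ltgtP s 0.
  - rewrite ltr0_norm// subrr mulr0.
    apply: (near_eq_is_derive (f := cst (0 : R^o) : R^o -> R^o)).
      near=> y; have y0 : y < 0 by near: y; exact: lt_nbhsl.
      by rewrite /b ltr0_norm// subrr expr0n.
  - rewrite gtr0_norm//.
    apply: (near_eq_is_derive (f := 4 \*: ((id : R^o -> R) * (id : R^o -> R)) : R^o -> R^o)).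
      near=> y; have y0 : 0 < y by near: y; exact: lt_nbhsr.
      have E (z : R) : 4 * (z * z) = (z + z) ^+ 2 by ring.
      by rewrite /b gtr0_norm//; exact: E.
    have := is_deriveZ (W := R^o) 4 (is_deriveM (is_derive_id s (1 : R^o)) (is_derive_id s (1 : R^o))).
    by rewrite [s%:A]mulr1.
  - rewrite s0 normr0 addr0 mulr0.
    have lim0 : (fun h : R => h^-1 *: ((b \o shift (0 : R^o)) (h *: (1 : R^o)) - b 0))
        @ 0^' --> (0 : R^o).
      apply/cvgr0Pnorm_le => e e0; near=> h.
      have h0 : h != 0 by near: h; exact: nbhs_dnbhs_neq.
      rewrite /= addr0 [h%:A]mulr1 /b normr0 addr0 expr0n subr0 normrZ normfV.
      rewrite ler_pdivrMl ?normr_gt0// normrX expr2.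
      have h2 : `|h + `|h| | <= 2 * `|h|.
        by rewrite (le_trans (ler_normD _ _))// normr_id mulr2n mulrDl mul1r.
      have h4 : 4 * `|h| <= e.
        have : `|h| < e / 4 by near: h; apply: dnbhs0_lt; rewrite divr_gt0.
        by lra.
      apply: (le_trans (ler_pM _ _ h2 h2)) => //.
      have -> (q : R) : 2 * q * (2 * q) = q * (4 * q) by ring.
      by rewrite ler_wpM2l.
    by apply: DeriveDef; [apply/cvg_ex; exists 0|exact: cvg_lim].
have dfb (s : R^o) : differentiable b s by apply/derivable1_diffP; have [] := db s.
have D x v : U x -> 'D_v (fun x => b (f x)) x = (4 * (f x + `|f x|)) * 'D_v f x.
  move=> Ux; have dfx : differentiable f x by exact: fk.1.
  rewrite deriveE; last exact: differentiable_comp.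
  rewrite diff_comp//= diff1E// derive1E derive_val -(deriveE v dfx).
  by rewrite -[LHS]/('D_v f x * _ : R) mulrC.
split=> [x Ux|v].
  by apply: (@differentiable_comp _ _ _ _ f b) => //; exact: fk.1.
have fc : Ck 0 U f := CkW fk.
have nc : Ck 0 U (fun x => `|f x| : R^o).
  by move=> x Ux; apply: cvg_norm; exact: fc.
have := Ck_mul Uo (Ck_scale 4 Uo (Ck_add Uo fc nc)) (fk.2 v).
by apply: Ck_ext => // x Ux; rewrite D.
Unshelve. all: by end_near. Qed.

Lemma is_derive_prod (V : normedModType R) (I : eqType) (s : seq I)
    (f : I -> V -> R^o) (df : I -> R) (x v : V) : uniq s ->
  (forall i, is_derive x v (f i) (df i : R^o)) ->
  is_derive x v (fun y => \prod_(i <- s) f i y : R^o)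
    (\sum_(i <- s) df i * \prod_(j <- s | j != i) f j x : R^o).
Proof.
move=> us Hdf; elim: s us => [_|i s IH /= /andP[si us]].
  have -> : (fun y : V => \prod_(i <- [::]) f i y : R^o) = cst 1.
    by apply/funext => y; rewrite big_nil.
  by rewrite big_nil; exact: is_derive_cst.
have -> : (fun y : V => \prod_(j <- i :: s) f j y : R^o) =
    (f i : V -> R) * (fun y => \prod_(j <- s) f j y : R).
  by apply/funext => y; rewrite big_cons.
apply: is_derive_eq; first exact: is_deriveM (Hdf i) (IH us).
rewrite -[LHS]/(f i x * _ + _ * df i : R) [RHS]big_cons big_cons eqxx /= addrC.
congr (_ + _).
  rewrite mulrC; congr (_ * _); rewrite [LHS]big_seq [RHS]big_seq_cond.
  apply: eq_bigl => j; case: (boolP (j \in s)) => //= js.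
  by apply/esym; apply: contraNneq si => <-.
rewrite mulr_sumr [LHS]big_seq [RHS]big_seq; apply: eq_bigr => k ks.
rewrite big_cons ifT 1?mulrCA//.
by apply: contraNneq si => ->.
Qed.

Lemma is_derive_bigsum (V : normedModType R) (I : Type) (s : seq I)
    (f : I -> V -> R^o) (df : I -> R^o) (x v : V) :
  (forall i, is_derive x v (f i) (df i)) ->
  is_derive x v (fun y => \sum_(i <- s) f i y : R^o) (\sum_(i <- s) df i).
Proof.
move=> Hdf; elim: s => [|i s IH].
  have -> : (fun y : V => \sum_(i <- [::]) f i y : R^o) = cst 0.
    by apply/funext => y; rewrite big_nil.
  by rewrite big_nil; exact: is_derive_cst.
have -> : (fun y : V => \sum_(j <- i :: s) f j y : R^o) =
    f i + (fun y => \sum_(j <- s) f j y : R^o).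
  by apply/funext => y; rewrite big_cons.
by rewrite big_cons; exact: is_deriveD.
Qed.

(** Differentiating the Leibniz expansion gives the sum over i of the determinants of [A x] with row
    i replaced by row i of [dA]; expansion along that row produces the cofactors. *)
Lemma jacobi_formula (V : normedModType R) (n : nat) (A : V -> 'M[R]_n)
    (dA : 'M[R]_n) (x v : V) :
  (forall i j, is_derive x v (fun y => A y i j : R^o) (dA i j : R^o)) ->
  is_derive x v (fun y => \det (A y) : R^o) (\tr (\adj (A x) *m dA) : R^o).
Proof.
move=> HdA; pose B i : 'M[R]_n := \matrix_(k, l) if k == i then dA i l else A x k l.
have tE : \tr (\adj (A x) *m dA) = \sum_i \det (B i).
  transitivity (\sum_i \sum_j dA i j * cofactor (A x) i j).
    rewrite exchange_big; apply: eq_bigr => j _; rewrite mxE.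
    by apply: eq_bigr => i _; rewrite mxE mulrC.
  apply: eq_bigr => i _; rewrite (expand_det_row _ i); apply: eq_bigr => j _.
  rewrite mxE eqxx; congr (_ * (_ * \det _)).
  by apply/matrixP => k l; rewrite !mxE eq_sym (negbTE (neq_lift _ _)).
pose F (s : {perm 'I_n}) (y : V) : R^o := (-1) ^+ s * \prod_i A y i (s i).
pose dF (s : {perm 'I_n}) : R^o := (-1) ^+ s *
  \sum_i dA i (s i) * \prod_(j | j != i) A x j (s j).
have HF s : is_derive x v (F s) (dF s).
  have := is_derive_prod (index_enum_uniq 'I_n) (fun i => HdA i (s i)).
  exact: is_deriveZ.
have FE : (fun y => \det (A y) : R^o) = fun y => \sum_s F s y by [].
rewrite FE tE; have := is_derive_bigsum (index_enum {perm 'I_n}) HF.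
congr (is_derive _ _ _ _); rewrite [RHS]exchange_big /=.
apply: eq_bigr => s _; rewrite /dF mulr_sumr; apply: eq_bigr => i _.
congr (_ * _); rewrite [RHS](bigD1 i)//= /B mxE eqxx; congr (_ * _).
by apply: eq_bigr => j ji; rewrite /B mxE (negbTE ji).
Qed.

End MeanValue.

(** * Charts and tangent maps *)

Section Jacobians.
Context {R : realType}.

Lemma invmxM (n : nat) (A B : 'M[R]_n) : A \in unitmx -> B \in unitmx ->
  invmx (A *m B) = invmx B *m invmx A.
Proof.
move=> Au Bu; have ABu : A *m B \in unitmx by rewrite unitmx_mul Au.
by apply: (can_inj (mulmxK ABu)); rewrite mulVmx// -mulmxA mulKmx// mulVmx.
Qed.

Lemma continuous_within_open (T S : topologicalType) (U : set T) (f : T -> S) (x : T) :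
  open U -> {within U, continuous f} -> U x -> {for x, continuous f}.
Proof.
by move=> Uo; rewrite continuous_open_subspace// => fc Ux; apply: fc; rewrite inE.
Qed.

Lemma jacobian_entry (m n : nat) (f : 'rV[R]_m -> 'rV[R]_n) (u : 'rV[R]_m) i j :
  differentiable f u -> jacobian f u i j = 'D_(delta_mx 0 i) f u 0 j.
Proof. by move=> df; rewrite deriveEjacobian// -rowE [RHS]mxE. Qed.

Lemma jacobian_near (m n : nat) (f g : 'rV[R]_m -> 'rV[R]_n) (u : 'rV[R]_m) :
  (\near u, f u = g u) -> differentiable f u -> jacobian f u = jacobian g u.
Proof.
move=> fg df; have dg := differentiable_near fg df.
apply/matrixP => i j.
have E1 := jacobian_entry i j df.
have E2 := jacobian_entry i j dg.
apply: (etrans E1); apply: (etrans _ (esym E2)).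
by congr (fun_of_matrix _ 0 j); exact: near_eq_derive fg.
Qed.

Lemma jacobian_comp (m n p : nat) (f : 'rV[R]_m -> 'rV[R]_n)
    (g : 'rV[R]_n -> 'rV[R]_p) (u : 'rV[R]_m) :
  differentiable f u -> differentiable g (f u) ->
  jacobian (g \o f) u = jacobian f u *m jacobian g (f u).
Proof.
move=> df dg; apply/row_matrixP => i; rewrite !rowE mulmxA.
have dgf : differentiable (g \o f) u by exact: differentiable_comp.
rewrite -(deriveEjacobian _ dgf) -(deriveEjacobian _ df) -(deriveEjacobian _ dg).
by rewrite (deriveE _ dgf) (deriveE _ df) (deriveE _ dg) diff_comp.
Qed.

Lemma jacobian_id (m : nat) (u : 'rV[R]_m) : jacobian id u = 1%:M.
Proof.
by apply/row_matrixP => i; rewrite !rowE -deriveEjacobian// derive_id mulmx1.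
Qed.

End Jacobians.

Section Charts.
Context {R : realType}.

Local Opaque jacobian.

Lemma coord_at (T : topologicalType) (n : nat) (c : chart R T n) x :
  dom c x -> {for x, continuous c}.
Proof.
move=> cx; apply: (continuous_within_open (open_dom c) _ cx).
exact: Defs.coord_continuous.
Qed.

Lemma param_at (T : topologicalType) (n : nat) (c : chart R T n) u :
  img c u -> {for u, continuous (param c)}.
Proof.
move=> cu; apply: (@continuous_within_open 'rV[R]_n T (img c)) => //; first exact: Defs.open_img.
exact: param_continuous.
Qed.

Lemma open_near (T : topologicalType) (U : set T) :
  (forall x, U x -> \near x, U x) -> open U.
Proof. by move=> H; rewrite openE => x /H. Qed.

Lemma chart_image (T : topologicalType) (n : nat) (c : chart R T n) (U : set T) :
  c @` (dom c `&` U) = [set u | img c u /\ U (param c u)].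
Proof.
apply/seteqP; split => [u [x [cx Ux] <-]|u [cu Uu]] /=.
  by rewrite coordK//; split => //; exact: coord_img.
by exists (param c u); [split => //; exact: param_dom|rewrite paramK].
Qed.

Lemma open_chart_image (T : topologicalType) (n : nat) (c : chart R T n) (U : set T) :
  open U -> open (c @` (dom c `&` U)).
Proof.
move=> Uo; rewrite chart_image; apply: open_near => u [cu Uu].
have Hi : \near u, img c u := open_nbhs_nbhs (conj (@Defs.open_img _ _ _ c) cu).
have Hu : \forall v \near u, U (param c v).
  by apply: (param_at cu); exact: open_nbhs_nbhs.
by apply: filterS2 Hi Hu.
Qed.

Lemma near_chart (T : topologicalType) (n : nat) (c : chart R T n) (x : T) (Q : T -> Prop) :
  dom c x -> (\near x, Q x) -> \forall u \near c x, img c u /\ Q (param c u).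
Proof.
move=> cx Qx; have cu := coord_img cx.
have Hi : \forall u \near c x, img c u := open_nbhs_nbhs (conj (@Defs.open_img _ _ _ c) cu).
have Hu : \forall u \near c x, Q (param c u).
  by apply: (param_at cu); rewrite coordK.
by apply: filterS2 Hi Hu.
Qed.

Section Frames.
Context {n : nat} {M : manifold R n}.
Implicit Types (c d : chart R M n) (x : M).

Lemma transition_differentiable c d x : atlas c -> atlas d -> dom c x -> dom d x ->
  differentiable (d \o param c) (c x).
Proof. by move=> ca da cx dx; apply: (atlas_compat ca da 1).1; exists x. Qed.

Lemma transition_jacobian c d x : atlas c -> atlas d -> dom c x -> dom d x ->
  jacobian (d \o param c) (c x) *m jacobian (c \o param d) (d x) = 1%:M.
Proof.
move=> ca da cx dx.
have dcd := transition_differentiable ca da cx dx.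
have ddc := transition_differentiable da ca dx cx.
have E : (d \o param c) (c x) = d x by rewrite /= coordK.
rewrite -E -jacobian_comp//; last by rewrite E.
rewrite -(jacobian_id (c x)); apply: jacobian_near.
  have := near_chart cx (open_nbhs_nbhs (conj (open_dom d) dx)).
  by apply: filterS => u [cu du] /=; rewrite coordK// paramK.
by apply: differentiable_comp; rewrite ?E.
Qed.

Lemma frame_unit c x : atlas c -> dom c x -> frame c x \in unitmx.
Proof.
move=> ca cx; have := transition_jacobian ca (chart_at_atlas x) cx (chart_at_dom x).
by move=> /mulmx1_unit[fu _]; exact: fu.
Qed.

Lemma frame_inv c x : atlas c -> dom c x ->
  jacobian (c \o param (chart_at x)) (chart_at x x) = invmx (frame c x).
Proof.
move=> ca cx; have := transition_jacobian ca (chart_at_atlas x) cx (chart_at_dom x).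
move=> /(congr1 (mulmx (invmx (frame c x)))).
by rewrite mulmxA mulVmx ?frame_unit// mul1mx mulmx1.
Qed.

Lemma gram_posdef (g : metric M) x : posdef (g x).
Proof. by split; [exact: gram_sym|exact: gram_gt0]. Qed.

Lemma local_formE (g : metric M) c x : dom c x ->
  local_form c g (c x) = frame c x *m g x *m (frame c x)^T.
Proof. by move=> cx; rewrite /local_form coordK. Qed.

Lemma local_form_posdef (g : metric M) c u : atlas c -> img c u ->
  posdef (local_form c g u).
Proof.
by move=> ca cu; apply: posdef_congr; [apply: frame_unit => //; exact: param_dom|exact: gram_posdef].
Qed.

End Frames.

(** * Tangent maps in arbitrary charts *)

Section TangentMaps.

(** The pointwise condition under which the chain rule for [tangent_map] holds. Continuity is part
    of it so that points near [x] are mapped into the chart around [s x]. *)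
Definition chart_differentiable (m n : nat) (M : manifold R m) (N : manifold R n)
    (s : M -> N) (x : M) : Prop :=
  {for x, continuous s} /\
  forall c d, atlas c -> atlas d -> dom c x -> dom d (s x) ->
    differentiable (d \o s \o param c) (c x).

Lemma smooth_map_differentiable (m n : nat) (M : manifold R m) (N : manifold R n)
    (s : M -> N) (x : M) : smooth_map s -> chart_differentiable s x.
Proof.
move=> [sc sk]; split; first exact: sc.
by move=> c d ca da cx dx; apply: (sk _ _ ca da 1).1; exists x.
Qed.

(** Near [c x] the representative of [s] factors through the preferred charts b and e as $(d
    e^{-1})(e s b^{-1})(b c^{-1})$, and the outer Jacobians are frames. *)
Lemma jacobian_tangent_map (m n : nat) (M : manifold R m) (N : manifold R n)
    (s : M -> N) (x : M) c d : chart_differentiable s x ->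
  atlas c -> atlas d -> dom c x -> dom d (s x) ->
  jacobian (d \o s \o param c) (c x) =
  frame c x *m tangent_map s x *m invmx (frame d (s x)).
Proof.
move=> [sc sd] ca da cx dx.
set b := chart_at x; set e := chart_at (s x).
have ba : atlas b by exact: chart_at_atlas.
have ea : atlas e by exact: chart_at_atlas.
have bx : dom b x by exact: chart_at_dom.
have ex : dom e (s x) by exact: chart_at_dom.
have dcb := transition_differentiable ca ba cx bx.
have dbe : differentiable (e \o s \o param b) ((b \o param c) (c x)).
  by rewrite /= coordK//; exact: sd.
have ded : differentiable (d \o param e) ((e \o s \o param b) ((b \o param c) (c x))).
  by rewrite /= !coordK//; exact: transition_differentiable.
rewrite -frame_inv// -/e /tangent_map /frame -/b -/e.
have bE : b x = (b \o param c) (c x) by rewrite /= coordK.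
have eE : e (s x) = (e \o s \o param b) ((b \o param c) (c x)) by rewrite /= !coordK.
have dsc := differentiable_comp dcb dbe.
rewrite bE eE -(jacobian_comp dcb dbe) -(jacobian_comp dsc ded).
apply/esym; apply: jacobian_near; last exact: differentiable_comp.
have nb : \near x, dom b x := open_nbhs_nbhs (conj (open_dom b) bx).
have ne : \forall y \near x, dom e (s y).
  by apply: sc; apply: open_nbhs_nbhs; split => //; exact: open_dom.
have nbe : \forall y \near x, dom b y /\ dom e (s y) by apply: filterS2 nb ne.
have := near_chart cx nbe.
by apply: filterS => u [cu [bu eu]] /=; rewrite !coordK// coordK.
Qed.

Lemma tangent_map_comp (m n p : nat) (M : manifold R m) (N : manifold R n)
    (Q : manifold R p) (s : M -> N) (f : N -> Q) (x : M) :
  chart_differentiable s x -> chart_differentiable f (s x) ->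
  chart_differentiable (f \o s) x /\
  tangent_map (f \o s) x = tangent_map s x *m tangent_map f (s x).
Proof.
move=> [sc sd] [fc fd].
have cc : {for x, continuous (f \o s)} by apply: continuous_comp.
set e := chart_at (s x).
have ea : atlas e by exact: chart_at_atlas.
have ex : dom e (s x) by exact: chart_at_dom.
have ne : \forall y \near x, dom e (s y).
  by apply: sc; apply: open_nbhs_nbhs; split => //; exact: open_dom.
have E c d : atlas c -> atlas d -> dom c x -> dom d (f (s x)) ->
    differentiable (d \o f \o param e) ((e \o s \o param c) (c x)) /\
    \forall u \near c x, ((d \o f \o param e) \o (e \o s \o param c)) u =
      (d \o (f \o s) \o param c) u.
  move=> ca da cx dx; split; first by rewrite /= !coordK//; exact: fd.
  by have := near_chart cx ne; apply: filterS => u [cu eu] /=; rewrite coordK.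
split.
  split=> // c d ca da cx dx; have [dd nn] := E c d ca da cx dx.
  by apply: differentiable_near nn _; apply: differentiable_comp => //; exact: sd.
have [ba bx] := (chart_at_atlas x, chart_at_dom x).
have [da dx] := (chart_at_atlas (f (s x)), chart_at_dom (f (s x))).
have [dd nn] := E _ _ ba da bx dx.
rewrite /tangent_map -/e.
have eE : e (s x) = (e \o s \o param (chart_at x)) (chart_at x x) by rewrite /= !coordK.
have ds := sd _ _ ba ea bx ex.
rewrite eE -(jacobian_comp ds dd).
apply/esym; apply: jacobian_near nn _; exact: differentiable_comp.
Qed.

Lemma tangent_map_id (m : nat) (M : manifold R m) (x : M) : tangent_map id x = 1%:M.
Proof.
have bx := chart_at_dom x; have ba := chart_at_atlas x.
rewrite -(jacobian_id (chart_at x x)); apply: jacobian_near; last first.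
  exact: (transition_differentiable ba ba bx bx).
have := near_chart bx (open_nbhs_nbhs (conj (open_dom (chart_at x)) bx)).
by apply: filterS => u [cu _]; exact: paramK.
Qed.

(** The frame at [y] cancels and the frame at [x] acts by conjugation, so conjugation-invariant
    functions of the tensor can be computed in any pair of charts. *)
Lemma pull_tensor_local (m n : nat) (M : manifold R m) (P : manifold R n)
    (g : metric M) (k : metric P) (x : M) (y : P) c d (L : 'M[R]_(m, n)) :
  atlas c -> atlas d -> dom c x -> dom d y ->
  let L' := frame c x *m L *m invmx (frame d y) in
  L' *m local_form d k (d y) *m L'^T *m invmx (local_form c g (c x)) =
  frame c x *m pull_tensor g k x y L *m invmx (frame c x).
Proof.
move=> ca da cx dy L'; have cu := frame_unit ca cx; have du := frame_unit da dy.
have gu := posdef_unit (gram_posdef g x).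
have dtu : (frame d y)^T \in unitmx by rewrite unitmx_tr.
have ctu : (frame c x)^T \in unitmx by rewrite unitmx_tr.
rewrite !local_formE// /pull_tensor /L'; move: (frame c x) (frame d y) cu du ctu dtu.
move=> C D cu du ctu dtu; rewrite !trmx_mul trmx_inv !mulmxA mulmxKV//.
rewrite -[_ *m D^T *m _]mulmxA mulmxV// mulmx1 !invmxM//; last by rewrite unitmx_mul cu.
by rewrite !mulmxA -[_ *m C^T *m _]mulmxA mulmxV// mulmx1.
Qed.

End TangentMaps.
End Charts.

(** * Smooth families of maps *)

Section Families.
Context {R : realType}.

Lemma near_pair (T S : topologicalType) (x : T) (y : S) (P : T -> Prop) (Q : S -> Prop) :
  (\near x, P x) -> (\near y, Q y) -> \forall z \near (x, y), P z.1 /\ Q z.2.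
Proof. by move=> Px Qy; exists (P, Q) => // -[a b] [/= Pa Qb]. Qed.

Lemma near_pair_map (T S S' : topologicalType) (f : S -> S') (x : T) (y : S)
    (Q : T * S' -> Prop) : {for y, continuous f} ->
  (\forall z \near (x, f y), Q z) -> \forall z \near (x, y), Q (z.1, f z.2).
Proof.
move=> fc [[A B] [/= Ax By] AB]; exists (A, f @^-1` B).
  by split=> //; exact: fc.
by move=> [a b] [/= Aa Bb]; apply: AB.
Qed.

Lemma near_slice (T S : topologicalType) (x : T) (y : S) (Q : T * S -> Prop) :
  (\forall z \near (x, y), Q z) -> \forall s \near y, Q (x, s).
Proof.
move=> [[A B] [/= Ax By] AB]; apply: filterS By => s Bs; apply: AB; split=> //.
exact: nbhs_singleton Ax.
Qed.

Lemma near_swap (T S : topologicalType) (x : T) (y : S) (Q : T -> S -> Prop) :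
  (\forall z \near (x, y), Q z.1 z.2) -> \forall z \near (y, x), Q z.2 z.1.
Proof.
move=> [[A B] [/= Ax By] AB]; exists (B, A) => // -[b a] [/= Bb Aa].
exact: (AB (a, b)).
Qed.

(** Joint smoothness is asked only near time 0, in a neighbourhood of each [(0, c x)], because every
    time derivative is taken at 0. In this form the notion is stable under composition with a smooth
    map, as required for $\pi \circ F_t$. *)
Definition smooth_family (m n : nat) (M : manifold R m) (N : manifold R n)
    (e : R) (F : R -> M -> N) : Prop :=
  [/\ 0 < e, forall t x, `|t| < e -> chart_differentiable (F t) x &
    forall x c d, atlas c -> atlas d -> dom c x -> dom d (F 0 x) ->
    exists W : set (R^o * 'rV[R]_m), [/\ open W, W (0, c x),
      forall w, W w -> [/\ `|w.1| < e, img c w.2 & dom d (F w.1 (param c w.2))] &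
      forall k, Ck k W (fun w => d (F w.1 (param c w.2)))]].

Lemma space_slice (m : nat) (W : normedModType R) (f : R^o * 'rV[R]_m -> W) (t : R^o) (u : 'rV[R]_m) :
  differentiable f (t, u) ->
  differentiable (fun v => f (t, v)) u /\
  forall v, 'D_v (fun v => f (t, v)) u = 'D_((0 : R^o, v)) f (t, u).
Proof.
move=> df; split.
  have dp : differentiable (fun v : 'rV[R]_m => (t, v) : R^o * 'rV[R]_m) u.
    by apply: differentiable_pair; [exact: differentiable_cst|].
  exact: (differentiable_comp dp df).
move=> v.
have E (h : R) : (t, h *: v + u) = h *: ((0 : R^o), v) + (t, u) :> R^o * 'rV[R]_m.
  by congr pair; rewrite /= scaler0 add0r.
by rewrite /derive; congr lim; under eq_fun do rewrite /= E.
Qed.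

Lemma variation_smooth_family (m n : nat) (M : manifold R m) (P : manifold R n)
    (e : R) (s : M -> P) (F : R -> M -> P) :
  Defs.variation e s F -> smooth_family e F.
Proof.
move=> [e0 F0 Fc Fk].
pose W (c : chart R M m) (d : chart R P n) := [set w : R^o * 'rV[R]_m |
  [/\ `|w.1| < e, img c w.2 & dom d (F w.1 (param c w.2))]].
have Wo c d : open (W c d).
  apply: open_near => -[t u] [/= te cu du].
  have H1 : \forall s \near (t : R^o), `|s| < e.
    have e1 : 0 < e - `|t| by rewrite subr_gt0.
    apply: filterS (near_dist (f := fun s : R^o => s) (x := t) (@cvg_id _ _) e1) => s'.
    by move=> h; have := ler_distD t s' 0; rewrite !subr0 [`|s' - t|]distrC; lra.
  have H2 : \forall v \near u, img c v := open_nbhs_nbhs (conj (@Defs.open_img _ _ _ c) cu).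
  have H3 : \forall w \near ((t, u) : R^o * 'rV[R]_m), dom d (F w.1 (param c w.2)).
    have H : nbhs (F t (param c u)) (dom d) := open_nbhs_nbhs (conj (open_dom d) du).
    have HF := Fc (t, param c u) te _ H.
    exact: (near_pair_map (param_at cu) HF).
  by apply: filterS2 (near_pair H1 H2) H3 => -[s' v] [/= ? ?] ?; split.
split=> // [t x te|x c d ca da cx dx]; last first.
  exists (W c d); split=> //.
    by split; rewrite /= ?normr0//; [exact: coord_img|rewrite coordK].
  by move=> k; exact: Fk.
split.
  by move=> Q HQ; exact: (near_slice (Fc (t, x) te Q HQ)).
move=> c d ca da cx dx; apply: (space_slice (f := fun w => d (F w.1 (param c w.2))) _).1.
by apply: (Fk _ _ ca da 1%N).1; split; rewrite /= ?coordK//; exact: coord_img.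
Qed.

Lemma smooth_family_comp (m n p : nat) (M : manifold R m) (N : manifold R n)
    (Q : manifold R p) (e : R) (F : R -> M -> N) (f : N -> Q) :
  smooth_family e F -> smooth_map f -> smooth_family e (fun t => f \o F t).
Proof.
move=> [e0 Fd Fk] fs; split=> // [t x te|x c d ca da cx dx].
  by apply: (tangent_map_comp (Fd t x te) _).1; exact: smooth_map_differentiable.
pose b := chart_at (F 0 x); have ba : atlas b by exact: chart_at_atlas.
have bx : dom b (F 0 x) by exact: chart_at_dom.
have [W [Wo W0 Wdom Wk]] := Fk x c b ca ba cx bx.
pose V := b @` (dom b `&` f @^-1` dom d).
have Vo : open V.
  apply: open_chart_image; apply: open_comp; last exact: open_dom.
  by move=> y _; exact: fs.1.
have bE w : W w -> param b (b (F w.1 (param c w.2))) = F w.1 (param c w.2).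
  by move=> /Wdom[_ _ ?]; rewrite coordK.
exists (W `&` (fun w => b (F w.1 (param c w.2))) @^-1` V).
have W'o : open (W `&` (fun w => b (F w.1 (param c w.2))) @^-1` V).
  apply: open_near => w [Ww Vw].
  have H : \forall w' \near w, V (b (F w'.1 (param c w'.2))).
    by apply: (Wk 0%N w Ww); apply: open_nbhs_nbhs.
  by apply: filterS2 (open_nbhs_nbhs (conj Wo Ww)) H.
split=> //.
- by split => //=; exists (F 0 x); [split|rewrite coordK].
- move=> w [Ww]; rewrite /V chart_image /= bE// => -[_ fd].
  by have [? ? _] := Wdom w Ww; split.
move=> k; apply: Ck_row => // j.
have Wk' i : Ck k (W `&` (fun w => b (F w.1 (param c w.2))) @^-1` V)
    (fun w => b (F w.1 (param c w.2)) 0 i : R^o).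
  by apply: Ck_sub (Ck_entry 0 i Wo (Wk k)); exact: subIsetl.
have fk : Ck k V (fun y => (d \o f \o param b) y 0 j : R^o).
  by apply: Ck_entry => //; exact: (fs.2 _ _ ba da k).
have := Ck_comp W'o (fun w => @proj2 _ _) Wk' fk.
by apply: Ck_ext => // w [Ww _] /=; rewrite bE.
Qed.

Definition C1_family (m : nat) (M : manifold R m) (Phi : R -> M -> R) : Prop :=
  forall x c, atlas c -> dom c x ->
  exists W : set (R^o * 'rV[R]_m), [/\ open W, W (0, c x),
    forall w, W w -> img c w.2 &
    Ck 1 W (fun w => Phi w.1 (param c w.2) : R^o)].

Definition time_derivative (T : Type) (Phi : R -> T -> R) (x : T) : R :=
  'D_1 (fun t : R^o => Phi t x : R^o) 0.

Section C1Families.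
Context {m : nat} {M : manifold R m}.

Lemma C1_familyB (Phi Psi : R -> M -> R) :
  C1_family Phi -> C1_family Psi -> C1_family (fun t x => Phi t x - Psi t x).
Proof.
move=> hPhi hPsi x c ca cx.
have [W [Wo W0 Wi Wk]] := hPhi x c ca cx; have [V [Vo V0 _ Vk]] := hPsi x c ca cx.
have WVo : open (W `&` V) by exact: openI.
exists (W `&` V); split=> // [w [/Wi]//|].
apply: Ck_sub_fun => //; first exact: Ck_sub Wk.
exact: Ck_sub Vk.
Qed.

Lemma time_slice (phi : R^o * 'rV[R]_m -> R^o) (u : 'rV[R]_m) :
  differentiable phi (0, u) ->
  is_derive (0 : R^o) 1 (fun t : R^o => phi (t, u)) ('D_((1 : R^o, 0)) phi (0, u)).
Proof.
move=> dphi; have dv := diff_derivable (v := (1 : R^o, 0)) dphi.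
have E : (fun h : R => h^-1 *: (((fun t : R^o => phi (t, u)) \o shift (0 : R^o))
    (h *: (1 : R^o)) - phi (0, u))) =
  (fun h : R => h^-1 *: ((phi \o shift ((0, u) : R^o * 'rV[R]_m)) (h *: ((1 : R^o), 0)) - phi (0, u))).
  apply/funext => h /=; congr (_ *: (phi _ - _)).
  by congr pair; rewrite /= scaler0 add0r.
by apply: DeriveDef; rewrite ?/derivable ?/derive E.
Qed.

Lemma time_derivativeE (Phi : R -> M -> R) (c : chart R M m) W (x : M) :
  open W -> W (0, c x) -> dom c x -> Ck 1 W (fun w => Phi w.1 (param c w.2) : R^o) ->
  is_derive (0 : R^o) 1 (fun t : R^o => Phi t x : R^o) (time_derivative Phi x : R^o) /\
  time_derivative Phi x =
    'D_((1 : R^o, 0)) (fun w : R^o * 'rV[R]_m => Phi w.1 (param c w.2) : R^o) (0, c x).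
Proof.
move=> Wo W0 cx Wk; have := time_slice (Wk.1 _ W0).
have -> : (fun t : R^o => Phi (t, c x).1 (param c (t, c x).2) : R^o) = (fun t : R^o => Phi t x).
  by apply/funext => t; rewrite /= coordK.
by move=> D; split; [apply: DeriveDef; [exact: ex_derive|]|rewrite -(derive_val (is_derive := D))].
Qed.

Lemma local_expansion (Phi : R -> M -> R) (x : M) (e : R) : C1_family Phi -> 0 < e ->
  \forall y \near x & t \near (0 : R^o),
    `|Phi t y - Phi 0 y - t * time_derivative Phi y| <= e * `|t|.
Proof.
move=> hPhi e0; have ca := chart_at_atlas x; have cx := chart_at_dom x.
set c := chart_at x in ca cx; have [W [Wo W0 Wi Wk]] := hPhi x c ca cx.
have H := time_expansion Wo W0 Wk e0.
have W0n : \forall w \near ((0, c x) : R^o * 'rV[R]_m), W (0, w.2).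
  apply: filterS (near_pair (x := (0 : R^o)) filterT (near_slice (x := (0 : R^o)) (open_nbhs_nbhs (conj Wo W0)))).
  by move=> z [].
have nc : \near x, dom c x := open_nbhs_nbhs (conj (open_dom c) cx).
have HW : \forall w \near ((0, c x) : R^o * 'rV[R]_m),
   `|Phi w.1 (param c w.2) - Phi 0 (param c w.2) -
     w.1 * 'D_((1 : R^o, 0)) (fun w : R^o * 'rV[R]_m => Phi w.1 (param c w.2) : R^o) (0, w.2)|
      <= e * `|w.1| /\ W (0, w.2).
  by apply: filterS2 H W0n.
have HM := near_pair_map (coord_at cx) HW.
apply: (near_swap (x := (0 : R^o)) (Q := fun t y =>
  `|Phi t y - Phi 0 y - t * time_derivative Phi y| <= e * `|t|)).
apply: filterS2 HM (near_pair (x := (0 : R^o)) filterT nc) => -[t y] /= [].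
move=> + W0y [_ cy]; rewrite coordK//.
by have [_ <-] := time_derivativeE Wo W0y cy Wk.
Qed.

Lemma uniform_expansion (Phi : R -> M -> R) (e : R) : compact [set: M] ->
  C1_family Phi -> 0 < e ->
  \forall t \near (0 : R^o), forall y,
    `|Phi t y - Phi 0 y - t * time_derivative Phi y| <= e * `|t|.
Proof.
move=> /compact_near_coveringP cM hPhi e0.
have := cM _ (nbhs (0 : R^o))
  (fun t y => `|Phi t y - Phi 0 y - t * time_derivative Phi y| <= e * `|t|) _.
move=> /(_ _ (fun x _ => local_expansion x hPhi e0)).
by apply: filterS => t H y; exact: H.
Qed.

Lemma nonneg_littleo (Phi : R -> M -> R) (e : R) : compact [set: M] ->
  C1_family Phi -> (\forall t \near (0 : R^o), forall y, 0 <= Phi t y) ->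
  (forall y, Phi 0 y = 0) -> 0 < e ->
  \forall t \near (0 : R^o), forall y, `|Phi t y| <= e * `|t|.
Proof.
move=> cM hPhi Phi_ge0 Phi0 e0.
have d0 y : time_derivative Phi y = 0.
  set D := time_derivative Phi y.
  apply/eqP; rewrite -normr_eq0; apply/eqP/le_anti.
  rewrite normr_ge0 andbT; apply/ler_addgt0Pr => e' e'0; rewrite add0r.
  have H := uniform_expansion cM hPhi e'0.
  have : \forall t \near (0 : R^o), 0 <= t * D + e' * `|t|.
    apply: filterS2 Phi_ge0 H => t /(_ y) + /(_ y); rewrite -/D Phi0 subr0.
    by move=> h1 /ler_normlP[_ h2]; move: h1 h2; move: (Phi t y) => a; lra.
  move=> /nbhs_normP[r /= r0 Br].
  have B (t : R) : `|t| < r -> 0 <= t * D + e' * `|t|.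
    by move=> tr; apply: Br; rewrite /= sub0r normrN.
  have r2 : 0 < r / 2 by rewrite divr_gt0.
  (* The two signs of time bound the derivative [D] by [e'] from above and from below. *)
  have := B (r / 2); have := B (- (r / 2)); rewrite normrN gtr0_norm// => h1 h2.
  have r2r : r / 2 < r by lra.
  move: (h1 r2r) (h2 r2r); rewrite ler_norml mulNr => {}h1 {}h2.
  by apply/andP; split; nra.
apply: filterS (uniform_expansion cM hPhi e0) => t H y.
by have := H y; rewrite d0 Phi0 mulr0 !subr0.
Qed.

End C1Families.
End Families.

(** * Tensors along a family *)

Section TensorFamilies.
Context {R : realType}.

(** Built from directional derivatives of the joint function of time and position, so that its
    regularity in both variables is inherited directly. *)
Definition space_jacobian (m n : nat) (f : R^o * 'rV[R]_m -> 'rV[R]_n)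
    (w : R^o * 'rV[R]_m) : 'M[R]_(m, n) :=
  \matrix_(i, j) 'D_((0 : R^o, delta_mx 0 i)) f w 0 j.

Lemma space_jacobianE (m n : nat) (f : R^o * 'rV[R]_m -> 'rV[R]_n) w :
  differentiable f w -> jacobian (fun v => f (w.1, v)) w.2 = space_jacobian f w.
Proof.
case: w => t u df; have [ds Ds] := space_slice df.
apply/matrixP => i j; rewrite [RHS]mxE; apply: (etrans (jacobian_entry i j ds)).
by rewrite Ds.
Qed.

Lemma Ckmx_space_jacobian (m n k : nat) (W : set (R^o * 'rV[R]_m))
    (f : R^o * 'rV[R]_m -> 'rV[R]_n) : open W ->
  Ck k.+1 W f -> Ckmx k W (space_jacobian f).
Proof.
move=> Wo fk i j; apply: Ck_ext (Ck_entry 0 j Wo (fk.2 _)) => // w Ww.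
by rewrite mxE.
Qed.

Lemma Ckmx_comp (V : normedModType R) (n p q k : nat) (W : set V)
    (f : V -> 'rV[R]_n) (U : set 'rV[R]_n) (A : 'rV[R]_n -> 'M[R]_(p, q)) :
  open W -> open U -> (forall w, W w -> U (f w)) ->
  Ck k W f -> Ckmx k U A -> Ckmx k W (fun w => A (f w)).
Proof.
move=> Wo Uo WU fk Ak i j.
apply: (Ck_comp Wo WU (g := fun u => A u i j)); last exact: Ak.
by move=> l; exact: Ck_entry.
Qed.

Lemma Ckmx_local_form (n k : nat) (M : manifold R n) (g : metric M) (c : chart R M n) :
  atlas c -> Ckmx k (img c) (local_form c g).
Proof.
move=> ca i j; apply: Ck_entry; first exact: Defs.open_img.
exact: gram_smooth.
Qed.

Lemma Ck_snd (m k : nat) (W : set (R^o * 'rV[R]_m)) :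
  Ck k W (fun w => w.2 : 'rV[R]_m).
Proof.
apply: (@Ck_linear _ _ _ k W (snd : {linear (R^o * 'rV[R]_m)%type -> 'rV[R]_m})).
by move=> w; exact: cvg_snd.
Qed.

Context {m n : nat} {M : manifold R m} {P : manifold R n}.
Variables (g : metric M) (k : metric P).

Lemma local_tangent_map (e : R) (F : R -> M -> P) (x : M) (c : chart R M m)
    (d : chart R P n) (t : R) :
  smooth_family e F -> `|t| < e -> atlas c -> atlas d -> dom c x -> dom d (F t x) ->
  differentiable (fun w : R^o * 'rV[R]_m => d (F w.1 (param c w.2))) ((t : R^o), c x) ->
  space_jacobian (fun w => d (F w.1 (param c w.2))) ((t : R^o), c x) =
  frame c x *m tangent_map (F t) x *m invmx (frame d (F t x)).
Proof.
move=> [_ Fd _] te ca da cx dx df.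
by rewrite -space_jacobianE//; exact: (jacobian_tangent_map (Fd t x te)).
Qed.

Lemma local_pull_tensor (e : R) (F : R -> M -> P) (x0 : M) (c : chart R M m) :
  smooth_family e F -> atlas c -> dom c x0 ->
  exists W A, [/\ open W, W ((0 : R^o), c x0),
    forall w, W w -> [/\ `|w.1| < e, img c w.2 &
      let x := param c w.2 in
      A w = frame c x *m pull_tensor g k x (F w.1 x) (tangent_map (F w.1) x)
              *m invmx (frame c x)] &
    Ckmx 1 W (A : R^o * 'rV[R]_m -> 'M[R]_m)].
Proof.
move=> sF ca cx; have [e0 Fd Fk] := sF.
pose d := chart_at (F 0 x0); have da : atlas d by exact: chart_at_atlas.
have [W [Wo W0 Wdom Wk]] := Fk x0 c d ca da cx (chart_at_dom _).
pose fh (w : R^o * 'rV[R]_m) := d (F w.1 (param c w.2)).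
pose L w := space_jacobian fh w.
exists W, (fun w => L w *m local_form d k (fh w) *m (L w)^T
                      *m invmx (local_form c g w.2)).
have Lk : Ckmx 1 W L by apply: Ckmx_space_jacobian => //; exact: Wk.
split=> // [w Ww|].
  have [we wc wd] := Wdom w Ww; split=> //=.
  have [cx' uE] := (param_dom wc, paramK wc).
  rewrite -(pull_tensor_local g k _ ca da cx' wd) uE.
  suff -> : L w = frame c (param c w.2) *m tangent_map (F w.1) (param c w.2)
     *m invmx (frame d (F w.1 (param c w.2))) by [].
  rewrite -(local_tangent_map sF)// uE; first by case: w {Ww we wc wd cx' uE}.
  by case: w Ww {we wc wd cx' uE} => t u Ww; exact: (Wk 1%N).1.
have Kk : Ckmx 1 W (fun w => local_form d k (fh w)).
  apply: (@Ckmx_comp _ _ _ _ 1 W fh (img d)); first exact: Wo.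
  - exact: Defs.open_img.
  - by move=> w /Wdom[_ _ wd]; exact: coord_img.
  - exact: (Wk 1%N).
  - exact: Ckmx_local_form.
have Gk : Ckmx 1 W (fun w => local_form c g w.2).
  apply: (@Ckmx_comp _ _ _ _ 1 W snd (img c)); first exact: Wo.
  - exact: Defs.open_img.
  - by move=> w /Wdom[].
  - exact: Ck_snd.
  - exact: Ckmx_local_form.
have Gu w : W w -> local_form c g w.2 \in unitmx.
  by move=> /Wdom[_ wc _]; apply: posdef_unit; exact: local_form_posdef.
exact: (Ckmx_mul Wo (Ckmx_mul Wo (Ckmx_mul Wo Lk Kk) (Ckmx_tr Wo Lk)) (Ckmx_inv Wo Gu Gk)).
Qed.

(** Invariance of [f] under conjugation removes the frame, which depends on the preferred chart and
    may jump from point to point; what remains is [f] of the C^1 matrix supplied by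
    [local_pull_tensor]. *)
Lemma pull_tensor_C1 (e : R) (F : R -> M -> P) (f : 'M[R]_m -> R) :
  smooth_family e F ->
  (forall U A, U \in unitmx -> f (U *m A *m invmx U) = f A) ->
  (forall W (A : R^o * 'rV[R]_m -> 'M[R]_m), open W -> Ckmx 1 W A ->
     Ck 1 W (fun w => f (A w) : R^o)) ->
  C1_family (fun t x => f (pull_tensor g k x (F t x) (tangent_map (F t) x))).
Proof.
move=> sF fconj fC1 x c ca cx.
have [W [A [Wo W0 WA Ak]]] := local_pull_tensor sF ca cx.
exists W; split=> // [w /WA[]//|].
apply: Ck_ext (fC1 W A Wo Ak) => // w Ww; have [_ wc ->] := WA w Ww.
by rewrite fconj//; apply: frame_unit => //; exact: param_dom.
Qed.

Variable pr : P -> M.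

(** With frames C below and D above, T becomes $D T C^{-1}$ and the metric K becomes $D K D^T$,
    whence the horizontal lift H becomes $C H D^{-1}$. *)
Lemma vproj_local (p : P) (c : chart R M m) (d : chart R P n) :
  submersion pr -> atlas c -> atlas d -> dom c (pr p) -> dom d p ->
  let T := jacobian (c \o pr \o param d) (d p) in
  row_full T /\
  1%:M - T *m hlift (local_form d k (d p)) T =
  frame d p *m vproj k pr p *m invmx (frame d p).
Proof.
move=> [prs prf] ca da cp dp.
rewrite /= (jacobian_tangent_map (smooth_map_differentiable _ prs))//.
have cu := frame_unit ca cp; have du := frame_unit da dp.
rewrite local_formE//; move: (frame c _) (frame d _) cu du => C D cu du.
have Tf := prf p; set T := tangent_map pr p in Tf *.
have Kp := gram_posdef k p.
have ctu : C^T \in unitmx by rewrite unitmx_tr.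
have dtu : D^T \in unitmx by rewrite unitmx_tr.
have civu : invmx C \in unitmx by rewrite unitmx_inv.
split.
  rewrite /row_full mxrankMfree ?row_free_unit// (eqmxMfull T _)//.
  by rewrite row_full_unit.
rewrite /vproj (vproj_formula Kp Tf) mulmxBr mulmx1 mulmxBl mulmxV//; congr (_ - _).
set H := hlift (k p) T.
suff -> : hlift (D *m k p *m D^T) (D *m T *m invmx C) = C *m H *m invmx D.
  by rewrite !mulmxA mulmxKV.
have Ku := posdef_unit Kp; have Su := posdef_unit (hgram_posdef Kp Tf).
have E1 : (D *m T *m invmx C)^T *m invmx (D *m k p *m D^T) =
    invmx C^T *m (T^T *m invmx (k p)) *m invmx D.
  rewrite !trmx_mul trmx_inv !invmxM ?unitmx_mul ?du ?Ku// !mulmxA.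
  by rewrite -[_ *m D^T *m _]mulmxA mulmxV// mulmx1.
have E2 : (D *m T *m invmx C)^T *m invmx (D *m k p *m D^T) *m (D *m T *m invmx C) =
    invmx C^T *m (T^T *m invmx (k p) *m T) *m invmx C.
  by rewrite E1 !mulmxA mulmxKV.
have E3 : invmx (invmx C^T *m (T^T *m invmx (k p) *m T) *m invmx C) =
    C *m invmx (T^T *m invmx (k p) *m T) *m C^T.
  by rewrite !invmxM ?unitmx_mul ?unitmx_inv ?ctu ?Su// !invmxK mulmxA.
rewrite /hlift E2 E3 -[LHS]mulmxA E1 /H /hlift.
by rewrite !mulmxA -[_ *m C^T *m _]mulmxA mulmxV// mulmx1.
Qed.

(** One chart [c] serves both at x and at pr (F t x): these points coincide at t = 0 since [F 0] is
    a section, and the neighbourhood [W'] keeps pr (F t x) in [dom c]. The vertical projection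
    enters through its rational formula. *)
Lemma veps_C1 (e : R) (F : R -> M -> P) (f : 'M[R]_m -> R) :
  submersion pr -> smooth_family e F -> is_section pr (F 0) ->
  (forall U A, U \in unitmx -> f (U *m A *m invmx U) = f A) ->
  (forall W (A : R^o * 'rV[R]_m -> 'M[R]_m), open W -> Ckmx 1 W A ->
     Ck 1 W (fun w => f (A w) : R^o)) ->
  C1_family (fun t x => f (pull_tensor g k x (F t x) (vtangent_map k pr (F t) x))).
Proof.
move=> prS sF sec fconj fC1 x0 c ca cx; have [e0 Fd Fk] := sF.
pose d := chart_at (F 0 x0); have da : atlas d by exact: chart_at_atlas.
have [W [Wo W0 Wdom Wk]] := Fk x0 c d ca da cx (chart_at_dom _).
pose fh (w : R^o * 'rV[R]_m) := d (F w.1 (param c w.2)).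
pose ph := c \o pr \o param d.
pose V := d @` (dom d `&` pr @^-1` dom c).
have Vo : open V.
  apply: open_chart_image; apply: open_comp; last exact: open_dom.
  by move=> y _; exact: prS.1.1.
have phs : smooth_on V ph by exact: (prS.1.2 _ _ da ca).
pose T := jacobian ph.
have Tk : Ckmx 1 V T.
  move=> i j; have Dk : Ck 1 V (fun y => 'D_(delta_mx 0 i) ph y) := (phs 2%N).2 _.
  apply: Ck_ext (Ck_entry 0 j Vo Dk) => // y Vy.
  by apply/esym; apply: jacobian_entry; exact: (phs 1%N).1.
have W'o : open (W `&` fh @^-1` V).
  apply: open_near => w [Ww Vw].
  have H : \forall w' \near w, V (fh w').
    by apply: (Wk 0%N w Ww); apply: open_nbhs_nbhs.
  by apply: filterS2 (open_nbhs_nbhs (conj Wo Ww)) H.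
set W' := W `&` fh @^-1` V in W'o.
have fhk j : Ck j W' fh by apply: Ck_sub (Wk j) => w [].
have W'dom w : W' w -> let x := param c w.2 in
    [/\ `|w.1| < e, img c w.2, dom c x, dom d (F w.1 x) & dom c (pr (F w.1 x))].
  move=> [Ww]; have [we wc wd] := Wdom w Ww; rewrite /= /V chart_image /fh => -[_].
  by rewrite /= coordK//; split=> //; exact: param_dom.
have [imgc imgd] := (@Defs.open_img _ _ _ c, @Defs.open_img _ _ _ d).
have fhd w : W' w -> img d (fh w) by move=> /W'dom[_ _ _ wd _]; exact: coord_img.
pose J w := space_jacobian fh w; pose K w := local_form d k (fh w).
pose G (w : R^o * 'rV[R]_m) := local_form c g w.2; pose Tw w := T (fh w).
have Jk : Ckmx 1 W' J by apply: Ckmx_space_jacobian => //; exact: fhk.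
have Kk : Ckmx 1 W' K.
  apply: (@Ckmx_comp _ _ _ _ 1 W' fh (img d)) => //; exact: Ckmx_local_form.
have Gk : Ckmx 1 W' G.
  apply: (@Ckmx_comp _ _ _ _ 1 W' snd (img c)) => //; first by move=> w /W'dom[].
    exact: Ck_snd.
  exact: Ckmx_local_form.
have Tk' : Ckmx 1 W' Tw by apply: (@Ckmx_comp _ _ _ _ 1 W' fh V) => // w [].
have Kp w : W' w -> posdef (K w) by move=> /fhd; exact: local_form_posdef.
have Gu w : W' w -> G w \in unitmx.
  by move=> /W'dom[_ wc _ _ _]; apply: posdef_unit; exact: local_form_posdef.
have VT w : W' w -> row_full (Tw w) /\ 1%:M - Tw w *m hlift (K w) (Tw w) =
    frame d (F w.1 (param c w.2)) *m vproj k pr (F w.1 (param c w.2))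
      *m invmx (frame d (F w.1 (param c w.2))).
  by move=> /W'dom[_ _ _ wd wp]; exact: vproj_local.
have Su w : W' w -> (Tw w)^T *m invmx (K w) *m Tw w \in unitmx.
  by move=> Ww; apply: posdef_unit; apply: hgram_posdef (Kp w Ww) (VT w Ww).1.
have Kik : Ckmx 1 W' (fun w => invmx (K w)).
  by apply: Ckmx_inv => // w /Kp; exact: posdef_unit.
have Sk : Ckmx 1 W' (fun w => (Tw w)^T *m invmx (K w) *m Tw w).
  exact: (Ckmx_mul W'o (Ckmx_mul W'o (Ckmx_tr W'o Tk') Kik) Tk').
have Hk : Ckmx 1 W' (fun w => hlift (K w) (Tw w)).
  exact: (Ckmx_mul W'o (Ckmx_mul W'o (Ckmx_inv W'o Su Sk) (Ckmx_tr W'o Tk')) Kik).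
pose L w := J w *m (1%:M - Tw w *m hlift (K w) (Tw w)).
have Lk : Ckmx 1 W' L.
  exact: (Ckmx_mul W'o Jk (Ckmx_sub W'o (Ckmx_cst _ _ 1%:M) (Ckmx_mul W'o Tk' Hk))).
pose A w := L w *m K w *m (L w)^T *m invmx (G w).
have Ak : Ckmx 1 W' A.
  exact: (Ckmx_mul W'o (Ckmx_mul W'o (Ckmx_mul W'o Lk Kk) (Ckmx_tr W'o Lk))
           (Ckmx_inv W'o Gu Gk)).
exists W'; split=> //.
- have dx : dom d (F 0 x0) := chart_at_dom _.
  split=> //=; rewrite /V chart_image /fh /= !coordK ?sec//; split=> //.
  exact: coord_img.
- by move=> w /W'dom[].
apply: Ck_ext (fC1 W' A W'o Ak) => // w Ww.
have [we wc cx' wd wp] := W'dom w Ww; set x := param c w.2 in cx' wd wp *.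
have uE : c x = w.2 := paramK wc.
have LE : L w = frame c x *m vtangent_map k pr (F w.1) x *m invmx (frame d (F w.1 x)).
  rewrite /L (VT w Ww).2 /vtangent_map -/x.
  have -> : J w = frame c x *m tangent_map (F w.1) x *m invmx (frame d (F w.1 x)).
    have H := local_tangent_map (t := w.1) sF we ca da cx' wd.
    move: H; rewrite uE -surjective_pairing => H; apply: H.
    exact: (Wk 1%N).1 _ Ww.1.
  by rewrite !mulmxA mulmxKV ?frame_unit.
have H := pull_tensor_local g k (vtangent_map k pr (F w.1) x) ca da cx' wd.
rewrite /= -LE uE in H.
by apply: etrans (fconj _ _ (frame_unit ca cx')); congr f.
Qed.

End TensorFamilies.

(** * Integration *)

Section Integration.
Local Open Scope ereal_scope.
Context {R : realType}.

Lemma ge0_integral_le (d : measure_display) (T : measurableType d)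
    (mu : {measure set T -> \bar R}) (f g : T -> \bar R) :
  (forall x, 0 <= f x) -> (forall x, f x <= g x) ->
  \int[mu]_x f x <= \int[mu]_x g x.
Proof.
move=> f0 fg; have g0 x : 0 <= g x := le_trans (f0 x) (fg x).
rewrite !ge0_integralTE//; apply: ereal_sup_le => _ [h hf <-].
by exists h => // x; exact: le_trans (hf x) (fg x).
Qed.

(* No measurability is needed: the integral of a nonnegative function is a
   supremum over the simple functions below it. *)
Lemma integral_le (d : measure_display) (T : measurableType d)
    (mu : {measure set T -> \bar R}) (f g : T -> \bar R) :
  (forall x, f x <= g x) -> \int[mu]_x f x <= \int[mu]_x g x.
Proof.
move=> fg; rewrite (integralE _ _ f) (integralE _ _ g); apply: leeB.
  apply: ge0_integral_le => x; first exact: funepos_ge0.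
  by apply: (@funepos_le _ _ setT) => [y _|]; rewrite ?inE.
apply: ge0_integral_le => x; first exact: funeneg_ge0.
by apply: (@funeneg_le _ _ setT) => [y _|]; rewrite ?inE.
Qed.

(** * Bounded functions on a finite measure space *)

Section FiniteMeasure.
Context (d : measure_display) (T : measurableType d) (mu : {measure set T -> \bar R}).
Hypothesis mu_fin : mu setT < +oo.

Definition bounded_measurable (f : T -> R) : Prop :=
  measurable_fun setT f /\ exists B : R, forall x, (`|f x| <= B)%R.

Lemma bounded_measurable_integrable f :
  bounded_measurable f -> mu.-integrable setT (EFin \o f).
Proof.
move=> [mf [B fB]]; apply: measurable_bounded_integrable => //.
exists B; split; first exact: num_real.
by move=> x /ltW Bx y _; exact: le_trans (fB y) Bx.
Qed.

Lemma bounded_measurable_cst (a : R) : bounded_measurable (fun=> a).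
Proof. by split; [exact: measurable_cst|exists `|a|%R]. Qed.

Lemma bounded_measurableD f g : bounded_measurable f -> bounded_measurable g ->
  bounded_measurable (fun x => f x + g x)%R.
Proof.
move=> [mf [B fB]] [mg [C gC]]; split; first exact: measurable_funD.
by exists (B + C)%R => x; rewrite (le_trans (ler_normD _ _))// lerD.
Qed.

Lemma bounded_measurableZ (a : R) f : bounded_measurable f ->
  bounded_measurable (fun x => a * f x)%R.
Proof.
move=> [mf [B fB]]; split; first by apply: measurable_funM => //; exact: measurable_cst.
by exists (`|a| * B)%R => x; rewrite normrM ler_wpM2l.
Qed.

Lemma bounded_measurable_indic (A : set T) : measurable A ->
  bounded_measurable (\1_A : T -> R).
Proof.
move=> mA; split; first exact: measurable_indic.
by exists 1%R => x; rewrite indicE; case: (x \in A); rewrite ?normr1 ?normr0.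
Qed.

Lemma bounded_measurable_sum (I : Type) (s : seq I) (f : I -> T -> R) :
  (forall i, bounded_measurable (f i)) ->
  bounded_measurable (fun x => \sum_(i <- s) f i x)%R /\
  (\int[mu]_x (\sum_(i <- s) f i x) = \sum_(i <- s) \int[mu]_x f i x)%R.
Proof.
move=> bf; elim: s => [|i s [IHm IHi]].
  have -> : (fun x : T => \sum_(i <- [::]) f i x)%R = (fun=> 0%R).
    by apply/funext => x; rewrite big_nil.
  split; first exact: bounded_measurable_cst.
  by rewrite big_nil Rintegral_cst// mul0r.
have -> : (fun x : T => \sum_(j <- i :: s) f j x)%R =
    (fun x => f i x + \sum_(j <- s) f j x)%R.
  by apply/funext => x; rewrite big_cons.
split; first exact: bounded_measurableD.
rewrite big_cons -IHi RintegralD//; exact: bounded_measurable_integrable.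
Qed.

(** [f] is arbitrary: its integral lies between those of [g - eta] and [g + eta]. Both are finite,
    so passing to real values through [fine] loses nothing. *)
Lemma Rintegral_close (f g : T -> R) (eta : R) : bounded_measurable g ->
  (forall x, `|f x - g x| <= eta)%R ->
  (`| \int[mu]_x f x - \int[mu]_x g x | <= eta * fine (mu setT))%R.
Proof.
move=> bg fg.
have bge (a : R) := bounded_measurableD bg (bounded_measurable_cst a).
have shift (a : R) : \int[mu]_x (g x + a)%:E =
    (\int[mu]_x g x + a * fine (mu setT))%R%:E.
  have /integrable_fin_num h := bounded_measurable_integrable (bge a).
  rewrite -[LHS]fineK; last exact: h.
  congr EFin; rewrite -(Rintegral_cst _ measurableT).
  rewrite -RintegralD//; first exact: bounded_measurable_integrable.
  exact: (bounded_measurable_integrable (bounded_measurable_cst a)).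
have lo : (\int[mu]_x g x + - eta * fine (mu setT))%R%:E <= \int[mu]_x (f x)%:E.
  rewrite -shift; apply: integral_le => x; rewrite lee_fin.
  by have := fg x; rewrite ler_distl => /andP[].
have hi : \int[mu]_x (f x)%:E <= (\int[mu]_x g x + eta * fine (mu setT))%R%:E.
  rewrite -shift; apply: integral_le => x; rewrite lee_fin.
  by have := fg x; rewrite ler_distl => /andP[].
have ffin : \int[mu]_x (f x)%:E \is a fin_num.
  by rewrite fin_numElt (lt_le_trans _ lo) ?ltNyr// (le_lt_trans hi) ?ltry.
move: lo hi; rewrite -(fineK ffin) !lee_fin mulNr => lo hi.
by rewrite ler_distl lo hi.
Qed.

End FiniteMeasure.

Lemma lebesgue_int_ge0 (n : nat) (f : 'rV[R]_n -> \bar R) :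
  (forall u, 0 <= f u) -> 0 <= lebesgue_int f.
Proof.
elim: n f => [|n IH] f f0 /=; first exact: f0.
by apply: integral_ge0 => x _; exact: IH.
Qed.

Lemma lebesgue_int_le (n : nat) (f g : 'rV[R]_n -> \bar R) :
  (forall u, 0 <= f u) -> (forall u, f u <= g u) ->
  lebesgue_int f <= lebesgue_int g.
Proof.
elim: n f g => [|n IH] f g f0 fg /=; first exact: fg.
by apply: ge0_integral_le => x; [exact: lebesgue_int_ge0|exact: IH].
Qed.

(** Half-open, so that the cubes of a grid are pairwise disjoint and their indicators add up. *)
Definition cube (n : nat) (a : 'rV[R]_n) (s : R) : set 'rV[R]_n :=
  [set u | forall i, a 0 i <= u 0 i < a 0 i + s]%R.

Lemma lebesgue_int_cube (n : nat) (a : 'rV[R]_n) (s C : R) : (0 <= s)%R -> (0 <= C)%R ->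
  lebesgue_int (fun u => (C * \1_(cube a s) u)%:E) = (C * s ^+ n)%:E.
Proof.
move=> s0; elim: n a C => [|n IH] a C C0 /=.
  rewrite expr0 indicE mem_set//; by case.
pose a0 : R := (a 0 0)%R; pose a' : 'rV[R]_n := @rsubmx R 1 1 n a.
have E x : lebesgue_int (fun v : 'rV[R]_n =>
      (C * \1_(cube a s) (row_mx (\row_(_ < 1) x) v : 'rV[R]_(1 + n)))%:E) =
    (C * s ^+ n)%:E * (\1_(`[a0, (a0 + s)%R[%classic) x)%:E.
  have -> : (fun v : 'rV[R]_n =>
      (C * \1_(cube a s) (row_mx (\row_(_ < 1) x) v : 'rV[R]_(1 + n)))%:E) =
      (fun v => (C * \1_(`[a0, (a0 + s)%R[%classic) x * \1_(cube a' s) v)%:E).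
    apply/funext => v; congr EFin; rewrite -mulrA; congr (_ * _)%R.
    rewrite !indicE -natrM mulnb; congr (nat_of_bool _)%:R.
    apply/idP/andP; rewrite !inE /= in_itv /=.
      move=> h; split=> [|j].
        have := h (@lshift 1 n 0%R); rewrite (@row_mxEl _ _ 1 n) mxE.
        by rewrite /a0 (_ : @lshift 1 n 0%R = 0%R)//; exact/val_inj.
      by have := h (@rshift 1 n j); rewrite (@row_mxEr _ _ 1 n) /a' mxE.
    move=> [h0 h] i; case: (@split_ordP 1 n i) => j ->.
      rewrite (@row_mxEl _ _ 1 n) mxE ord1 (_ : @lshift 1 n 0%R = 0%R)//.
      exact/val_inj.
    by have := h j; rewrite (@row_mxEr _ _ 1 n) /a' mxE.
  rewrite IH ?mulr_ge0// -EFinM; congr EFin; by rewrite mulrAC.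
under eq_integral do rewrite E.
have ms : measurable (`[a0, (a0 + s)%R[%classic : set R) by exact: measurable_itv.
have -> : (\int[@lebesgue_measure R]_x ((C * s ^+ n)%:E * (\1_(`[a0, (a0 + s)%R[%classic) x)%:E) =
    (C * s ^+ n)%:E * (\int[@lebesgue_measure R]_x (\1_(`[a0, (a0 + s)%R[%classic) x)%:E)).
  rewrite ge0_integralZl_EFin//.
  - by apply/measurable_EFinP; exact: measurable_indic.
  - by rewrite mulr_ge0// exprn_ge0.
have L : lebesgue_measure (`[a0, (a0 + s)%R[%classic : set R) = s%:E.
  rewrite lebesgue_measure_itv /= lte_fin ltrDl; have [s1|s1] := ltP 0%R s.
    by rewrite -EFinB addrAC subrr add0r.
  by congr EFin; apply/le_anti; rewrite s1 s0.
rewrite integral_indic// setIT -[X in _ * X]/(lebesgue_measure _) L -EFinM.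
by rewrite exprSr mulrA.
Qed.

End Integration.

(** * Volume in a chart *)

Section ChartMeasure.
Context {R : realType}.

Lemma norm_rV_le (n : nat) (u : 'rV[R]_n) (r : R) : 0 <= r ->
  (forall j, `|u 0 j| <= r) -> `|u| <= r.
Proof.
move=> r0 H; rewrite /Num.Def.normr/= mx_normrE; apply: bigmax_le => // -[i j] _ /=.
by rewrite ord1 H.
Qed.

Lemma entry_le_norm (n : nat) (u : 'rV[R]_n) j : `|u 0 j| <= `|u|.
Proof.
by rewrite [leRHS]/Num.Def.normr/= mx_normrE (le_bigmax _ _ (0, j)).
Qed.

Lemma compact_cball (n : nat) (u : 'rV[R]_n) (r : R) :
  compact [set v | `|v - u| <= r].
Proof.
apply: bounded_closed_compact.
  exists (`|u| + r); split; first exact: num_real.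
  move=> B uB v /= vr; apply: le_trans (ltW uB).
  by rewrite -[v](subrK u) (le_trans (ler_normD _ _))// addrC lerD2l.
rewrite -[X in closed X]setCK; apply: open_closedC; apply: open_near => v /= /negP.
rewrite -ltNge => rv; apply/nbhs_normP; exists (`|v - u| - r) => /=.
  by rewrite subr_gt0.
by move=> w /= vw; apply/negP; rewrite -ltNge; have := ler_distD w v u; lra.
Qed.

Lemma uniform_continuity (n : nat) (K : set 'rV[R]_n) (F : 'rV[R]_n -> R^o) (eta : R) :
  compact K -> (forall x, K x -> {for x, continuous F}) -> 0 < eta ->
  exists2 d : R, 0 < d &
    forall x y, K x -> K y -> `|x - y| < d -> `|F x - F y| <= eta.
Proof.
move=> /compact_near_coveringP cK Fc eta0.
have := cK R (nbhs (0 : R))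
  (fun d x => forall y, K y -> `|x - y| < d -> `|F x - F y| <= eta) _.
have H x : K x -> \forall x' \near x & d \near (0 : R),
    forall y, K y -> `|x' - y| < d -> `|F x' - F y| <= eta.
  move=> Kx; have e2 : 0 < eta / 2 by rewrite divr_gt0.
  have /nbhs_normP[r /= r0 Br] := near_dist (Fc x Kx) e2.
  have r2 : 0 < r / 2 by rewrite divr_gt0.
  have H1 : \forall x' \near x, `|x - x'| < r / 2.
    by apply/nbhs_normP; exists (r / 2).
  have H2 : \forall d \near (0 : R), d < r / 2 by exact: lt_nbhsl.
  apply: filterS (near_pair H1 H2) => -[x' d] /= [xx' dr] y Ky x'y.
  apply: (ler_dist_half (b := F x)); rewrite distrC; apply: Br => /=; first by lra.
  by have := ler_distD x' x y; lra.
move=> /(_ _ H) /nbhs_normP[r /= r0 Br]; exists (r / 2); first by rewrite divr_gt0.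
move=> x y Kx Ky xy; apply: (Br (r / 2)) => //=.
by rewrite sub0r normrN gtr0_norm; lra.
Qed.

(** The determinant is $e_n$ of the eigenvalues of [G] relative to the identity, hence nonnegative;
    invertibility excludes 0. *)
Lemma det_posdef (n : nat) (G : 'M[R]_n) : posdef G -> 0 < \det G.
Proof.
move=> Gpd; rewrite lt_neqAle; apply/andP; split.
  by rewrite eq_sym -unitfE -unitmxE posdef_unit.
have one : posdef (1%:M : 'M[R]_n).
  split; first exact: trmx1.
  move=> v v0; rewrite /qform mulmx1 mxE lt_neqAle eq_sym; apply/andP; split.
    apply: contraNneq v0 => /psumr_eq0P H; apply/eqP/rowP => j; rewrite [RHS]mxE.
    have := H _ j isT; rewrite mxE => h; apply/eqP; rewrite -sqrf_eq0 expr2 h//.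
    by move=> i _; rewrite mxE -expr2 sqr_ge0.
  by apply: sumr_ge0 => i _; rewrite mxE -expr2 sqr_ge0.
have := eigsym_ge0 (leqnn n) (posdefW Gpd) one.
rewrite invmx1 mulmx1 /eigsym subnn char_poly_det mulrA -exprD addnn -mul2n exprM.
by rewrite sqrrN expr1n expr1n mul1r.
Qed.

Context {m : nat} {M : manifold R m} (g : metric M).

Definition density (c : chart R M m) (u : 'rV[R]_m) : R :=
  Num.sqrt (\det (local_form c g u)).

Lemma density_gt0 c u : atlas c -> img c u -> 0 < density c u.
Proof.
by move=> ca cu; rewrite sqrtr_gt0; apply: det_posdef; exact: local_form_posdef.
Qed.

Lemma density_C1 c : atlas c -> Ck 1 (img c) (density c : 'rV[R]_m -> R^o).
Proof.
move=> ca; have io : open (img c) := @Defs.open_img _ _ _ c.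
have dk := Ck_det io (Ckmx_local_form 1 g ca).
apply: (Ck_sqrt io _ dk).1 => u cu; apply: det_posdef; exact: local_form_posdef.
Qed.

Lemma open_borel (U : set M) : open U -> measurable (U : set (borel M)).
Proof. by move=> Uo; exact: sub_sigma_algebra. Qed.

Lemma open_chart_preimage (c : chart R M m) (U : set 'rV[R]_m) : open U ->
  open [set x | dom c x /\ U (c x)].
Proof.
move=> Uo; apply: open_near => x [cx Ux].
have H : \forall y \near x, U (c y) by apply: (coord_at cx); exact: open_nbhs_nbhs.
by apply: filterS2 (open_nbhs_nbhs (conj (open_dom c) cx)) H.
Qed.

Definition chart_cube (c : chart R M m) (a : 'rV[R]_m) (s : R) : set (borel M) :=
  [set x : M | dom c x /\ cube a s (c x)].

(** A half-open condition on one coordinate is a difference of two open ones; only open sets are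
    directly known to be Borel here. *)
Lemma measurable_chart_cube c a s : measurable (chart_cube c a s).
Proof.
have lto (j : 'I_m) (b : R) : open [set u : 'rV[R]_m | u 0 j < b].
  rewrite (_ : [set u | _] = (fun u : 'rV[R]_m => u 0 j) @^-1` [set x | x < b])//.
  apply: open_comp; last exact: open_lt.
  by move=> u _; exact: coord_continuous.
pose L j : set (borel M) := [set x : M | dom c x /\ c x 0 j < a 0 j + s].
pose N j : set (borel M) := [set x : M | dom c x /\ c x 0 j < a 0 j].
have mL j : measurable (L j) by apply: open_borel; exact: open_chart_preimage (lto j _).
have mN j : measurable (N j) by apply: open_borel; exact: open_chart_preimage (lto j _).
rewrite (_ : chart_cube c a s = (dom c : set (borel M)) `&`
    \bigcap_(j in [set: 'I_m]) (L j `\` N j)); last first.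
  apply/seteqP; split => x /=.
    move=> [cx xa]; split=> // j _; split; first by split=> //; case/andP: (xa j).
    by move=> [_]; case/andP: (xa j) => h _; rewrite ltNge h.
  move=> [cx H]; split=> // j; have [[_ h1] h2] := H j I.
  by rewrite h1 andbT leNgt; apply/negP => h3; apply: h2.
apply: measurableI; first exact: open_borel (open_dom c).
apply: fin_bigcap_measurable => // j _; exact: measurableD.
Qed.

Variable vol : {measure set (borel M) -> \bar R}.
Hypothesis hvol : is_volume g vol.

(** The iterated integral defining the volume is compared with those of [lo] and [hi] times the
    indicator of the cube, which are explicit. *)
Lemma volume_chart_cube c a s (lo hi : R) : atlas c -> 0 <= s -> 0 <= lo -> 0 <= hi ->
  (forall u, cube a s u -> img c u) ->
  (forall u, cube a s u -> lo <= density c u <= hi) ->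
  ((lo * s ^+ m)%:E <= vol (chart_cube c a s) <= (hi * s ^+ m)%:E)%E.
Proof.
move=> ca s0 lo0 hi0 ci H.
have -> := hvol ca (measurable_chart_cube c a s) (fun x => @proj1 _ _).
have cE : c @` chart_cube c a s = cube a s.
  have := chart_image c (fun x => cube a s (c x)).
  rewrite -[dom c `&` _]/(chart_cube c a s) => ->.
  apply/seteqP; split => u /=; first by move=> [cu]; rewrite paramK.
  by move=> ua; have cu := ci _ ua; rewrite paramK.
rewrite cE -!(lebesgue_int_cube a)//; apply/andP; split; apply: lebesgue_int_le => u.
- by rewrite lee_fin mulr_ge0// indicE.
- rewrite lee_fin indicE; case: (boolP (u \in _)) => [|_]; rewrite ?mulr0 ?mul0r//.
  by rewrite inE mulr1 mul1r => /H /andP[].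
- by rewrite lee_fin mulr_ge0 ?sqrtr_ge0// indicE.
- rewrite lee_fin indicE; case: (boolP (u \in _)) => [|_]; rewrite ?mulr0 ?mul0r//.
  by rewrite inE mulr1 mul1r => /H /andP[].
Qed.

Lemma chart_radius (x : M) : exists2 r : R, 0 < r &
  forall v, `|v - chart_at x x| <= r -> img (chart_at x) v.
Proof.
have cx := coord_img (chart_at_dom x).
have /nbhs_normP[r /= r0 Br] := open_nbhs_nbhs (conj (@Defs.open_img _ _ _ (chart_at x)) cx).
exists (r / 2); first by rewrite divr_gt0.
by move=> v vr; apply: Br => /=; rewrite distrC; lra.
Qed.

Lemma closed_chart_ball (c : chart R M m) u0 (r : R) :
  (forall v, `|v - u0| <= r -> img c v) ->
  closed (param c @` [set v | `|v - u0| <= r]).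
Proof.
move=> ball_img; apply: compact_closed; first exact: space_hausdorff.
apply: continuous_compact; last exact: compact_cball.
apply: continuous_in_subspaceT => v; rewrite inE /= => vr.
by apply: param_at; apply: ball_img.
Qed.

(** Each point has an open neighbourhood contained in a coordinate cube on which the density is
    bounded; finitely many of them cover [M]. *)
Lemma volume_finite : compact [set: M] -> (vol [set: borel M] < +oo)%E.
Proof.
move=> cM.
have loc (x : M) : exists U : set M, [/\ open U, U x & (vol (U : set (borel M)) < +oo)%E].
  have [r r0 Hr] := chart_radius x; set c := chart_at x in Hr *.
  have ca : atlas c by exact: chart_at_atlas.
  have cx : dom c x by exact: chart_at_dom.
  have cu : img c (c x) by exact: coord_img.
  have dc := Ck_continuous (density_C1 ca) cu.
  have /nbhs_normP[r' /= r'0 Br'] := near_dist dc ltr01.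
  (* The cube of side 2q centred at [c x] lies in the closed ball of radius q for the maximum norm.
     Since q < r and q < r', it is inside the chart and the density varies by less than 1 on it. *)
  pose q := Num.min r r' / 2.
  have q0 : 0 < q by rewrite divr_gt0// lt_min r0.
  pose a : 'rV[R]_m := \row_j (c x 0 j - q).
  have aq v : cube a (q *+ 2) v -> `|v - c x| <= q.
    move=> av; apply: norm_rV_le => [|j]; first exact: ltW.
    have := av j; rewrite !mxE ler_norml mulr2n; lra.
  have qr : q < r /\ q < r'.
    have : Num.min r r' <= r /\ Num.min r r' <= r' by rewrite !ge_min !lexx orbT.
    by rewrite /q; lra.
  have := @volume_chart_cube c a (q *+ 2) 0 (density c (c x) + 1) ca.
  have di v : cube a (q *+ 2) v -> 0 <= density c v <= density c (c x) + 1.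
    move=> /aq vq; rewrite sqrtr_ge0 /=.
    have : `|density c (c x) - density c v| < 1.
      by apply: Br' => /=; rewrite distrC; lra.
    move: (density c v) (density c (c x)) => a1 a2.
    by rewrite ltr_distl => /andP[]; lra.
  case/(_ _ _ _ _ di)/andP => //.
  - by rewrite mulrn_wge0// ltW.
  - by rewrite addr_ge0// sqrtr_ge0.
  - by move=> v /aq vq; apply: Hr; lra.
  move=> _ volq.
  exists [set y | dom c y /\ `|c y - c x| < q]; split.
  - apply: (@open_chart_preimage c [set v | `|v - c x| < q]).
    rewrite (_ : [set v | _] = ball (c x) q); first exact: ball_open.
    by apply/seteqP; split => v; rewrite -ball_normE /= distrC.
  - by rewrite /= subrr normr0.
  apply: le_lt_trans (ltry _); apply: le_trans volq; apply: le_measure; rewrite ?inE.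
  - apply: open_borel; apply: (@open_chart_preimage c [set v | `|v - c x| < q]).
    rewrite (_ : [set v | _] = ball (c x) q); first exact: ball_open.
    by apply/seteqP; split => v; rewrite -ball_normE /= distrC.
  - exact: measurable_chart_cube.
  move=> y /= [cy yq]; split=> // j; rewrite !mxE mulr2n.
  have := entry_le_norm (c y - c x) j; rewrite !mxE ler_norml; lra.
have [U HU] := choice loc.
move: (cM); rewrite compact_cover => /(_ M setT U).
case=> [x _|x _|D _ DM]; [by case: (HU x)|by exists x => //; case: (HU x)|].
have mU x : measurable (U x : set (borel M)) by apply: open_borel; case: (HU x).
have fin (s : seq M) : measurable (\big[setU/set0]_(x <- s) (U x : set (borel M))) /\
    (vol (\big[setU/set0]_(x <- s) (U x : set (borel M))) < +oo)%E.
  elim: s => [|x s [IHm IHf]]; first by rewrite big_nil measure0.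
  rewrite big_cons; split; first exact: measurableU.
  apply: le_lt_trans (measureU2 _ (mU x) IHm) _.
  by apply: lte_add_pinfty => //; case: (HU x).
have [mD fD] := fin (finmap.enum_fset D); apply: le_lt_trans fD; apply: le_measure; rewrite ?inE//.
move=> x _; have [y /= yD Uy] := DM x I.
by rewrite -bigcup_seq; exists y.
Qed.

Lemma continuous_borel (f : M -> R^o) : continuous f ->
  measurable_fun setT (f : borel M -> R).
Proof.
move=> /continuousP cf _; apply: (measurability _ (RGenOpens.measurableE R)).
move=> _ [_ [a [b ->] <-]]; rewrite setTI; apply: open_borel.
  exact/cf/interval_open.
exact: measurableT.
Qed.

Lemma continuous_bounded_measurable (f : M -> R^o) : compact [set: M] ->
  continuous f -> bounded_measurable (f : borel M -> R).
Proof.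
move=> cM cf; split; first exact: continuous_borel.
have /compact_bounded[B [_ HB]] : compact (f @` [set: M]).
  by apply: continuous_compact => //; exact: continuous_subspaceT.
by exists (B + 1) => x; apply: (HB (B + 1)); [rewrite ltrDl|exists x].
Qed.

End ChartMeasure.

(** * Riemann sums *)

Section RiemannSum.
Context {R : realType} {m : nat} {M : manifold R m} (g : metric M).
Variable vol : {measure set (borel M) -> \bar R}.
Hypothesis hvol : is_volume g vol.
Hypothesis cM : compact [set: M].

Variables (c : chart R M m) (u0 : 'rV[R]_m) (r r' : R) (phi : 'rV[R]_m -> R^o) (i : 'I_m).
Hypothesis ca : atlas c.
Hypothesis r0 : 0 < r.
Hypothesis rr' : r < r'.
Hypothesis ball_img : forall v, `|v - u0| <= r' -> img c v.
Hypothesis phik : Ck 1 (img c) phi.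
Hypothesis phi0 : forall v, img c v -> r <= `|v - u0| -> phi v = 0.

Let D (v : 'rV[R]_m) : R^o := 'D_(delta_mx 0 i) phi v.
Let fp (v : 'rV[R]_m) : R^o := D v * (density g c v)^-1.

(** The divergence of the field (phi / w) d/dc_i, with w the density, extended by 0 off the chart;
    against the volume, w cancels and the partial derivative of phi remains. *)
Definition chart_divergence (x : M) : R :=
  if `[< dom c x >] then 'D_(delta_mx 0 i) phi (c x) / density g c (c x) else 0.

Let imgo : open (img c) := @Defs.open_img _ _ _ c.

Let D0 (v : 'rV[R]_m) : img c v -> r < `|v - u0| -> D v = 0.
Proof.
move=> cv rv; rewrite -(derive_cst (0 : R^o) v (delta_mx 0 i)).
apply: near_eq_derive.
have e0 : 0 < `|v - u0| - r by rewrite subr_gt0.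
have H : \forall w \near v, `|v - w| < `|v - u0| - r.
  by apply/nbhs_normP; exists (`|v - u0| - r).
apply: filterS2 (open_nbhs_nbhs (conj imgo cv)) H => w cw vw.
by rewrite /cst phi0//; have := ler_distD w v u0; lra.
Qed.

Let fpk : Ck 0 (img c) fp.
Proof.
apply: Ck_mul => //; first exact: (phik.2 _).
apply: Ck_inv => //; first by move=> v cv; rewrite gt_eqF// density_gt0.
exact: (CkW (density_C1 g ca)).
Qed.

Let fE x : dom c x -> chart_divergence x = fp (c x).
Proof. by move=> cx; rewrite /chart_divergence asboolT. Qed.

Let f0 x : ~ (dom c x /\ `|c x - u0| <= r) -> chart_divergence x = 0.
Proof.
rewrite /chart_divergence; case: asboolP => // cx H.
have rx : r < `|c x - u0| by rewrite ltNge; apply/negP => h; exact: H.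
by rewrite -/(D (c x)) D0 ?mul0r//; exact: coord_img.
Qed.

(** The support lies in the image of a closed ball, which is compact and therefore closed in the
    Hausdorff space [M]; so the function vanishes near every point outside the chart. *)
Lemma chart_divergence_continuous : continuous (chart_divergence : M -> R^o).
Proof.
move=> x; have [cx|cx] := pselect (dom c x).
  have H : \forall y \near x, fp (c y) = chart_divergence y.
    by apply: filterS (open_nbhs_nbhs (conj (open_dom c) cx)) => y cy; rewrite fE.
  rewrite /continuous_at fE//; apply: cvg_trans (near_eq_cvg H) _.
  apply: (@continuous_comp _ _ _ c fp); first exact: coord_at.
  exact/fpk/coord_img.
have ball_img' v : `|v - u0| <= r -> img c v.
  by move=> vr; apply: ball_img; exact: le_trans vr (ltW rr').
have Kc := closed_chart_ball ball_img'; set K := (X in closed X) in Kc.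
have Kx : ~ K x by move=> [v /= vr vx]; apply: cx; rewrite -vx; apply: param_dom; exact: ball_img'.
have H : \forall y \near x, 0 = chart_divergence y.
  apply: filterS (open_nbhs_nbhs (conj (closed_openC Kc) Kx)) => y Ky.
  rewrite f0// => -[cy yr]; apply: Ky; exists (c y) => //; exact: coordK.
rewrite /continuous_at -(nbhs_singleton H); apply: cvg_trans (near_eq_cvg H) _.
exact: cvg_cst.
Qed.

(** * The grid of $N^m$ cubes of side [h] filling the box of radius r' around u0 *)

Section Grid.
Variable N' : nat.
Let N := N'.+1.
Let h : R := (r' *+ 2) / N%:R.

Let N0 : 0 < N%:R :> R. Proof. by rewrite ltr0n. Qed.
Let r'0 : 0 < r'. Proof. exact: lt_trans rr'. Qed.
Let h0 : 0 < h. Proof. by rewrite divr_gt0// pmulrn_lgt0. Qed.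
Let hN : h * N%:R = r' *+ 2. Proof. by rewrite divfK// gt_eqF. Qed.

Definition grid_node (k : {ffun 'I_m -> 'I_N}) : 'rV[R]_m :=
  \row_j (u0 0 j - r' + h * (k j)%:R).

Let node_bound (k : {ffun 'I_m -> 'I_N}) j :
  0 <= h * (k j)%:R /\ h * (k j)%:R + h <= r' *+ 2.
Proof.
split; first by rewrite mulr_ge0// ltW.
rewrite -hN -[X in _ + X]mulr1 -mulrDr ler_wpM2l ?(ltW h0)// natr1 ler_nat.
exact: ltn_ord.
Qed.

Let box_ball (v : 'rV[R]_m) : (forall j, u0 0 j - r' <= v 0 j <= u0 0 j + r') -> `|v - u0| <= r'.
Proof.
move=> H; apply: norm_rV_le => [|j]; first exact: ltW.
by have := H j; rewrite !mxE ler_norml; lra.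
Qed.

Let cube_ball k (v : 'rV[R]_m) : cube (grid_node k) h v -> `|v - u0| <= r'.
Proof.
move=> kv; apply: box_ball => j; have := kv j; have := node_bound k j.
rewrite mxE mulr2n; move: (h * _) h0 => a; move: (v 0 j) (u0 0 j) => b d; lra.
Qed.

Let cube_uniq k k' (v : 'rV[R]_m) : cube (grid_node k) h v -> cube (grid_node k') h v -> k = k'.
Proof.
have E (l : {ffun 'I_m -> 'I_N}) j : cube (grid_node l) h v ->
    Num.truncn ((v 0 j - (u0 0 j - r')) / h) = l j.
  move=> lv; apply: truncn_def; have := lv j; rewrite mxE => /andP[h1 h2].
  rewrite ler_pdivlMr// ltr_pdivrMr// -natr1 mulrDl mul1r ![_%:R * h]mulrC.
  by move: h1 h2; move: (h * _) => a; move: (v 0 j) (u0 0 j) => b d; lra.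
move=> kv k'v; apply/ffunP => j; apply: val_inj => /=.
by rewrite -(E k j)// -(E k' j).
Qed.

Let cube_exists (v : 'rV[R]_m) : (forall j, u0 0 j - r' <= v 0 j < u0 0 j + r') ->
  exists k, cube (grid_node k) h v.
Proof.
move=> H; pose q (j : 'I_m) := (v 0 j - (u0 0 j - r')) / h.
have q0 j : 0 <= q j.
  by rewrite divr_ge0 ?(ltW h0)//; have := H j; lra.
have qN j : (Num.truncn (q j) < N)%N.
  rewrite truncn_lt_nat// ltr_pdivrMr// mulrC hN mulr2n.
  by have := H j; lra.
exists [ffun j => Ordinal (qN j)] => j; rewrite mxE ffunE /=.
have := truncn_itv (q0 j); rewrite ler_pdivlMr// ltr_pdivrMr// -natr1 mulrDl mul1r.
rewrite ![_%:R * h]mulrC; move: (h * _) => a; move: (v 0 j) (u0 0 j) => b d; lra.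
Qed.

Let far (v : 'rV[R]_m) j : v 0 j = u0 0 j + r' \/ v 0 j = u0 0 j - r' -> img c v -> phi v = 0.
Proof.
move=> vj cv; apply: phi0 => //; have := entry_le_norm (v - u0) j; rewrite !mxE.
apply: le_trans; case: vj => ->; first by rewrite addrAC subrr add0r gtr0_norm// ltW.
by rewrite addrAC subrr add0r normrN gtr0_norm// ltW.
Qed.

(* phi vanishes on the two opposite faces of the grid that this identifies. *)
Definition cycle_shift (k : {ffun 'I_m -> 'I_N}) : {ffun 'I_m -> 'I_N} :=
  [ffun j => if j == i then ordS (k j) else k j].

Let cycle_shift_inj : injective cycle_shift.
Proof.
move=> k k' /ffunP kk'; apply/ffunP => j; have := kk' j; rewrite !ffunE.
by case: eqP => // _ /ordS_inj.
Qed.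

Let node_img k : img c (grid_node k).
Proof.
apply: ball_img; apply: (cube_ball (k := k)) => j; rewrite lexx /=.
by rewrite ltrDl.
Qed.

Let phi_shift k : phi (grid_node k + h *: delta_mx 0 i) = phi (grid_node (cycle_shift k)).
Proof.
have nE j : (grid_node k + h *: delta_mx 0 i) 0 j =
    u0 0 j - r' + h * (k j)%:R + h * (j == i)%:R.
  by rewrite !mxE eqxx.
have kimg : img c (grid_node k + h *: delta_mx 0 i).
  apply: ball_img; apply: box_ball => j; rewrite nE; have := node_bound k j.
  rewrite mulr2n; case: (j == i); rewrite ?mulr1 ?mulr0;
  move: (h * _) h0 r'0 => a; move: (u0 0 j) => d; lra.
have [kN|kN] := ltnP (k i).+1 N.
  congr phi; apply/rowP => j; rewrite nE [RHS]mxE ffunE.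
  have [->|ji] := eqVneq j i; last by rewrite mulr0 addr0.
  by rewrite /= modn_small// -[(k i).+1%:R]natr1 mulrDr mulr1 addrA.
have kE : (k i).+1 = N by apply/eqP; rewrite eqn_leq kN ltn_ord.
have top : (grid_node k + h *: delta_mx 0 i) 0 i = u0 0 i + r'.
  rewrite nE eqxx -addrA -mulrDr natr1 kE hN mulr2n.
  by move: (u0 0 i) => d; rewrite addrA subrK.
rewrite (far (or_introl top) kimg).
apply/esym; apply: (@far _ i); last exact: node_img.
right.
by rewrite mxE ffunE eqxx /= kE modnn mulr0 addr0.
Qed.

(* The mean value theorem on an edge of the cube. *)
Let sample k : exists xi : 'rV[R]_m, [/\ `|xi - u0| <= r',
  forall v : 'rV[R]_m, cube (grid_node k) h v -> `|v - xi| <= h &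
  h * D xi = phi (grid_node k + h *: delta_mx 0 i) - phi (grid_node k)].
Proof.
pose pt s := s *: (h *: delta_mx 0 i) + grid_node k.
have ptE s j : pt s 0 j = u0 0 j - r' + h * (k j)%:R + s * h * (j == i)%:R.
  by rewrite !mxE eqxx addrC mulrA.
have ptB s : 0 <= s <= 1 -> `|pt s - u0| <= r'.
  move=> /andP[s0 s1]; apply: box_ball => j; rewrite ptE; have := node_bound k j.
  have : 0 <= s * h <= h by rewrite mulr_ge0 ?(ltW h0)//= ler_piMl// ltW.
  rewrite mulr2n; case: (j == i); rewrite ?mulr1 ?mulr0;
  move: (s * h) (h * _) h0 r'0 => b a; move: (u0 0 j) => d; lra.
have [s s01 E] : exists2 s : R, 0 <= s <= 1 &
    phi (h *: delta_mx 0 i + grid_node k) - phi (grid_node k) = 'D_(h *: delta_mx 0 i) phi (pt s).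
  by apply: MVT_line => s s01; apply: phik.1; apply: ball_img; exact: ptB.
exists (pt s); split; first exact: ptB.
  move=> v kv; apply: norm_rV_le => [|j]; first exact: ltW.
  have -> : (v - pt s) 0 j = v 0 j - pt s 0 j by rewrite !mxE.
  rewrite ptE; have := kv j; rewrite mxE.
  have : 0 <= s * h <= h.
    by case/andP: s01 => s0 s1; rewrite mulr_ge0 ?(ltW h0)//= ler_piMl// ltW.
  rewrite ler_norml; case: (j == i); rewrite ?mulr1 ?mulr0;
  move: (s * h) (h * _) h0 => b a; move: (v 0 j) (u0 0 j) => d d'; lra.
rewrite [grid_node k + _]addrC E deriveZv//; apply: phik.1; apply: ball_img; exact: ptB.
Qed.

(** There are two errors. Replacing the function by its value at a sample point of each cube costs
    at most eta times the total volume. Replacing the volume of a cube by its density at the sample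
    point times $h^m$ costs at most $B \eta h^m$ per cube, and $N^m$ cubes with $N h = 2 r'$ give
    the second term. What is left is $h^m$ times the sum of the derivatives at the sample points,
    which is zero. *)
Lemma riemann_sum_bound (eta B : R) : 0 < eta ->
  (forall x, `|chart_divergence x| <= B) ->
  (forall v w : 'rV[R]_m, `|v - u0| <= r' -> `|w - u0| <= r' -> `|v - w| <= h ->
    `|fp v - fp w| <= eta /\ `|density g c v - density g c w| <= eta) ->
  `| \int[vol]_x chart_divergence x |
    <= eta * fine (vol setT) + B * eta * (r' *+ 2) ^+ m.
Proof.
move=> eta0 fB fpu; have [xi Hxi] := choice sample.
have vfin := volume_finite hvol cM.
pose S k := chart_cube c (grid_node k) h.
have mS k : measurable (S k) by exact: measurable_chart_cube.
pose step x := \sum_k fp (xi k) * \1_(S k) x.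
have bS k : bounded_measurable (\1_(S k) : borel M -> R).
  exact: bounded_measurable_indic.
have [bstep istep] := bounded_measurable_sum vfin (index_enum _)
  (fun k => bounded_measurableZ (fp (xi k)) (bS k)).
have close x : `|chart_divergence x - step x| <= eta.
  have [[cx H]|H] := pselect (dom c x /\ forall j, u0 0 j - r' <= c x 0 j < u0 0 j + r').
    have [k kx] := cube_exists H; have [h1 h2 _] := Hxi k.
    have -> : step x = fp (xi k).
      rewrite /step (bigD1 k)//= big1 ?addr0 => [|k' k'k].
        by rewrite indicE mem_set ?mulr1.
      rewrite indicE memNset ?mulr0// => -[_ k'x]; case/eqP: k'k.
      exact: cube_uniq k'x kx.
    by rewrite fE//; apply: (fpu _ _ (cube_ball kx) h1 (h2 _ kx)).1.
  have -> : step x = 0.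
    rewrite /step big1// => k _; rewrite indicE memNset ?mulr0// => -[cx kx]; apply: H.
    split=> // j; have := kx j; have := node_bound k j.
    rewrite mxE mulr2n; move: (h * _) => a; move: (c x 0 j) (u0 0 j) => b d; lra.
  rewrite f0; first by rewrite subrr normr0 ltW.
  move=> [cx xr]; apply: H; split=> // j.
  have := le_trans (entry_le_norm (c x - u0) j) xr; rewrite !mxE ler_norml.
  by move: (c x 0 j) (u0 0 j) rr' => b d; lra.
have := Rintegral_close vfin bstep close; rewrite istep => H1.
rewrite -[X in `|X|](subrK (\sum_k \int[vol]_x (fp (xi k) * \1_(S k) x))).
apply: le_trans (ler_normD _ _) _; apply: lerD H1 _.
(* After multiplication by [h] the terms are increments of [phi] from a node to its cyclic
   successor, and [cycle_shift] permutes the nodes. *)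
have Sx : \sum_k D (xi k) = 0.
  apply/eqP; rewrite -(mulrI_eq0 _ (mulfI (lt0r_neq0 h0))) mulr_sumr.
  under eq_bigr => k _ do rewrite (let: And3 _ _ e := Hxi k in e) phi_shift.
  by rewrite sumrB [X in _ - X](reindex_inj cycle_shift_inj) subrr.
pose W k := fine (vol (S k)).
have WE k : \int[vol]_x (fp (xi k) * \1_(S k) x) = fp (xi k) * W k.
  rewrite RintegralZl//; last exact: bounded_measurable_integrable.
  by rewrite /Rintegral integral_indic// setIT.
have err k : `|fp (xi k) * W k - D (xi k) * h ^+ m| <= B * eta * h ^+ m.
  have [h1 h2 _] := Hxi k; have ik := ball_img h1.
  (* The maximum with 0 supplies the nonnegative lower bound that [volume_chart_cube] asks for. *)
  have dk v : cube (grid_node k) h v ->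
      Num.max 0 (density g c (xi k) - eta) <= density g c v <= density g c (xi k) + eta.
    move=> kv; have [_] := fpu _ _ (cube_ball kv) h1 (h2 _ kv).
    have := sqrtr_ge0 (\det (local_form c g v)); rewrite -/(density g c v).
    rewrite ge_max; move: (density _ _ _) (density _ _ _) => a b; rewrite ler_distl; lra.
  have lo0 : 0 <= Num.max 0 (density g c (xi k) - eta) by rewrite le_max lexx.
  have /andP[lo hi] := volume_chart_cube hvol ca (ltW h0)
    lo0 (addr_ge0 (sqrtr_ge0 _) (ltW eta0))
    (fun v kv => ball_img (cube_ball kv)) dk.
  have Wfin : vol (S k) \is a fin_num.
    rewrite ge0_fin_numE//; exact: le_lt_trans hi (ltry _).
  have hm : 0 <= h ^+ m by rewrite exprn_ge0// ltW.
  have DE : D (xi k) = fp (xi k) * density g c (xi k).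
    by rewrite /fp mulfVK// gt_eqF// density_gt0.
  have fk : `|fp (xi k)| <= B.
    by rewrite -[xi k](paramK ik) -fE ?fB//; exact: param_dom.
  rewrite DE -mulrA -mulrBr normrM -mulrA ler_pM//.
  move: lo hi; rewrite -(fineK Wfin) !lee_fin -/(W k) => lo hi.
  rewrite ler_distl -mulrBl -mulrDl hi andbT; apply: le_trans lo.
  by rewrite ler_wpM2r// le_max lexx orbT.
under eq_bigr => k _ do rewrite WE.
have -> : \sum_k fp (xi k) * W k = \sum_k (fp (xi k) * W k - D (xi k) * h ^+ m).
  by rewrite sumrB -mulr_suml Sx mul0r subr0.
apply: le_trans (ler_norm_sum _ _ _) _.
apply: le_trans (ler_sum _ (fun k _ => err k)) _.
rewrite sumr_const card_ffun !card_ord -mulr_natr natrX -[leLHS]mulrA -exprMn hN.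
exact: lexx.
Qed.

End Grid.

Lemma integral_chart_divergence : \int[vol]_x chart_divergence x = 0.
Proof.
have r'0 : 0 < r' by exact: lt_trans rr'.
have [_ [B fB]] := continuous_bounded_measurable cM chart_divergence_continuous.
have B0 : 0 <= B := le_trans (normr_ge0 _) (fB point).
have vol0 : 0 <= fine (vol setT) by rewrite fine_ge0.
pose C := fine (vol setT) + B * (r' *+ 2) ^+ m.
have C0 : 0 <= C by rewrite addr_ge0// mulr_ge0// exprn_ge0// mulrn_wge0// ltW.
apply/eqP; rewrite -normr_eq0 eq_le normr_ge0 andbT; apply/ler_addgt0Pr => e e0; rewrite add0r.
pose eta := e / (C + 1).
have C1 : 0 < C + 1 by rewrite ltr_wpDl.
have eta0 : 0 < eta by rewrite divr_gt0.
have cK := @compact_cball _ _ u0 r'.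
have [d1 d10 H1] := uniform_continuity cK (fun v vr => fpk (ball_img vr)) eta0.
have [d2 d20 H2] := uniform_continuity cK
  (fun v vr => Ck_continuous (density_C1 g ca) (ball_img vr)) eta0.
pose d := Num.min d1 d2; have d0 : 0 < d by rewrite lt_min d10.
(* This number of subdivisions makes the mesh finer than both moduli of uniform continuity. *)
have hd : (r' *+ 2) / (Num.truncn ((r' *+ 2) / d)).+1%:R < d.
  by rewrite ltr_pdivrMr ?ltr0n// mulrC -ltr_pdivrMr// truncnS_gt.
have := @riemann_sum_bound _ eta B eta0 fB _.
move=> /(_ (Num.truncn ((r' *+ 2) / d))) H.
apply: (le_trans (H _)).
  move=> v w vr wr vw; have := le_lt_trans vw hd; rewrite lt_min => /andP[vw1 vw2].
  by split; [exact: H1|exact: H2].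
have -> : eta * fine (vol setT) + B * eta * (r' *+ 2) ^+ m = eta * C.
  by rewrite /C; move: (fine _) (_ ^+ m) (eta) => a b s; ring.
rewrite /eta mulrAC ler_pdivrMr// ler_wpM2l ?(ltW e0)//.
by rewrite lerDl.
Qed.

End RiemannSum.

(** * The velocity of a variation of the identity *)

Section MatrixDerivatives.
Context {R : realType} {V : normedModType R}.

Lemma is_derive_mul (f f' : V -> R^o) (df df' : R) (x v : V) :
  is_derive x v f (df : R^o) -> is_derive x v f' (df' : R^o) ->
  is_derive x v (fun y => f y * f' y : R^o) (df * f' x + f x * df' : R^o).
Proof.
move=> Hf Hf'; have := is_deriveM Hf Hf'; congr (is_derive _ _ _ _).
by rewrite -[LHS]/(f x * df' + f' x * df : R) addrC [f' x * _]mulrC.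
Qed.

Lemma is_derive_mulmx (p q r : nat) (A : V -> 'M[R]_(p, q)) (B : V -> 'M[R]_(q, r))
    (dA : 'M[R]_(p, q)) (dB : 'M[R]_(q, r)) (x v : V) :
  (forall i j, is_derive x v (fun y => A y i j : R^o) (dA i j : R^o)) ->
  (forall i j, is_derive x v (fun y => B y i j : R^o) (dB i j : R^o)) ->
  forall i j, is_derive x v (fun y => (A y *m B y) i j : R^o)
    ((dA *m B x + A x *m dB) i j : R^o).
Proof.
move=> HA HB i j.
have H l := is_derive_mul (HA i l) (HB l j).
have := is_derive_bigsum (index_enum 'I_q) H.
have -> : (fun y => \sum_(l <- index_enum 'I_q) A y i l * B y l j : R^o) =
    (fun y => (A y *m B y) i j : R^o) by apply/funext => y; rewrite mxE.
by rewrite big_split /= !mxE.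
Qed.

Lemma is_derive_trace (n : nat) (A : V -> 'M[R]_n) (dA : 'M[R]_n) (x v : V) :
  (forall i j, is_derive x v (fun y => A y i j : R^o) (dA i j : R^o)) ->
  is_derive x v (fun y => \tr (A y) : R^o) (\tr dA : R^o).
Proof. by move=> HA; exact: is_derive_bigsum. Qed.

Lemma derive_sqrt_det (n : nat) (U : set V) (G : V -> 'M[R]_n) (x v : V) :
  open U -> U x -> (forall y, U y -> 0 < \det (G y)) -> Ckmx 1 U G ->
  'D_v (fun y => Num.sqrt (\det (G y)) : R^o) x =
  Num.sqrt (\det (G x)) / 2 *
    \tr (invmx (G x) *m (\matrix_(i, j) 'D_v (fun y => G y i j : R^o) x)).
Proof.
move=> Uo Ux Gp Gk; rewrite (Ck_sqrt Uo Gp (Ck_det Uo Gk)).2//.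
set dG := (\matrix_(i, j) _).
have HG i j : is_derive x v (fun y => G y i j : R^o) (dG i j : R^o).
  by rewrite mxE; apply: DeriveDef => //; apply: diff_derivable; exact: (Gk i j).1.
rewrite (derive_val (is_derive := jacobi_formula HG)).
have d0 : 0 < \det (G x) by exact: Gp.
have Gu : G x \in unitmx by rewrite unitmxE unitfE gt_eqF.
have -> : \adj (G x) = \det (G x) *: invmx (G x).
  by rewrite /invmx Gu scalerA divff ?scale1r// gt_eqF.
rewrite -scalemxAl mxtraceZ -{2}(sqr_sqrtr (ltW d0)).
have : Num.sqrt (\det (G x)) != 0 by rewrite gt_eqF// sqrtr_gt0.
by move: (Num.sqrt _) (\tr _) => s t s0; field.
Qed.

End MatrixDerivatives.

(** * The velocity field in a chart and the first variation of the trace *)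

Section Velocity.
Context {R : realType}.

Lemma Ck_slice (m : nat) (Z : normedModType R) k (W : set (R^o * 'rV[R]_m))
    (f : R^o * 'rV[R]_m -> Z) : open W ->
  Ck k W f -> Ck k [set v | W (0, v)] (fun v => f ((0 : R^o), v)).
Proof.
move=> Wo; have So : open [set v : 'rV[R]_m | W (0, v)].
  apply: open_near => v /= Wv; exact: (near_slice (x := (0 : R^o)) (open_nbhs_nbhs (conj Wo Wv))).
elim: k f => [|k IH] f fk.
  move=> v /= Wv Q HQ; exact: (near_slice (x := (0 : R^o)) (fk _ Wv Q HQ)).
split=> [v Wv|w]; first exact: (space_slice (fk.1 _ Wv)).1.
apply: Ck_ext (IH _ (fk.2 (0, w))) => // v Wv.
by rewrite (space_slice (fk.1 _ Wv)).2.
Qed.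

Context {m : nat} {M : manifold R m} (g : metric M) (e : R) (h : R -> M -> M).
Hypothesis sh : smooth_family e h.
Hypothesis h0 : forall x, h 0 x = x.
Implicit Types (c : chart R M m).

Let hc c (w : R^o * 'rV[R]_m) : 'rV[R]_m := c (h w.1 (param c w.2)).

Definition velocity c (i : 'I_m) (v : 'rV[R]_m) : R^o :=
  'D_1 (fun t : R^o => c (h t (param c v)) 0 i : R^o) 0.

Let local c v : atlas c -> img c v -> exists W : set (R^o * 'rV[R]_m),
  [/\ open W, W (0, v),
   forall w, W w -> [/\ `|w.1| < e, img c w.2 & dom c (h w.1 (param c w.2))] &
   (forall k, Ck k W (hc c)) /\
   forall v' i, W (0, v') ->
     is_derive (0 : R^o) 1 (fun t : R^o => hc c (t, v') 0 i : R^o) (velocity c i v') /\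
     velocity c i v' = 'D_((1 : R^o, 0)) (fun w => hc c w 0 i : R^o) (0, v')].
Proof.
move=> ca cv; have [_ _ hk] := sh; have cx := param_dom cv.
have hx : dom c (h 0 (param c v)) by rewrite h0.
have [W [Wo W0 Wd Wk]] := hk (param c v) c c ca ca cx hx.
rewrite paramK// in W0.
exists W; split; [exact: Wo|exact: W0|exact: Wd|split; first exact: Wk].
move=> v' i W'.
have D := time_slice ((Ck_entry 0 i Wo (Wk 1%N)).1 _ W').
split; last by rewrite -(derive_val (is_derive := D)).
by apply: DeriveDef; first exact: ex_derive.
Qed.

Lemma velocity_C1 c i : atlas c -> Ck 1 (img c) (velocity c i).
Proof.
move=> ca; apply: Ck_local => v cv.
have [W [Wo W0 _ [Wk WE]]] := local ca cv.
exists [set v | W (0, v)] => //.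
have So : open [set v : 'rV[R]_m | W (0, v)].
  apply: open_near => v' /= Wv; exact: (near_slice (x := (0 : R^o)) (open_nbhs_nbhs (conj Wo Wv))).
have Dk : Ck 1 W (fun w => 'D_((1 : R^o, 0)) (fun w => hc c w 0 i : R^o) w).
  exact: (Ck_entry 0 i Wo (Wk 2%N)).2.
apply: Ck_ext (Ck_slice Wo Dk) => // v' Wv'.
by rewrite (WE v' i Wv').2.
Qed.

(** The derivative Y f of [f] along the velocity field Y, by the chain rule at time 0. *)
Let along c (f : 'rV[R]_m -> R^o) u : atlas c -> img c u -> Ck 1 (img c) f ->
  is_derive (0 : R^o) 1 (fun t : R^o => f (hc c (t, u)))
    (\sum_l velocity c l u * 'D_(delta_mx 0 l) f u : R^o).
Proof.
move=> ca cu fk; have [W [Wo W0 Wd [Wk WE]]] := local ca cu.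
have E0 : hc c (0, u) = u by rewrite /hc /= h0 paramK.
have dh : differentiable (hc c) (0, u) by exact: (Wk 1%N).1.
have df : differentiable f (hc c (0, u)) by rewrite E0; exact: fk.1.
have := time_slice (differentiable_comp dh df); rewrite derive_comp_row// E0.
congr (is_derive _ _ _ _).
by apply: eq_bigr => l _; rewrite -(WE _ l W0).2.
Qed.

Let near_time W u : open W -> W ((0 : R^o), u) -> \forall t \near (0 : R^o), W (t, u : 'rV[R]_m).
Proof.
move=> Wo W0; have Wn : \forall z \near ((0 : R^o), u), W (z.1, z.2).
  by apply: filterS (open_nbhs_nbhs (conj Wo W0)) => -[].
exact: (near_slice (near_swap (Q := fun t v => W (t, v)) Wn)).
Qed.

Lemma time_derivative_comp (rho : M -> R) c x : atlas c -> dom c x ->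
  Ck 1 (img c) (fun v => rho (param c v) : R^o) ->
  time_derivative (fun t y => rho (h t y)) x =
  \sum_l velocity c l (c x) * 'D_(delta_mx 0 l) (fun v => rho (param c v) : R^o) (c x).
Proof.
move=> ca cx rk; have cu := coord_img cx.
have [W [Wo W0 Wd _]] := local ca cu.
have D := along ca cu rk.
have H : \forall t \near (0 : R^o), rho (param c (hc c (t, c x))) = rho (h t x).
  apply: filterS (near_time Wo W0) => t /Wd[_ _]; rewrite /hc /= coordK// => td.
  by rewrite coordK.
have D' := near_eq_is_derive H D.
by rewrite /time_derivative (derive_val (is_derive := D')).
Qed.

Let q t x : R := \tr (pull_tensor g g x (h t x) (tangent_map (h t) x)).

(** In the chart the trace is that of $J\,G(h_t)\,J^T G^{-1}$, where J is the spatial Jacobian of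
    [h t], equal to the identity at time 0, and the last factor, the metric at the fixed point x, is
    constant in time. The two factors J contribute the divergence of the components of Y, the metric
    at the moving point its derivative along Y. The total is 2 div Y. *)
Lemma time_derivative_trace c x : atlas c -> dom c x ->
  time_derivative q x =
  2 * (\sum_i 'D_(delta_mx 0 i) (velocity c i) (c x)) +
  \sum_l velocity c l (c x) *
    \tr (invmx (local_form c g (c x)) *m
      \matrix_(i, j) 'D_(delta_mx 0 l) (fun v => local_form c g v i j : R^o) (c x)).
Proof.
move=> ca cx; set u := c x; have cu : img c u := coord_img cx.
have [W [Wo W0 Wd [Wk WE]]] := local ca cu.
pose J w := space_jacobian (hc c) w; pose G := local_form c g u.
have Gu : G \in unitmx by apply: posdef_unit; exact: local_form_posdef.
have E0 : hc c (0, u) = u by rewrite /hc /= h0 paramK.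
pose Jd : 'M[R]_m := \matrix_(i, j) 'D_(delta_mx 0 i) (velocity c j) u.
pose Gd : 'M[R]_m :=
  \matrix_(i, j) \sum_l velocity c l u * 'D_(delta_mx 0 l) (fun v => local_form c g v i j : R^o) u.
have Jk : Ckmx 1 W J by exact: Ckmx_space_jacobian (Wk 2%N).
have HJ i j : is_derive (0 : R^o) 1 (fun t : R^o => J (t, u) i j : R^o) (Jd i j : R^o).
  have := time_slice ((Jk i j).1 _ W0); congr (is_derive _ _ _ _); rewrite mxE.
  pose f w : R^o := hc c w 0 j.
  have fk k : Ck k W f by exact: (Ck_entry 0 j Wo (Wk k)).
  transitivity ('D_((1 : R^o), 0) (fun w => 'D_((0 : R^o), delta_mx 0 i) f w : R^o) (0, u)).
    apply: near_eq_derive; apply: near_open Wo W0 _ => w Ww; rewrite mxE.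
    by rewrite derive_mx ?mxE//; apply: diff_derivable; exact: (Wk 1%N).1.
  (* Symmetry of second derivatives: the time derivative of the Jacobian is the Jacobian of the
     velocity. *)
  rewrite (schwarz _ _ Wo W0 (fk 2%N)) -(space_slice (((fk 2%N).2 _).1 _ W0)).2.
  apply: near_eq_derive.
  apply: filterS (near_slice (x := (0 : R^o)) (open_nbhs_nbhs (conj Wo W0))) => v Wv.
  by rewrite (WE v j Wv).2.
have HG i j : is_derive (0 : R^o) 1 (fun t : R^o => local_form c g (hc c (t, u)) i j : R^o)
    (Gd i j : R^o).
  by rewrite mxE; apply: along => //; exact: Ckmx_local_form.
have HC i j : is_derive (0 : R^o) 1 (fun t : R^o => invmx G i j : R^o) ((0 : 'M[R]_m) i j : R^o).
  by rewrite mxE; exact: is_derive_cst.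
have HJt i j : is_derive (0 : R^o) 1 (fun t : R^o => (J (t, u))^T i j : R^o) (Jd^T i j : R^o).
  have := HJ j i; rewrite mxE [Jd^T i j]mxE [Jd j i]mxE; congr (is_derive _ _ _ _).
  by apply/funext => t; rewrite [RHS]mxE.
have D := is_derive_trace (is_derive_mulmx (is_derive_mulmx (is_derive_mulmx HJ HG) HJt) HC).
have H : \forall t \near (0 : R^o),
    \tr (J (t, u) *m local_form c g (hc c (t, u)) *m (J (t, u))^T *m invmx G) = q t x.
  apply: filterS (near_time Wo W0) => t Wt; have [te _ td] := Wd _ Wt.
  have ux : param c u = x by exact: coordK.
  rewrite /= ux in te td.
  have dh : differentiable (hc c) (t, u) by exact: (Wk 1%N).1.
  have LE := local_tangent_map sh te ca ca cx td dh.
  have := pull_tensor_local g g (tangent_map (h t) x) ca ca cx td.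
  rewrite /= -LE /J /hc /= ux => ->.
  by rewrite mxtrace_mulC mulmxA mulVmx ?mul1mx// frame_unit.
have J0 : J (0, u) = 1%:M.
  apply/matrixP => i j; rewrite !mxE -(space_slice ((Wk 1%N).1 _ W0)).2.
  have -> : 'D_(delta_mx 0 i) (fun v => hc c (0, v)) u = 'D_(delta_mx 0 i) id u.
    apply: near_eq_derive.
    apply: filterS (near_slice (x := (0 : R^o)) (open_nbhs_nbhs (conj Wo W0))) => v /Wd[_ cv _].
    by rewrite /hc /= h0 paramK.
  by rewrite derive_id mxE eqxx /= eq_sym.
rewrite /time_derivative (derive_val (is_derive := near_eq_is_derive H D)).
rewrite J0 E0 -/G trmx1 !mulmx0 !mul1mx !mulmx1 addr0 !mulmxDl !mxtraceD mulmxK//.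
have -> : \tr (G *m Jd^T *m invmx G) = \tr Jd.
  by rewrite mxtrace_mulC mulmxA mulVmx// mul1mx mxtrace_tr.
have -> : \tr Jd = \sum_i 'D_(delta_mx 0 i) (velocity c i) u.
  by apply: eq_bigr => i _; rewrite mxE.
have -> : \tr (Gd *m invmx G) = \sum_l velocity c l u *
    \tr (invmx G *m \matrix_(i, j) 'D_(delta_mx 0 l) (fun v => local_form c g v i j : R^o) u).
  have -> : Gd = \sum_l velocity c l u *:
      (\matrix_(i, j) 'D_(delta_mx 0 l) (fun v => local_form c g v i j : R^o) u : 'M[R]_m).
    apply/matrixP => i j; rewrite mxE summxE; apply: eq_bigr => l _.
    by rewrite !mxE.
  rewrite mulmx_suml raddf_sum /=; apply: eq_bigr => l _.
  by rewrite -scalemxAl mxtraceZ mxtrace_mulC.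
by move: (\sum_i _) (\sum_l _) => a b; ring.
Qed.

End Velocity.

(** * The divergence theorem *)

Section DivergenceTheorem.
Context {R : realType} {m : nat} {M : manifold R m}.

Definition C1_fun (rho : M -> R) : Prop :=
  forall c, atlas c -> Ck 1 (img c) (fun v => rho (param c v) : R^o).

(** Two radii: the function lives in the ball of radius r, while the grid fills the larger ball of
    radius r', still inside the chart, and [rho] vanishes on the faces of the grid. *)
Definition chart_supported (c : chart R M m) (rho : M -> R) : Prop :=
  exists u0 r r', [/\ 0 < r, r < r', forall v, `|v - u0| <= r' -> img c v &
    forall x, rho x != 0 -> dom c x /\ `|c x - u0| < r].

Lemma chart_supported_near0 (c : chart R M m) (rho : M -> R) x :
  chart_supported c rho -> ~ dom c x -> \forall y \near x, rho y = 0.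
Proof.
move=> [u0 [r [r' [r0 rr' ball_img supp]]]] cx.
have ball_img' v : `|v - u0| <= r -> img c v.
  by move=> vr; apply: ball_img; exact: le_trans vr (ltW rr').
have Kc := closed_chart_ball ball_img'; set K := (X in closed X) in Kc.
have Kx : ~ K x by move=> [v /= vr vx]; apply: cx; rewrite -vx; apply: param_dom; exact: ball_img'.
apply: filterS (open_nbhs_nbhs (conj (closed_openC Kc) Kx)) => y Ky.
apply/eqP; apply: contraPT Ky => /supp[cy yr] Ky; apply: Ky; exists (c y); first exact: ltW.
exact: coordK.
Qed.

Lemma C1_fun_continuous (rho : M -> R) : C1_fun rho -> continuous (rho : M -> R^o).
Proof.
move=> rk x; have ca := chart_at_atlas x; have cx := chart_at_dom x.
set c := chart_at x in ca cx; have cu := coord_img cx.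
have H : \forall y \near x, rho (param c (c y)) = rho y.
  by apply: filterS (open_nbhs_nbhs (conj (open_dom c) cx)) => y cy; rewrite coordK.
rewrite /continuous_at -{2}(coordK cx); apply: cvg_trans (near_eq_cvg H) _.
apply: (@continuous_comp _ _ _ c (fun v => rho (param c v) : R^o)); first exact: coord_at.
exact: Ck_continuous (rk c ca) cu.
Qed.

Lemma Ck1_is_derive (V : normedModType R) (U : set V) (f : V -> R^o) x v :
  Ck 1 U f -> U x -> is_derive x v f ('D_v f x).
Proof. by move=> fk Ux; apply: DeriveDef => //; apply: diff_derivable; exact: fk.1. Qed.

(* The square of s + |s| makes the cutoff differentiable where s = 0. *)
Definition bump (c : chart R M m) (u0 : 'rV[R]_m) (r : R) (x : M) : R :=
  let s := r ^+ 2 - \sum_j (c x 0 j - u0 0 j) ^+ 2 in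
  if `[< dom c x >] then (s + `|s|) ^+ 2 else 0.

Lemma bump_ge0 c u0 r x : 0 <= bump c u0 r x.
Proof. by rewrite /bump; case: asboolP => // _; rewrite sqr_ge0. Qed.

Lemma bump_gt0 c u0 r x : 0 < r -> dom c x -> c x = u0 -> 0 < bump c u0 r x.
Proof.
move=> r0 cx cu; rewrite /bump asboolT// big1 => [|j _]; last by rewrite cu subrr expr0n.
rewrite subr0 exprn_gt0// ltr_pwDl// exprn_gt0//.
Qed.

(** The bump lives on a Euclidean ball, which lies in the ball of the same radius for the maximum
    norm. *)
Lemma bump_support c u0 r x : 0 < r -> bump c u0 r x != 0 -> dom c x /\ `|c x - u0| < r.
Proof.
move=> r0; rewrite /bump; case: asboolP => [cx|]; last by rewrite eqxx.
set S := \sum_j _ => h; split=> //.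
have S0 : 0 <= S by apply: sumr_ge0 => j _; exact: sqr_ge0.
have Sr : S < r ^+ 2.
  rewrite ltNge; apply: contraNN h => rS; rewrite ler0_norm ?subr_le0//.
  by rewrite subrr expr0n.
apply: (@le_lt_trans _ _ (Num.sqrt S)); last first.
  by rewrite -[ltRHS](ger0_norm (ltW r0)) -sqrtr_sqr ltr_sqrt// exprn_gt0.
apply: norm_rV_le => [|j]; first exact: sqrtr_ge0.
rewrite !mxE -sqrtr_sqr ler_sqrt// /S (bigD1 j)//= lerDl.
by apply: sumr_ge0 => i _; exact: sqr_ge0.
Qed.

Lemma bump_chart_supported c u0 r r' : 0 < r -> r < r' ->
  (forall v, `|v - u0| <= r' -> img c v) -> chart_supported c (bump c u0 r).
Proof. by move=> r0 rr' H; exists u0, r, r'; split=> // x; exact: bump_support. Qed.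

(** In another chart, near a point of [dom c] this is a transition map followed by a C^1 function;
    near any other point the bump is zero. *)
Lemma bump_C1 c u0 r r' : atlas c -> 0 < r -> r < r' ->
  (forall v, `|v - u0| <= r' -> img c v) -> C1_fun (bump c u0 r).
Proof.
move=> ca r0 rr' H b ba; have supp := bump_chart_supported r0 rr' H.
apply: Ck_local => v bv; have bx := param_dom bv.
have [cx|cx] := pselect (dom c (param b v)).
  pose U := b @` (dom b `&` dom c); have Uo : open U by apply: open_chart_image; exact: open_dom.
  have UE w : U w -> dom c (param b w) by rewrite /U chart_image => -[].
  exists U; first by rewrite /U chart_image.
  have tk j : Ck 1 U (fun w => c (param b w) 0 j : R^o).
    by apply: Ck_entry => //; exact: (atlas_compat ba ca).
  have sk := Ck_sub_fun Uo (Ck_cst 1 U (r ^+ 2 : R^o)) (Ck_sum (index_enum 'I_m) predT Uo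
    (fun j => Ck_mul Uo (Ck_sub_fun Uo (tk j) (Ck_cst 1 U (u0 0 j : R^o)))
                        (Ck_sub_fun Uo (tk j) (Ck_cst 1 U (u0 0 j : R^o))))).
  apply: Ck_ext (Ck_bump Uo sk) => // w /UE cw.
  by rewrite /bump asboolT.
have := near_chart bx (chart_supported_near0 supp cx); rewrite paramK// => n0.
move: n0; rewrite /prop_near1 nbhsE /= => -[V [Vo Vv] V0].
exists V => //; apply: Ck_ext (Ck_cst 1 V (0 : R^o)) => // w /V0[_ ->] //.
Qed.

(** The sets where the bumps are positive cover [M]. The sum over a finite subcover is positive
    everywhere, and dividing by it does not enlarge supports. *)
Lemma partition_of_unity : compact [set: M] ->
  exists (s : seq M) (rho : M -> M -> R), [/\ forall a, C1_fun (rho a),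
    forall a, chart_supported (chart_at a) (rho a) &
    forall x, \sum_(a <- s) rho a x = 1].
Proof.
move=> cM.
have loc (a : M) : exists r : R, 0 < r /\
    forall v, `|v - chart_at a a| <= r -> img (chart_at a) v.
  by have [r r0 Hr] := chart_radius a; exists r.
have [rad Hrad] := choice loc.
(* Half of the admissible radius for the bump leaves the margin that [chart_supported] demands. *)
have rad2 a : 0 < rad a / 2 /\ rad a / 2 < rad a by have [] := Hrad a; lra.
pose psi a := bump (chart_at a) (chart_at a a) (rad a / 2).
have psi_C1 a : C1_fun (psi a).
  exact: (bump_C1 (chart_at_atlas a) (rad2 a).1 (rad2 a).2 (Hrad a).2).
have psi_supp a : chart_supported (chart_at a) (psi a).
  exact: (bump_chart_supported (rad2 a).1 (rad2 a).2 (Hrad a).2).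
pose U a := [set x | 0 < psi a x].
have Uo a : open (U a).
  have -> : U a = psi a @^-1` [set y : R | 0 < y] by [].
  by apply: open_comp; [move=> x _; exact: (C1_fun_continuous (psi_C1 a))|exact: open_gt].
move: (cM); rewrite compact_cover => /(_ M setT U).
case=> [a _|x _|D _ DM]; first exact: Uo.
  by exists x => //; apply: bump_gt0; [exact: (rad2 x).1|exact: chart_at_dom|].
pose s := finmap.enum_fset D; pose Psi x := \sum_(a <- s) psi a x.
have Psi_gt0 x : 0 < Psi x.
  have [a /= aD ax] := DM x I; rewrite /Psi (big_rem a)//= ltr_pwDl//.
  by apply: sumr_ge0 => b _; exact: bump_ge0.
have Psi_C1 : C1_fun Psi.
  move=> c ca; apply: Ck_sum; [exact: Defs.open_img|move=> a; exact: psi_C1].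
exists s, (fun a x => psi a x / Psi x); split=> [a c ca|a|x].
- have io := @Defs.open_img _ _ _ c.
  apply: Ck_mul => //; first exact: psi_C1.
  by apply: Ck_inv => [//|v _|]; [rewrite gt_eqF|exact: Psi_C1].
- have [u0 [r [r' [r0 rr' H supp]]]] := psi_supp a.
  exists u0, r, r'; split=> // x px; apply: supp; apply: contraNneq px => ->.
  by rewrite mul0r.
by rewrite -mulr_suml -/(Psi x) divff// gt_eqF// Psi_gt0.
Qed.

(** * Localising the divergence of the velocity *)

Section Weighted.
Variables (g : metric M) (vol : {measure set (borel M) -> \bar R}) (e : R) (h : R -> M -> M).
Hypothesis hvol : is_volume g vol.
Hypothesis cM : compact [set: M].
Hypothesis sh : smooth_family e h.
Hypothesis h0 : forall x, h 0 x = x.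

Let q t x : R := \tr (pull_tensor g g x (h t x) (tangent_map (h t) x)).

Definition weighted_divergence (rho : M -> R) (x : M) : R :=
  rho x * (time_derivative q x / 2) + time_derivative (fun t y => rho (h t y)) x.

(* [weighted_divergence rho] is rho div Y + Y rho = div (rho Y), for Y the
   velocity of h; in a chart, the divergence of a field Z is
   w^-1 sum_i D_i (w Z_i) with w the density. *)
Let flux c (rho : M -> R) i (v : 'rV[R]_m) : R^o :=
  rho (param c v) * (velocity h c i v * density g c v).

Let flux_C1 c rho i : atlas c -> C1_fun rho -> Ck 1 (img c) (flux c rho i).
Proof.
move=> ca rk; have io := @Defs.open_img _ _ _ c.
apply: Ck_mul => //; first exact: rk.
by apply: Ck_mul => //; [exact: (velocity_C1 sh)|exact: density_C1].
Qed.

(** Inside the chart this is the product rule for rho, the velocity component and the density, the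
    last differentiated by Jacobi's formula. Outside, rho vanishes in a neighbourhood and both sides
    are 0. *)
Lemma weighted_divergenceE c rho x : atlas c -> C1_fun rho -> chart_supported c rho ->
  weighted_divergence rho x = \sum_i chart_divergence g c (flux c rho i) i x.
Proof.
move=> ca rk supp; have [cx|cx] := pselect (dom c x); last first.
  have n0 := chart_supported_near0 supp cx.
  rewrite big1 => [|i _]; last by rewrite /chart_divergence asboolF.
  have ba := chart_at_atlas x; have bx := chart_at_dom x.
  rewrite /weighted_divergence (nbhs_singleton n0) mul0r add0r.
  rewrite (time_derivative_comp sh h0 ba bx (rk _ ba)) big1// => l _.
  have -> : 'D_(delta_mx 0 l) (fun v => rho (param (chart_at x) v) : R^o) (chart_at x x) = 0.
    rewrite -(derive_cst (0 : R^o) (chart_at x x) (delta_mx 0 l)).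
    by apply: near_eq_derive; apply: filterS (near_chart bx n0) => u [].
  by rewrite mulr0.
have cu := coord_img cx; have io := @Defs.open_img _ _ _ c.
rewrite /weighted_divergence (time_derivative_comp sh h0 ca cx (rk _ ca)).
rewrite (time_derivative_trace g sh h0 ca cx).
pose rc v : R^o := rho (param c v); pose T l := \tr (invmx (local_form c g (c x)) *m
  \matrix_(i, j) 'D_(delta_mx 0 l) (fun v => local_form c g v i j : R^o) (c x)).
have -> : \sum_i chart_divergence g c (flux c rho i) i x = \sum_i
    ('D_(delta_mx 0 i) rc (c x) * velocity h c i (c x)
     + rho x * 'D_(delta_mx 0 i) (velocity h c i) (c x)
     + rho x * (velocity h c i (c x) * T i) / 2).
  apply: eq_bigr => i _; rewrite /chart_divergence asboolT//.
  have w0 : density g c (c x) != 0 by rewrite gt_eqF// density_gt0.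
  have Dv := Ck1_is_derive (delta_mx 0 i) (velocity_C1 sh h0 i ca) cu.
  have Dr := Ck1_is_derive (delta_mx 0 i) (rk _ ca) cu.
  have Dw := Ck1_is_derive (delta_mx 0 i) (density_C1 g ca) cu.
  rewrite (derive_val (is_derive := is_derive_mul Dr (is_derive_mul Dv Dw))).
  have -> : 'D_(delta_mx 0 i) (density g c : _ -> R^o) (c x) = density g c (c x) / 2 * T i.
    apply: (derive_sqrt_det (U := img c)) => //; last exact: Ckmx_local_form.
    by move=> y cy; apply: det_posdef; exact: local_form_posdef.
  rewrite (coordK cx) -/rc; move: w0; move: (density _ _ _) (velocity _ _ _ _) (rho x) (T i).
  move: ('D_ _ rc _) ('D_ _ (velocity _ _ _) _) => a b w v s t w0; field.
  exact: w0.
rewrite !big_split /= -mulr_sumr -mulr_suml -mulr_sumr.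
under [X in _ = X + _ + _]eq_bigr do rewrite mulrC.
have F (a b d s : R) : s * ((2 * a + b) / 2) + d = d + s * a + s * b / 2 by field.
exact: F.
Qed.

Lemma integral_weighted_divergence c rho : atlas c -> C1_fun rho -> chart_supported c rho ->
  bounded_measurable (weighted_divergence rho : borel M -> R) /\
  \int[vol]_x weighted_divergence rho x = 0.
Proof.
move=> ca rk supp.
have -> : weighted_divergence rho = fun x => \sum_i chart_divergence g c (flux c rho i) i x.
  by apply/funext => x; exact: weighted_divergenceE.
have [u0 [r [r' [r0 rr' ball_img sup]]]] := supp.
have f0 i v : img c v -> r <= `|v - u0| -> flux c rho i v = 0.
  move=> cv rv; rewrite /flux; have [->|/sup[_]] := eqVneq (rho (param c v)) 0.
    by rewrite mul0r.
  by rewrite paramK// ltNge rv.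
have fk i := flux_C1 i ca rk.
have H i : bounded_measurable (chart_divergence g c (flux c rho i) i : borel M -> R).
  apply: continuous_bounded_measurable => //.
  exact: (chart_divergence_continuous ca rr' ball_img (fk i) (f0 i)).
have [bs ->] := bounded_measurable_sum (volume_finite hvol cM) (index_enum _) H.
split; first exact: bs.
rewrite big1// => i _.
exact: (integral_chart_divergence hvol cM i ca r0 rr' ball_img (fk i) (f0 i)).
Qed.

(** Summing div (rho_a Y) = rho_a div Y + Y rho_a over a partition of unity gives div Y, since the
    sum of the rho_a is constant and Y annihilates it. *)
Lemma integral_divergence :
  bounded_measurable (time_derivative q : borel M -> R) /\
  \int[vol]_x time_derivative q x = 0.
Proof.
have [s [rho [rk supp rho1]]] := partition_of_unity cM.
have qE : time_derivative q = fun x => 2 * \sum_(a <- s) weighted_divergence (rho a) x.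
  apply/funext => x; rewrite big_split /= -mulr_suml rho1 mul1r.
  have -> : \sum_(a <- s) time_derivative (fun t y => rho a (h t y)) x = 0; last first.
    by rewrite addr0 mulrC divfK.
  have ca := chart_at_atlas x; have cx := chart_at_dom x; set c := chart_at x in ca cx.
  have cu := coord_img cx.
  under eq_bigr do rewrite (time_derivative_comp sh h0 ca cx (rk _ _ ca)).
  rewrite exchange_big big1//= => l _; rewrite -mulr_sumr.
  have D a := Ck1_is_derive (delta_mx 0 l) (rk a _ ca) cu.
  rewrite -(derive_val (is_derive := is_derive_bigsum s D)).
  have -> : (fun v => \sum_(a <- s) rho a (param c v) : R^o) = cst (1 : R^o).
    by apply/funext => v; rewrite rho1.
  by rewrite derive_cst mulr0.
have H a := integral_weighted_divergence (chart_at_atlas a) (rk a) (supp a).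
have vfin := volume_finite hvol cM.
have [bs Is] := bounded_measurable_sum vfin s (fun a => (H a).1).
rewrite qE; split; first exact: bounded_measurableZ.
rewrite RintegralZl//; last exact: bounded_measurable_integrable.
by rewrite Is big1 ?mulr0// => a _; exact: (H a).2.
Qed.

End Weighted.
End DivergenceTheorem.

(** * First variation of the energies *)

Section FirstVariation.
Context {R : realType}.

Lemma is_derive_littleo (f : R^o -> R^o) :
  (forall eta : R, 0 < eta -> \forall t \near (0 : R^o), `|f t - f 0| <= eta * `|t|) ->
  is_derive (0 : R^o) 1 f 0.
Proof.
move=> H; have lim0 : (fun t : R => t^-1 *: ((f \o shift (0 : R^o)) (t *: (1 : R^o)) - f 0))
    @ 0^' --> (0 : R^o).
  apply/cvgr0Pnorm_le => eta eta0; near=> t.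
  have t0 : t != 0 by near: t; exact: nbhs_dnbhs_neq.
  rewrite /= addr0 [t%:A]mulr1 normrZ normfV ler_pdivrMl ?normr_gt0// mulrC.
  by near: t; apply: nbhs_dnbhs; exact: H.
by apply: DeriveDef; [apply/cvg_ex; exists 0|exact: cvg_lim].
Unshelve. all: by end_near. Qed.

Context {m : nat} {M : manifold R m} (g : metric M).
Variable vol : {measure set (borel M) -> \bar R}.
Hypothesis hvol : is_volume g vol.
Hypothesis cM : compact [set: M].

(** [Phi t] is within eta |t| of [a + t * d], whose integral does not depend on t because [d]
    integrates to 0. Only [d] has to be measurable. *)
Lemma is_derive_integral (Phi : R -> M -> R) (a : R) (d : M -> R) :
  bounded_measurable (d : borel M -> R) -> \int[vol]_x d x = 0 ->
  (forall eta, 0 < eta -> \forall t \near (0 : R^o), forall x,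
     `|Phi t x - a - t * d x| <= eta * `|t|) ->
  is_derive (0 : R^o) 1 (fun t : R^o => 2^-1 * \int[vol]_x Phi t x : R^o) 0.
Proof.
move=> bd d0 H; have vfin := volume_finite hvol cM.
have V0 : 0 <= fine (vol setT) by rewrite fine_ge0.
(* At time 0 the uniform bound reads |Phi 0 x - a| <= 0. *)
have Phi0 : Phi 0 = fun=> a.
  apply/funext => x; apply/eqP; rewrite -subr_eq0 -normr_eq0 eq_le normr_ge0 andbT.
  by have := nbhs_singleton (H 1 ltr01) x; rewrite mul0r subr0 normr0 mulr0.
apply: is_derive_littleo => eta eta0.
have V1 : 0 < fine (vol setT) + 1 by rewrite ltr_wpDl.
apply: filterS (H (eta / (fine (vol setT) + 1)) (divr_gt0 eta0 V1)) => t Ht.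
have bc : bounded_measurable ((fun=> a) : borel M -> R) by exact: bounded_measurable_cst.
have btd := bounded_measurableZ t bd.
have C : `|\int[vol]_x Phi t x - \int[vol]_x (a + t * d x)| <=
    eta / (fine (vol setT) + 1) * `|t| * fine (vol setT).
  apply: (Rintegral_close vfin (g := fun x => a + t * d x)); last first.
    by move=> x; rewrite opprD addrA.
  exact: bounded_measurableD bc btd.
rewrite Phi0 -mulrBr normrM.
have -> : \int[vol]_x a = \int[vol]_x (a + t * d x).
  rewrite RintegralD//; first last.
  - exact: (bounded_measurable_integrable vfin btd).
  - exact: (bounded_measurable_integrable vfin bc).
  rewrite RintegralZl//; last exact: bounded_measurable_integrable.
  by rewrite d0 mulr0 addr0.
have C' : `|\int[vol]_x Phi t x - \int[vol]_x (a + t * d x)| <= eta * `|t|.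
  apply: le_trans C _.
  rewrite mulrAC ler_wpM2r// mulrAC ler_pdivrMr// ler_wpM2l ?(ltW eta0)//.
  by rewrite lerDl.
apply: le_trans C'; rewrite ler_piMl//.
by rewrite ger0_norm ?invr_ge0// invf_le1// ler1n.
Qed.

Context {n : nat} {P : manifold R n} (k : metric P) (pr : P -> M).
Hypothesis hpr : submersion pr.
Implicit Types (sigma : M -> P) (F : R -> M -> P).

Let psd (y : P) (L : 'M[R]_(m, n)) : possemidef (L *m k y *m L^T).
Proof. by apply: possemidef_congr; apply: posdefW; exact: gram_posdef. Qed.

Lemma epsE r F t x : (r <= m)%N ->
  eps g k r (F t) x = eigsym r (pull_tensor g k x (F t x) (tangent_map (F t) x)).
Proof. by move=> rm; exact: (elem_sym_eigenvalues rm (psd _ _) (gram_posdef g x)). Qed.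

Lemma vepsE r F t x : (r <= m)%N ->
  veps g k pr r (F t) x = eigsym r (pull_tensor g k x (F t x) (vtangent_map k pr (F t) x)).
Proof. by move=> rm; exact: (elem_sym_eigenvalues rm (psd _ _) (gram_posdef g x)). Qed.

Lemma r_horizontal_r_harmonic r sigma : (1 <= r <= m)%N -> is_section pr sigma ->
  is_r_horizontal k pr r sigma -> r_harmonic_section g k pr vol r sigma.
Proof.
move=> /andP[r1 rm] sec rh e F vF _; have sF := variation_smooth_family vF.
have F0 : F 0 = sigma by apply/funext => x; case: vF.
apply: (is_derive_integral (a := 0) (d := fun=> 0)).
- exact: bounded_measurable_cst.
- by rewrite Rintegral_cst// mul0r.
move=> eta eta0.
have secF : is_section pr (F 0) by rewrite F0.
have PhiC1 := veps_C1 g k hpr sF secF (@eigsym_conj R m r) (fun W A => @Ck_eigsym R _ 1 W m r A).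
have Phi0 x : eigsym r (pull_tensor g k x (F 0 x) (vtangent_map k pr (F 0) x)) = 0.
  apply: eigsym_rank => //; rewrite F0; apply: leq_ltn_trans (rh x).
  (* The rank of a product is at most that of its leftmost factor, here the vertical derivative. *)
  by do 2!apply: leq_trans (mxrankM_maxl _ _) _; exact: mxrankM_maxl.
have Phi_ge0 : \forall t \near (0 : R^o), forall x,
    0 <= eigsym r (pull_tensor g k x (F t x) (vtangent_map k pr (F t) x)).
  by apply: filterE => t x; exact: (eigsym_ge0 rm (psd _ _) (gram_posdef g x)).
apply: filterS (nonneg_littleo cM PhiC1 Phi_ge0 Phi0 eta0) => t H x.
by rewrite vepsE// mulr0 !subr0.
Qed.

Lemma horizontal_r_harmonic r sigma : (1 <= r <= m)%N ->
  smooth_map sigma -> is_section pr sigma -> riemannian_submersion g k pr ->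
  is_horizontal k pr sigma -> r_harmonic_map g k vol r sigma.
Proof.
case: r => [//|r] /andP[_ rm] ssig sec [_ iso] hor e F vF.
have sF := variation_smooth_family vF; have [e0 Fd _] := sF.
have F0 : F 0 = sigma by apply/funext => x; case: vF.
pose h t := pr \o F t.
have sh : smooth_family e h by exact: (smooth_family_comp sF hpr.1).
have h0 x : h 0 x = x by rewrite /h /= F0 sec.
have m0 : (0 < m)%N by exact: leq_ltn_trans rm.
pose A t x := pull_tensor g k x (F t x) (tangent_map (F t) x).
pose B t x := pull_tensor g g x (h t x) (tangent_map (h t) x).
have hT t x : `|t| < e ->
    tangent_map (h t) x = tangent_map (F t) x *m tangent_map pr (F t x).
  move=> te; apply: (tangent_map_comp (Fd t x te) _).2.
  exact: smooth_map_differentiable hpr.1.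
have h1 x : tangent_map (h 0) x = 1%:M.
  by rewrite (_ : h 0 = id) ?tangent_map_id//; exact/funext.
(* The image of d sigma is horizontal, d pi is isometric there, and their composite is the identity
   since sigma is a section. *)
have A0 x : A 0 x = 1%:M.
  apply/esym/pull_tensorP => X Y; rewrite mulmx1.
  have H (Z : 'rV[R]_m) : (Z *m tangent_map (F 0) x <= horizontal k pr (F 0 x))%MS.
    apply: submx_trans (submxMl _ _) _.
    apply: (horizontal_vproj0 (gram_posdef k _) (hpr.2 _)).
    by rewrite F0; exact: hor.
  rewrite -(iso _ _ _ (H X) (H Y)) -!mulmxA -hT ?normr0// h1 !mulmx1.
  by rewrite (h0 x : pr (F 0 x) = x).
have B0 x : B 0 x = 1%:M.
  by rewrite /B /pull_tensor h1 h0 mul1mx trmx1 mulmx1 mulmxV// gram_unit.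
(* With L the differential of F t and T that of pi, the difference of the tensors is that of the
   form K - T G T^T pulled back by L, semidefinite by [submersion_psd]. *)
have trAB t x : `|t| < e -> 0 <= \tr (A t x) - \tr (B t x).
  move=> te; rewrite -raddfB /= /A /B /pull_tensor hT//.
  have E (L : 'M[R]_(m, n)) (K : 'M[R]_n) (T : 'M[R]_(n, m)) (G W : 'M[R]_m) :
      L *m K *m L^T *m W - L *m T *m G *m (L *m T)^T *m W =
      L *m (K - T *m G *m T^T) *m L^T *m W.
    by rewrite mulmxBr !mulmxBl trmx_mul !mulmxA.
  rewrite E.
  apply: (fun H => tr_ge0 H (gram_posdef g x)); apply: possemidef_congr.
  apply: (submersion_psd (gram_posdef k _) (hpr.2 _) (gram_sym g _)) => u v.
  exact: iso.
have trconj (U A' : 'M[R]_m) : U \in unitmx -> \tr (U *m A' *m invmx U) = \tr A'.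
  by move=> Uu; rewrite mxtrace_mulC mulmxA mulVmx// mul1mx.
have trC1 W (A' : R^o * 'rV[R]_m -> 'M[R]_m) : open W -> Ckmx 1 W A' ->
    Ck 1 W (fun w => \tr (A' w) : R^o) by exact: Ck_trace.
have sqC1 W (A' : R^o * 'rV[R]_m -> 'M[R]_m) : open W -> Ckmx 1 W A' ->
    Ck 1 W (fun w => sqdev (A' w) : R^o) by exact: Ck_sqdev.
have QC1 : C1_family (fun t x => sqdev (A t x)).
  exact: (pull_tensor_C1 g _ sF (@sqdev_conj R m) sqC1).
have AC1 : C1_family (fun t x => \tr (A t x)) by exact: (pull_tensor_C1 g _ sF trconj trC1).
have BC1 : C1_family (fun t x => \tr (B t x)) by exact: (pull_tensor_C1 g _ sh trconj trC1).
have [bq q0] := integral_divergence hvol cM sh h0.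
rewrite -/B in bq q0; pose q := time_derivative (fun t x => \tr (B t x)).
pose b : R := 'C(m.-1, r)%:R.
have b0 : 0 <= b by exact: ler0n.
have [K K0 HK] := @eigsym_near1 R m r rm.
apply: (is_derive_integral (a := 'C(m, r.+1)%:R) (d := fun x => b * q x)).
- exact: bounded_measurableZ.
- rewrite RintegralZl//; first by rewrite q0 mulr0.
  exact: (bounded_measurable_integrable (volume_finite hvol cM) bq).
(* In units of z |t|: K accounts for the quadratic remainder, 2 b for the two errors in the trace
   (passing from F t to h t, then expanding in t), and 1 makes the denominator positive. *)
move=> eta eta0; pose z := eta / (K + 2 * b + 1).
have D0 : 0 < K + 2 * b + 1 by rewrite ltr_wpDl// addr_ge0// mulr_ge0.
have z0 : 0 < z by rewrite divr_gt0.
have te : \forall t \near (0 : R^o), `|t| < e.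
  by apply/nbhs_normP; exists e => // t /=; rewrite sub0r normrN.
(* Secures the condition [sqdev <= 1] of [eigsym_near1] for small t, uniformly on M. *)
have tz : \forall t \near (0 : R^o), z * `|t| <= 1.
  apply/nbhs_normP; exists z^-1; rewrite /= ?invr_gt0// => t /=.
  by rewrite sub0r normrN => /ltW tz; rewrite mulrC -ler_pdivlMr// mul1r.
have Q_ge0 : \forall t \near (0 : R^o), forall x, 0 <= sqdev (A t x).
  by apply: filterE => t x; exact: (sqdev_ge0 m0 (psd _ _) (gram_posdef g x)).
have Q0 x : sqdev (A 0 x) = 0 by rewrite A0 sqdev1.
have AB_ge0 : \forall t \near (0 : R^o), forall x, 0 <= \tr (A t x) - \tr (B t x).
  by apply: filterS te => t te' x; exact: trAB.
have AB0 x : \tr (A 0 x) - \tr (B 0 x) = 0 by rewrite A0 B0 subrr.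
have HQ := nonneg_littleo cM QC1 Q_ge0 Q0 z0.
have HAB := nonneg_littleo cM (C1_familyB AC1 BC1) AB_ge0 AB0 z0.
have HB := uniform_expansion cM BC1 z0.
have HQz : \forall t \near (0 : R^o), (forall x, `|sqdev (A t x)| <= z * `|t|) /\ z * `|t| <= 1.
  by apply: filterS2 HQ tz.
have HABB : \forall t \near (0 : R^o), (forall x, `|\tr (A t x) - \tr (B t x)| <= z * `|t|) /\
    forall x, `|\tr (B t x) - \tr (B 0 x) - t * q x| <= z * `|t|.
  by apply: filterS2 HAB HB.
apply: filterS2 HQz HABB => t [h2 h3] [h4 h5] x.
rewrite epsE// -/(A t x).
have sq : sqdev (A t x) <= z * `|t| := le_trans (ler_norm _) (h2 x).
have := HK _ _ (psd (F t x) (tangent_map (F t) x)) (gram_posdef g x).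
move=> /(_ (le_trans sq h3)); rewrite -/b -/(A t x) => h6.
have := h4 x; have := h5 x; rewrite B0 mxtrace1 => h7 h8.
have {}h6 := le_trans h6 (ler_wpM2l K0 sq).
have -> : eta * `|t| = (K + 2 * b + 1) * (z * `|t|).
  by rewrite mulrA /z mulrCA divff ?mulr1// gt_eqF.
have zt : 0 <= z * `|t| by rewrite mulr_ge0// ltW.
have {h7 h8} h9 : `|\tr (A t x) - m%:R - t * q x| <= 2 * (z * `|t|).
  move: h7 h8; rewrite !ler_norml; move: (\tr (A t x)) (\tr _) (t * q x) (z * _).
  by move=> *; lra.
have {}h9 : `|b * (\tr (A t x) - m%:R) - t * (b * q x)| <= 2 * b * (z * `|t|).
  rewrite mulrCA -mulrBr normrM (ger0_norm b0) [2 * b]mulrC -mulrA.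
  exact: ler_wpM2l.
move: h6 h9 zt; rewrite !ler_norml.
move: (eigsym _ _) (b * (\tr _ - _)) (t * (b * _)) (z * _) => s1 s2 s3 s4.
by rewrite !mulrDl mul1r; move: (K * s4) (2 * b * s4) => s5 s6; lra.
Qed.

End FirstVariation.

Theorem theorem3p13 (R : realType) (m n : nat)
    (M : manifold R m) (P : manifold R n) (g : metric M) (k : metric P)
    (vol : {measure set (borel M) -> \bar R}) (hvol : is_volume g vol)
    (hM : compact [set: M])
    (pr : P -> M) (hpr : submersion pr)
    (sigma : M -> P) (hsigma : smooth_map sigma)
    (hsection : is_section pr sigma) :
  (forall r : nat, (1 <= r <= m)%N ->
     is_r_horizontal k pr r sigma -> r_harmonic_section g k pr vol r sigma) /\
  (riemannian_submersion g k pr -> totally_geodesic_fibres k pr ->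
     is_horizontal k pr sigma ->
     forall r : nat, (1 <= r <= m)%N -> r_harmonic_map g k vol r sigma).
Proof.
split=> [r r1m|rsub _ hor r r1m].
  exact: r_horizontal_r_harmonic.
exact: (horizontal_r_harmonic hvol hM hpr r1m hsigma hsection rsub hor).
Qed.
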